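(* Let $\mathcal{E}$ denote either the set of nonnegative even integers $\{0,2,4,\ldots\}$ or the set of positive odd integers $\{1,3,5,\ldots\}$, and let $\beta\in\mathbb{C}$ with $\beta\neq0$. Then the pair $(\mathcal{E},\beta)$ has neither the deep interpolation property nor the deep sampling property.
   Context: $\mathbb{N}_0:=\{0,1,2,\ldots\}$, and for $\mathcal{E}\subset\mathbb{N}_0$ put $\mathcal{E}^c:=\mathbb{N}_0\setminus\mathcal{E}$. The Bargmann-Fock space $\mathscr{F}(\mathbb{C})$ is the Hilbert space of all entire functions $f:\mathbb{C}\to\mathbb{C}$ with \[ \|f\|^2_{\mathscr{F}(\mathbb{C})}:=\int_{\mathbb{C}}|f(z)|^2\,e^{-|z|^2}\,\mathrm{dA}(z)<+\infty,\qquad \mathrm{dA}(z):=\pi^{-1}\,\mathrm{d}x\,\mathrm{d}y,\quad z=x+\mathrm{i}y. \] For $\beta\in\mathbb{C}$, the Fock translate of $f\in\mathscr{F}(\mathbb{C})$ is \[ \mathbf{U}_\beta f(z):=e^{-\frac12|\beta|^2+\bar\beta z}f(z-\beta),\qquad z\in\mathbb{C}, \] and $\mathbf{U}_\beta$ is a unitary operator on $\mathscr{F}(\mathbb{C})$. Here $g^{(j)}(0)$ denotes the $j$-th complex derivative of $g$ at $0$. Deep interpolation property of $(\mathcal{E},\beta)$: for all complex numbers $a_j$ ($j\in\mathcal{E}$) and $b_j$ ($j\in\mathcal{E}^c$) with \[ \sum_{j\in\mathcal{E}}\frac{|a_j|^2}{j!}+\sum_{j\in\mathcal{E}^c}\frac{|b_j|^2}{j!}<+\infty,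 \] there exists $f\in\mathscr{F}(\mathbb{C})$ such that $f^{(j)}(0)=a_j$ for all $j\in\mathcal{E}$ and $(\mathbf{U}_\beta f)^{(j)}(0)=b_j$ for all $j\in\mathcal{E}^c$. Deep sampling property of $(\mathcal{E},\beta)$: there exists a constant $\epsilon>0$ such that for all $f\in\mathscr{F}(\mathbb{C})$, \[ \sum_{j\in\mathcal{E}}\frac{|f^{(j)}(0)|^2}{j!}+\sum_{j\in\mathcal{E}^c}\frac{|(\mathbf{U}_\beta f)^{(j)}(0)|^2}{j!}\ge\epsilon\,\|f\|^2_{\mathscr{F}(\mathbb{C})}. \] *)

(* Defs.v *)
From mathcomp Require Export all_boot all_order all_algebra complex.
From mathcomp Require Export all_classical all_reals all_analysis.
Import Order.TTheory GRing.Theory Num.Theory.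
Import numFieldNormedType.Exports.

Set Implicit Arguments.
Unset Strict Implicit.
Unset Printing Implicit Defensive.

Local Open Scope classical_set_scope.
Local Open Scope complex_scope.
Local Open Scope ring_scope.

Section Fock.
Context {R : realType}.
Implicit Types (f : R[i] -> R[i]) (beta z : R[i]) (E : set nat).

(* R[i]^o is R[i] as a normed module over the field R[i] itself, so the
   derivative in the direction 1 below is the complex derivative. *)
Definition entire f : Prop :=
  forall z, derivable (f : R[i]^o -> R[i]^o) z 1.

Definition cderivn (n : nat) f (z : R[i]) : R[i] :=
  @derive1n R[i] R[i]^o n f z.

(* the square of the modulus, as an element of R rather than R[i] *)
Definition sqmod z : R := Normc.normc z ^+ 2.

Definition cexp z : R[i] :=
  (expR (complex.Re z) * cos (complex.Im z))
    +i* (expR (complex.Re z) * sin (complex.Im z)).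

(* the integral of F against dA = pi^-1 dx dy *)
Definition area_integral (F : R[i] -> \bar R) : \bar R :=
  ((pi^-1)%:E *
   \int[lebesgue_measure \x lebesgue_measure]_(p in [set: R * R])
     F (p.1 +i* p.2))%E.

Definition fock_sqnorm f : \bar R :=
  area_integral (fun z => (sqmod (f z) * expR (- sqmod z))%:E).

Definition fock : set (R[i] -> R[i]) :=
  [set f | entire f /\ (fock_sqnorm f < +oo)%E].

Definition fock_translate beta f : R[i] -> R[i] :=
  fun z => cexp (- (2^-1 * `|beta| ^+ 2) + beta^* * z) * f (z - beta).

(* the sum of |a_j|^2 / j! over j in E, with values in [0, +oo] *)
Definition weighted_sum E (a : nat -> R[i]) : \bar R :=
  \esum_(j in E) (sqmod (a j) / (j`!)%:R)%:E.

(* Only the values of a on E and of b on ~` E matter. *)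
Definition deep_interpolation E beta : Prop :=
  forall a b : nat -> R[i],
    (weighted_sum E a + weighted_sum (~` E) b < +oo)%E ->
    exists f, [/\ fock f,
      forall j, E j -> cderivn j f 0 = a j &
      forall j, (~` E) j -> cderivn j (fock_translate beta f) 0 = b j].

Definition deep_sampling E beta : Prop :=
  exists eps : R, 0 < eps /\
    forall f, fock f ->
      (eps%:E * fock_sqnorm f <=
       weighted_sum E (fun j => cderivn j f 0%R) +
       weighted_sum (~` E) (fun j => cderivn j (fock_translate beta f) 0%R))%E.

End Fock.

(* Main.v *)
Require Import Defs.
From mathcomp Require Import ring lra zify measurable_realfun.
Import Order.TTheory GRing.Theory Num.Theory.
Import numFieldNormedType.Exports.

Set Implicit Arguments.
Unset Strict Implicit.
Unset Printing Implicit Defensive.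

Local Open Scope classical_set_scope.
Local Open Scope complex_scope.
Local Open Scope ring_scope.

(** The translates k_t of the constant 1 by t * beta, with t real, form an orbit
    of Gaussian-like functions along the line R * beta, and the translation by
    beta maps k_t to k_(t+1).  Reflection about 0 maps k_t to k_(-t).  Both
    failures come from the fact that -1 is an approximate eigenvalue, but not an
    eigenvalue, of the translation by 2 * beta.

    Sampling.  Let f be the sum of (-1)^i k_(2i-n) over 0 <= i <= n
    ([test_fun]).  It has the parity of n.  If this parity is opposite to E, the
    derivatives f^(j)(0) with j in E vanish.  The translate of f is the sum of
    (-1)^i k_(2i-n+1); in its component of the parity of n all terms cancel in
    pairs except for the last one, so the second sum is at most 1.  But at the
    n + 1 points (2m - n + i sigma) * beta, with sigma |beta|^2 = pi / 2, the
    phases of the exponentials cancel the signs, and |f|^2 e^(-|z|^2) is bounded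
    below independently of n.  A local mean value inequality
    ([separated_lower_bound]) then shows that the squared norm of f is at least a
    constant times n + 1.

    Interpolation.  Take b = 0, and for a the derivatives of the series of the
    functions (-1)^m / m * k_(2m), m >= 1.  Since these functions are almost
    orthogonal, the data are square summable ([data_finite]).  If f
    interpolates, its component of the parity of E is known, and the translate
    of f has the parity of E.  The latter relates f(w) to f(- w - 2 beta), so
    the two together express f(w + 2 beta) through f(w) and the known
    component.  At the points w_k = (2k + i sigma) * beta this reads
    phi_(k+1) - phi_k >= c / (k+1) for the normalized real parts phi_k
    ([part_lower], [lattice_step]).  The harmonic series diverges, whereas point
    evaluations are bounded on Fock space ([fock_density_bound]).

    Both parts rest on complex function theory built from differentiability
    alone: Goursat's theorem on rectangles ([goursat]), Cauchy's formula
    ([cauchy_formula]), and the convergence of the Taylor series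
    ([taylor_cvg]), which also yields the measurability of entire functions and
    the fact that the derivatives at 0 determine the function.  The mean value
    inequality ([square_mean_value]) is obtained by averaging Cauchy's formula
    over the four sides of a rectangle. *)

Notation cRe := complex.Re.
Notation cIm := complex.Im.
Notation normc := Normc.normc.

(** * Complex numbers *)

Section Modulus.
Context {R : realType}.
Implicit Types (z w : R[i]).

Lemma sqmodE z : sqmod z = cRe z ^+ 2 + cIm z ^+ 2.
Proof. by case: z => a b; rewrite /sqmod /= sqr_sqrtr// addr_ge0 ?sqr_ge0. Qed.

Lemma normc_ge0 z : 0 <= normc z.
Proof. by case: z => a b; rewrite sqrtr_ge0. Qed.

Lemma normcE z : `|z| = (normc z)%:C.
Proof. by case: z. Qed.

Lemma normc_eq0 z : (normc z == 0) = (z == 0).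
Proof.
by apply/eqP/eqP => [/Normc.eq0_normc //|->]; exact: Normc.normc0.
Qed.

Lemma normc_gt0 z : (0 < normc z) = (z != 0).
Proof. by rewrite lt_neqAle normc_ge0 andbT eq_sym normc_eq0. Qed.

Lemma normc_Re z : `|cRe z| <= normc z.
Proof. by rewrite -lecR -normcE normc_ge_Re. Qed.

Lemma normc_Im z : `|cIm z| <= normc z.
Proof.
case: z => a b /=; rewrite -sqrtr_sqr ler_sqrt ?addr_ge0 ?sqr_ge0//.
by rewrite lerDr sqr_ge0.
Qed.

Lemma normc_leD z : normc z <= `|cRe z| + `|cIm z|.
Proof.
case: z => a b /=; rewrite -(@ger0_norm _ (`|a| + `|b|)) ?addr_ge0//.
rewrite -sqrtr_sqr ler_sqrt ?sqr_ge0// sqrrD !real_normK ?num_real//.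
by rewrite lerD2r lerDl mulrn_wge0// mulr_ge0.
Qed.

Lemma normcR (x : R) : normc x%:C = `|x|.
Proof. by rewrite /= expr0n addr0 sqrtr_sqr. Qed.

Lemma normci : normc ('i : R[i]) = 1.
Proof. by rewrite /= expr0n expr1n add0r sqrtr1. Qed.

Lemma normcX z n : normc (z ^+ n) = normc z ^+ n.
Proof. by elim: n => [|n IH]; rewrite ?expr0 ?Normc.normc1// !exprS Normc.normcM IH. Qed.

Lemma normcB z w : normc (z - w) = normc (w - z).
Proof. by rewrite -normcN opprB. Qed.

Lemma normc_lebB z w : normc z - normc w <= normc (z - w).
Proof. by rewrite lerBlDr -{1}(subrK w z); exact: le_normcD. Qed.

Lemma normc_sum (I : Type) (r : seq I) (P : pred I) (F : I -> R[i]) :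
  normc (\sum_(i <- r | P i) F i) <= \sum_(i <- r | P i) normc (F i).
Proof.
elim/big_ind2: _ => //; first by rewrite Normc.normc0.
by move=> ? ? ? ? h1 h2; exact: le_trans (le_normcD _ _) (lerD h1 h2).
Qed.

Lemma normcJ z : normc z^* = normc z.
Proof. by case: z => a b /=; rewrite sqrrN. Qed.

Lemma eq_complexP z w : cRe z = cRe w -> cIm z = cIm w -> z = w.
Proof. by case: z w => [a b] [c d] /= -> ->. Qed.

Lemma cReD z w : cRe (z + w) = cRe z + cRe w. Proof. by case: z w => [? ?] []. Qed.
Lemma cImD z w : cIm (z + w) = cIm z + cIm w. Proof. by case: z w => [? ?] []. Qed.
Lemma cReN z : cRe (- z) = - cRe z. Proof. by case: z. Qed.
Lemma cImN z : cIm (- z) = - cIm z. Proof. by case: z. Qed.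
Lemma cReM z w : cRe (z * w) = cRe z * cRe w - cIm z * cIm w.
Proof. by case: z w => [? ?] []. Qed.
Lemma cImM z w : cIm (z * w) = cRe z * cIm w + cIm z * cRe w.
Proof. by case: z w => [? ?] []. Qed.

Lemma complexC_E z : z = cRe z +i* cIm z. Proof. by case: z. Qed.

End Modulus.

(** * Complex differentiability *)

Section CDiff.
Context {R : realType}.
Implicit Types (f g : R[i] -> R[i]) (z w l m : R[i]).

(** Complex differentiability with real radii.  Everything below is estimated
    in the real-valued modulus, while the norm of R[i] takes values in R[i]. *)
Definition cdiff f z l := forall e : R, 0 < e -> exists2 d : R, 0 < d &
  forall h, normc h < d -> normc (f (z + h) - f z - l * h) <= e * normc h.

Lemma ball0P (P : R[i]^o -> Prop) (z : R[i]^o) :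
  (\forall x \near z, P x) <->
  exists2 d : R, 0 < d & forall x : R[i], normc (x - z) < d -> P x.
Proof.
split.
  case/nbhs_ballP => d /= d0 H.
  move: d0; rewrite ltcE /= => /andP[/eqP dI dR].
  exists (cRe d) => // x xd; apply: H.
  by rewrite /ball /= -normrN opprB normcE ltcE /= dI eqxx xd.
case=> d d0 H; apply/nbhs_ballP; exists d%:C => /=; first by rewrite ltcR.
move=> x; rewrite /ball /= => xd; apply: H.
by rewrite -normrN opprB normcE ltcR in xd.
Qed.

(** The bridge between the two forms of the complex derivative. *)
Lemma cdiff_cvg f z l : cdiff f z l ->
  (fun h : R[i]^o => h^-1 *: (((f : R[i]^o -> R[i]^o) \o shift z) (h *: (1 : R[i]^o)) - f z))
    @ (0 : R[i]^o)^' --> (l : R[i]^o).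
Proof.
move=> fl; apply/cvgrPdist_lt => /= e; rewrite ltcE /= => /andP[/eqP eI e0].
have [|d d0 H] := fl (cRe e / 2); first by rewrite divr_gt0.
rewrite /dnbhs /within /=; apply/ball0P; exists d => // x.
rewrite subr0 => xd x0.
rewrite normcE ltcE /= eI eqxx /=.
have -> : l - x^-1 *: (f (x *: (1 : R[i]^o) + z) - f z) =
   - (x^-1 * (f (z + x) - f z - l * x)).
  rewrite /GRing.scale /= mulr1 [x + z]addrC; field; exact: x0.
rewrite normcN Normc.normcM Normc.normcV.
have nx : 0 < normc x by rewrite normc_gt0.
apply: (@le_lt_trans _ _ (cRe e / 2)); last lra.
rewrite mulrC ler_pdivrMr//; exact: H.
Qed.

Lemma cdiff_derivable f z l : cdiff f z l ->
  derivable (f : R[i]^o -> R[i]^o) z 1.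
Proof. by move=> /cdiff_cvg H; apply/cvg_ex; exists l. Qed.

Lemma cdiff_derive1 f z l : cdiff f z l ->
  @derive1 R[i] R[i]^o f z = l.
Proof.
move=> /cdiff_cvg H; rewrite derive1E /derive.
exact: (@cvg_lim R[i]^o).
Qed.

Lemma derivable_cdiff f z : derivable (f : R[i]^o -> R[i]^o) z 1 ->
  cdiff f z (@derive1 R[i] R[i]^o f z).
Proof.
move=> H; set l := @derive1 R[i] R[i]^o f z.
have {}H : (fun h : R[i]^o => h^-1 *: (((f : R[i]^o -> R[i]^o) \o shift z) (h *: (1 : R[i]^o)) - f z))
    @ (0 : R[i]^o)^' --> (l : R[i]^o) by rewrite /l derive1E; exact: H.
move=> e e0.
move/cvgrPdist_lt: H => /(_ e%:C); rewrite ltcR => /(_ e0).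
rewrite /dnbhs /within /= => /ball0P[d d0 H]; exists d => // h hd.
have [->|h0] := eqVneq h 0.
  by rewrite mulr0 subr0 addr0 subrr Normc.normc0 mulr0.
have := H h; rewrite subr0 => /(_ hd h0).
rewrite normcE ltcR /GRing.scale /= mulr1 [h + z]addrC => /ltW.
have -> : f (z + h) - f z - l * h = - (l - h^-1 * (f (z + h) - f z)) * h.
  by field; exact: h0.
rewrite Normc.normcM normcN => H'; apply: ler_wpM2r => //; exact: normc_ge0.
Qed.

Lemma entire_cdiff f : entire f -> forall z, exists l, cdiff f z l.
Proof. by move=> H z; exists (@derive1 R[i] R[i]^o f z); exact: derivable_cdiff. Qed.

Lemma cdiff_entire f : (forall z, exists l, cdiff f z l) -> entire f.
Proof. by move=> H z; have [l] := H z; exact: cdiff_derivable. Qed.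

Definition ccont f z := forall e : R, 0 < e -> exists2 d : R, 0 < d &
  forall h, normc h < d -> normc (f (z + h) - f z) <= e.

Lemma cdiff_ccont f z l : cdiff f z l -> ccont f z.
Proof.
move=> fl e e0; have [d d0 H] := fl 1 ltr01.
have l1 : 0 < normc l + 1 by rewrite ltr_wpDl// normc_ge0.
exists (Num.min d (e / (normc l + 1))).
  by rewrite lt_min d0 divr_gt0.
move=> h; rewrite lt_min => /andP[hd he].
have := le_normcD (f (z + h) - f z - l * h) (l * h).
rewrite subrK => /le_trans; apply.
apply: (@le_trans _ _ (normc h * (normc l + 1))).
  rewrite mulrDr mulr1 addrC; apply: lerD; first by rewrite Normc.normcM mulrC.
  by have := H h hd; rewrite mul1r.
by rewrite -ler_pdivlMr// ltW.
Qed.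

Lemma ccont_cst (a : R[i]) z : ccont (fun=> a) z.
Proof. by move=> e e0; exists 1 => // h _; rewrite subrr Normc.normc0 ltW. Qed.

Lemma ccontD f g z : ccont f z -> ccont g z -> ccont (fun x => f x + g x) z.
Proof.
move=> cf cg e e0.
have [|d d0 Hf] := cf (e / 2); first by rewrite divr_gt0.
have [|d' d0' Hg] := cg (e / 2); first by rewrite divr_gt0.
exists (Num.min d d'); first by rewrite lt_min d0.
move=> h; rewrite lt_min => /andP[h1 h2].
have -> : f (z + h) + g (z + h) - (f z + g z) =
  (f (z + h) - f z) + (g (z + h) - g z) by ring.
apply: le_trans (le_normcD _ _) _; rewrite [leRHS]splitr; apply: lerD; auto.
Qed.

Lemma ccontM f g z : ccont f z -> ccont g z -> ccont (fun x => f x * g x) z.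
Proof.
move=> cf cg e e0.
pose M := normc (f z) + normc (g z) + 1.
have M0 : 0 < M by rewrite ltr_wpDl// addr_ge0 ?normc_ge0.
pose e' := Num.min 1 (e / (2 * M)).
have e'0 : 0 < e' by rewrite lt_min ltr01 divr_gt0// mulr_gt0.
have [d d0 Hf] := cf e' e'0.
have [d' d0' Hg] := cg e' e'0.
exists (Num.min d d'); first by rewrite lt_min d0.
move=> h; rewrite lt_min => /andP[/Hf h1 /Hg h2].
set a := f (z + h) - f z in h1 *; set b := g (z + h) - g z in h2 *.
have -> : f (z + h) * g (z + h) - (f z * g z) = a * b + (a * g z + f z * b).
  by rewrite /a /b; ring.
have e'1 : e' <= 1 by rewrite ge_min lexx.
have e'2 : e' * M <= e / 2.
  apply: (@le_trans _ _ (e / (2 * M) * M)).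
    by rewrite ler_wpM2r ?(ltW M0)// ge_min lexx orbT.
  by rewrite invfM mulrA mulfVK// gt_eqF.
have na := normc_ge0 a. have nb := normc_ge0 b.
have nf := normc_ge0 (f z). have ng := normc_ge0 (g z).
apply: le_trans (le_normcD _ _) _.
apply: (@le_trans _ _ (normc a * normc b + (normc a * normc (g z) + normc (f z) * normc b))).
  rewrite -!Normc.normcM lerD2l; exact: le_normcD.
apply: (@le_trans _ _ (e' * M)); last by lra.
have : normc a * normc b <= e' * 1 by apply: ler_pM => //; lra.
have : normc a * normc (g z) <= e' * normc (g z) by apply: ler_wpM2r.
have : normc (f z) * normc b <= normc (f z) * e' by apply: ler_wpM2l.
rewrite /M; lra.
Qed.

Lemma ccontB f g z : ccont f z -> ccont g z -> ccont (fun x => f x - g x) z.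
Proof.
move=> cf cg.
have -> : (fun x => f x - g x) = (fun x => f x + (-1) * g x).
  by apply/funext => x; rewrite mulN1r.
by apply: ccontD => //; apply: ccontM => //; exact: ccont_cst.
Qed.

Lemma cdiff_eq f g z l : (forall x, f x = g x) -> cdiff f z l -> cdiff g z l.
Proof. by move=> /funext ->. Qed.

Lemma cdiff_cst (a : R[i]) z : cdiff (fun=> a) z 0.
Proof.
move=> e e0; exists 1 => // h _; rewrite mul0r subrr subr0 Normc.normc0.
by rewrite mulr_ge0 ?normc_ge0// ltW.
Qed.

Lemma cdiff_id z : cdiff id z 1.
Proof.
move=> e e0; exists 1 => // h _; rewrite mul1r [_ + h]addrC addrK subrr Normc.normc0.
by rewrite mulr_ge0 ?normc_ge0// ltW.
Qed.

Lemma cdiffD f g z l m : cdiff f z l -> cdiff g z m ->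
  cdiff (fun x => f x + g x) z (l + m).
Proof.
move=> cf cg e e0.
have [|d d0 Hf] := cf (e / 2); first by rewrite divr_gt0.
have [|d' d0' Hg] := cg (e / 2); first by rewrite divr_gt0.
exists (Num.min d d'); first by rewrite lt_min d0.
move=> h; rewrite lt_min => /andP[h1 h2].
have -> : f (z + h) + g (z + h) - (f z + g z) - (l + m) * h =
  (f (z + h) - f z - l * h) + (g (z + h) - g z - m * h) by ring.
apply: le_trans (le_normcD _ _) _; rewrite [e]splitr mulrDl; apply: lerD; auto.
Qed.

Lemma cdiffM f g z l m : cdiff f z l -> cdiff g z m ->
  cdiff (fun x => f x * g x) z (l * g z + f z * m).
Proof.
move=> cf cg e e0.
pose M := normc (f z) + normc (g z) + normc l + 1.
have nf := normc_ge0 (f z). have ng := normc_ge0 (g z). have nl := normc_ge0 l.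
have M0 : 0 < M by rewrite /M; lra.
pose e' := Num.min 1 (e / (4 * M)).
have e'0 : 0 < e' by rewrite lt_min ltr01 divr_gt0// mulr_gt0.
have e'1 : e' <= 1 by rewrite ge_min lexx.
have e'2 : e' * M <= e / 4.
  apply: (@le_trans _ _ (e / (4 * M) * M)).
    by rewrite ler_wpM2r ?(ltW M0)// ge_min lexx orbT.
  by rewrite invfM mulrA mulfVK// gt_eqF.
have [d d0 Hf] := cf e' e'0.
have [d' d0' Hg] := cg e' e'0.
have [d'' d0'' Hc] := cdiff_ccont cg e'0.
exists (Num.min d (Num.min d' d'')); first by rewrite !lt_min d0 d0'.
move=> h; rewrite !lt_min => /andP[/Hf h1 /andP[/Hg h2 /Hc h3]].
set a := f (z + h) - f z - l * h in h1 *; set b := g (z + h) - g z - m * h in h2 *.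
set c := g (z + h) - g z in h3.
have -> : f (z + h) * g (z + h) - (f z * g z) - (l * g z + f z * m) * h =
   (a * c + l * h * c) + (a * g z + f z * b).
  by rewrite /a /b /c; ring.
have na := normc_ge0 a. have nb := normc_ge0 b. have nc := normc_ge0 c.
have nh := normc_ge0 h.
apply: le_trans (le_normcD _ _) _.
apply: (@le_trans _ _ ((normc a * normc c + normc l * normc h * normc c) + (normc a * normc (g z) + normc (f z) * normc b))).
  rewrite -!Normc.normcM; apply: lerD; exact: le_normcD.
have h4 : normc a * normc c <= (e' * normc h) * 1 by apply: ler_pM => //; lra.
have h5 : normc l * normc h * normc c <= normc l * normc h * e'.
  by apply: ler_wpM2l => //; exact: mulr_ge0.
have h6 : normc a * normc (g z) <= e' * normc h * normc (g z) by apply: ler_wpM2r.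
have h7 : normc (f z) * normc b <= normc (f z) * (e' * normc h) by apply: ler_wpM2l.
apply: (@le_trans _ _ (e' * M * normc h)).
  rewrite /M; apply: le_trans (lerD (lerD h4 h5) (lerD h6 h7)) _.
  by rewrite le_eqVlt; apply/orP; left; apply/eqP; ring.
apply: (ler_wpM2r nh); lra.
Qed.

Lemma cdiffZ f z l (a : R[i]) : cdiff f z l -> cdiff (fun x => a * f x) z (a * l).
Proof.
by move=> cf; have := cdiffM (cdiff_cst a z) cf; rewrite mul0r add0r.
Qed.

Lemma cdiff_sum (I : Type) (s : seq I) (F : I -> R[i] -> R[i]) (L : I -> R[i]) z :
  (forall i, cdiff (F i) z (L i)) ->
  cdiff (fun x => \sum_(i <- s) F i x) z (\sum_(i <- s) L i).
Proof.
move=> H; elim: s => [|a s IH].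
  rewrite big_nil; apply: cdiff_eq (cdiff_cst 0 z) => x; by rewrite big_nil.
rewrite big_cons; apply: cdiff_eq (cdiffD (H a) IH) => x; by rewrite big_cons.
Qed.

Lemma cdiff_affine f (a b : R[i]) z l : cdiff f (a * z + b) l ->
  cdiff (fun x => f (a * x + b)) z (a * l).
Proof.
move=> cf e e0.
have a1 : 0 < normc a + 1 by rewrite ltr_wpDl// normc_ge0.
have [|d d0 H] := cf (e / (normc a + 1)); first by rewrite divr_gt0.
exists (d / (normc a + 1)); first by rewrite divr_gt0.
move=> h; rewrite ltr_pdivlMr// => hd.
have -> : a * (z + h) + b = a * z + b + a * h by ring.
have -> : a * l * h = l * (a * h) by ring.
have nah : normc (a * h) <= normc h * (normc a + 1).
  rewrite Normc.normcM mulrC ler_wpM2l ?normc_ge0//; lra.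
apply: le_trans (H _ _) _; first exact: le_lt_trans hd.
by rewrite mulrAC ler_pdivrMr// -mulrA ler_wpM2l// ltW.
Qed.

Lemma cdiffV z : z != 0 -> cdiff (fun x => x^-1) z (- z^-2).
Proof.
move=> z0 e e0.
have nz : 0 < normc z by rewrite normc_gt0.
exists (Num.min (normc z / 2) (e * normc z ^+ 3 / 2)).
  by rewrite lt_min !divr_gt0// mulr_gt0// exprn_gt0.
move=> h; rewrite lt_min => /andP[h1 h2].
have hz : normc z / 2 <= normc (z + h).
  have := normc_lebB z (- h); rewrite normcN opprK; lra.
have zh0 : z + h != 0 by rewrite -normc_gt0; lra.
have -> : (z + h)^-1 - z^-1 - (- z^-2 * h) = h * h * (z + h)^-1 * (z ^+ 2)^-1.
  by field; rewrite z0 zh0.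
rewrite !Normc.normcM !Normc.normcV normcX [in leRHS]mulrC -!mulrA.
rewrite ler_wpM2l ?normc_ge0// mulrA ler_pdivrMr ?exprn_gt0// ler_pdivrMr; last lra.
apply: (@le_trans _ _ (e * normc z ^+ 2 * (normc z / 2))).
  apply: le_trans (ltW h2) _; rewrite le_eqVlt; apply/orP; left; apply/eqP.
  by field.
by apply: ler_wpM2l => //; rewrite mulr_ge0// ?exprn_ge0// ltW.
Qed.

End CDiff.

(** * Integrals along segments and rectangles *)

Section SegmentIntegral.
Context {R : realType}.
Notation mu := (@lebesgue_measure R).
Implicit Types (g h : R -> R[i]) (a b m x y : R).

Definition cint a b g : R[i] :=
  (\int[mu]_(x in `[a, b]) cRe (g x)) +i* (\int[mu]_(x in `[a, b]) cIm (g x)).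

(** Continuity at each point of [a, b] as a function on the whole line: the
    integrands below extend beyond the segments they are integrated over. *)
Definition pcont g a b := forall x, a <= x <= b -> forall e : R, 0 < e ->
  exists2 d : R, 0 < d & forall t, `|t| < d -> normc (g (x + t) - g x) <= e.

Lemma pcont_within g a b (p : R[i] -> R) :
  (forall z w, `|p z - p w| <= normc (z - w)) ->
  pcont g a b -> {within `[a, b], continuous (fun x => p (g x))}.
Proof.
move=> Hp H; apply: continuous_in_subspaceT => x; rewrite inE /= in_itv /= => xab.
apply/cvgrPdist_le => e e0; have [d d0 Hd] := H x xab e e0.
apply/nbhs_ballP; exists d => //= t; rewrite /ball /= => xt.
apply: le_trans (Hp _ _) _; rewrite normcB.
have := Hd (t - x); rewrite [x + _]addrC subrK distrC; exact.
Qed.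

Lemma itv_continuous_integrable (u : R -> R) a b :
  {within `[a, b], continuous u} -> mu.-integrable `[a, b] (EFin \o u).
Proof. by move=> H; apply: continuous_compact_integrable => //; exact: segment_compact. Qed.

Lemma Re_lip (z w : R[i]) : `|cRe z - cRe w| <= normc (z - w).
Proof. by rewrite -cReN -cReD normc_Re. Qed.
Lemma Im_lip (z w : R[i]) : `|cIm z - cIm w| <= normc (z - w).
Proof. by rewrite -cImN -cImD normc_Im. Qed.
Lemma normc_lip (z w : R[i]) : `|normc z - normc w| <= normc (z - w).
Proof. by rewrite ler_norml normc_lebB andbT lerNl opprB normcB normc_lebB. Qed.

Lemma Re_integrable g a b : pcont g a b -> mu.-integrable `[a, b] (EFin \o (fun x => cRe (g x))).
Proof. by move=> H; apply: itv_continuous_integrable; apply: (pcont_within (p := @cRe R)) => //; exact: Re_lip. Qed.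
Lemma Im_integrable g a b : pcont g a b -> mu.-integrable `[a, b] (EFin \o (fun x => cIm (g x))).
Proof. by move=> H; apply: itv_continuous_integrable; apply: (pcont_within (p := @cIm R)) => //; exact: Im_lip. Qed.

Lemma eq_cint g h a b : (forall x, a <= x <= b -> g x = h x) -> cint a b g = cint a b h.
Proof.
move=> H; rewrite /cint.
by congr (_ +i* _); apply: eq_Rintegral => x; rewrite inE /= in_itv /= => /H ->.
Qed.

Lemma cintD g h a b : pcont g a b -> pcont h a b ->
  cint a b (fun x => g x + h x) = cint a b g + cint a b h.
Proof.
move=> cg ch; apply: eq_complexP; rewrite ?cReD ?cImD /cint /= -RintegralD //=.
- by apply: eq_Rintegral => x _; rewrite cReD.
- exact: Re_integrable.
- exact: Re_integrable.
- by apply: eq_Rintegral => x _; rewrite cImD.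
- exact: Im_integrable.
- exact: Im_integrable.
Qed.

Lemma integrable_scale (u : R -> R) (r : R) a b :
  mu.-integrable `[a, b] (EFin \o u) -> mu.-integrable `[a, b] (EFin \o (fun x => r * u x)).
Proof.
move=> H; apply: eq_integrable (integrableZl _ r H) => //.
Qed.

Lemma cintZ g a b (w : R[i]) : pcont g a b ->
  cint a b (fun x => w * g x) = w * cint a b g.
Proof.
move=> cg; have iR := Re_integrable cg; have iI := Im_integrable cg.
apply: eq_complexP; rewrite [RHS](cReM, cImM) /cint /=.
- rewrite -[X in _ = X - _]RintegralZl // -[X in _ = _ - X]RintegralZl //=.
  rewrite -RintegralB //=; try exact: integrable_scale.
  by apply: eq_Rintegral => x _; rewrite cReM.
- rewrite -[X in _ = X + _]RintegralZl // -[X in _ = _ + X]RintegralZl //=.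
  rewrite -RintegralD //=; try exact: integrable_scale.
  by apply: eq_Rintegral => x _; rewrite cImM.
Qed.

Lemma pcontN g a b : pcont g a b -> pcont (fun x => - g x) a b.
Proof.
move=> H x xab e e0; have [d d0 Hd] := H x xab e e0; exists d => // t td.
by rewrite -opprD normcN Hd.
Qed.

Lemma cintN g a b : pcont g a b -> cint a b (fun x => - g x) = - cint a b g.
Proof.
move=> H; rewrite -mulN1r -cintZ //; apply: eq_cint => x _; by rewrite mulN1r.
Qed.

Lemma cintB g h a b : pcont g a b -> pcont h a b ->
  cint a b (fun x => g x - h x) = cint a b g - cint a b h.
Proof. by move=> cg ch; rewrite cintD ?cintN//; exact: pcontN. Qed.

Lemma Rintegral_cat (u : R -> R) a m b : a <= m <= b ->
  mu.-integrable `[a, b] (EFin \o u) ->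
  \int[mu]_(x in `[a, b]) u x =
  \int[mu]_(x in `[a, m]) u x + \int[mu]_(x in `[m, b]) u x.
Proof.
move=> /andP[am mb] iu.
have := @Rintegral_itvB R u (BLeft a) (BRight b) m iu; rewrite !bnd_simp => /(_ am mb) E.
rewrite -(@Rintegral_itv_obnd_cbnd R m (BRight b) u).
  by rewrite -E addrC subrK.
apply: integrableS iu => //; apply: subset_itvScc => //=; exact: am.
Qed.

Lemma cint_cat g a m b : a <= m <= b -> pcont g a b ->
  cint a b g = cint a m g + cint m b g.
Proof.
move=> amb cg; apply: eq_complexP; rewrite ?cReD ?cImD /cint /=; apply: Rintegral_cat => //.
  exact: Re_integrable.
exact: Im_integrable.
Qed.

(** The factor 2 is the price of bounding the real and imaginary parts
    separately. *)
Lemma cint_le g (u : R -> R) a b : pcont g a b ->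
  mu.-integrable `[a, b] (EFin \o u) ->
  (forall x, a <= x <= b -> normc (g x) <= u x) ->
  normc (cint a b g) <= 2 * \int[mu]_(x in `[a, b]) u x.
Proof.
move=> cg iu H; apply: le_trans (normc_leD _) _; rewrite mulr_natl mulr2n.
apply: lerD; rewrite /cint /=.
- apply: le_trans (le_normr_Rintegral _ (Re_integrable cg)) _ => //.
  apply: le_Rintegral => //; first exact: integrable_norm (Re_integrable cg).
  by move=> x; rewrite /= in_itv /= => /H; apply: le_trans; exact: normc_Re.
- apply: le_trans (le_normr_Rintegral _ (Im_integrable cg)) _ => //.
  apply: le_Rintegral => //; first exact: integrable_norm (Im_integrable cg).
  by move=> x; rewrite /= in_itv /= => /H; apply: le_trans; exact: normc_Im.
Qed.

Lemma Rintegral_itv_cst a b (r : R) : a <= b ->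
  \int[mu]_(x in `[a, b]) r = r * (b - a).
Proof.
by move=> ab; rewrite Rintegral_cst//= lebesgue_measure_itv /= lte_fin; case: ltgtP ab => //= -> _; rewrite subrr.
Qed.

Lemma cst_integrable a b (r : R) : mu.-integrable `[a, b] (EFin \o (fun=> r)).
Proof. by apply: itv_continuous_integrable; apply: continuous_subspaceT => x; exact: cvg_cst. Qed.

Lemma cint_bound g a b (M : R) : a <= b -> pcont g a b ->
  (forall x, a <= x <= b -> normc (g x) <= M) ->
  normc (cint a b g) <= 2 * M * (b - a).
Proof.
move=> ab cg H; have := cint_le cg (cst_integrable a b M) H.
by rewrite Rintegral_itv_cst// mulrA.
Qed.

Lemma cint_cst a b (w : R[i]) : a <= b -> cint a b (fun=> w) = w * (b - a)%:C.
Proof.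
move=> ab; rewrite /cint !Rintegral_itv_cst//; apply: eq_complexP; rewrite ?cReM ?cImM /=; ring.
Qed.

Lemma ccont_hpath (f : R[i] -> R[i]) a b c :
  (forall x, a <= x <= b -> ccont f (x +i* c)) -> pcont (fun x => f (x +i* c)) a b.
Proof.
move=> H x xab e e0; have [d d0 Hd] := H x xab e e0; exists d => // t td.
have := Hd t%:C; rewrite normcR => /(_ td); congr (normc (f _ - _) <= _).
by apply: eq_complexP => /=; rewrite ?addr0.
Qed.

Lemma ccont_vpath (f : R[i] -> R[i]) a b c :
  (forall x, a <= x <= b -> ccont f (c +i* x)) -> pcont (fun x => f (c +i* x)) a b.
Proof.
move=> H x xab e e0; have [d d0 Hd] := H x xab e e0; exists d => // t td.
have := Hd (0 +i* t); rewrite /= expr0n add0r sqrtr_sqr => /(_ td); congr (normc (f _ - _) <= _).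
by apply: eq_complexP => /=; rewrite ?addr0.
Qed.

End SegmentIntegral.

Section Rectangle.
Context {R : realType}.
Implicit Types (f g : R[i] -> R[i]) (a b c d m : R).

(** The integral of f dz over the positively oriented boundary of
    [a, b] x [c, d], opposite sides being grouped. *)
Definition rint f a b c d : R[i] :=
  cint a b (fun x => f (x +i* c) - f (x +i* d)) +
  'i * cint c d (fun y => f (b +i* y) - f (a +i* y)).

Definition rbnd a b c d (z : R[i]) : Prop :=
  [/\ a <= cRe z <= b, c <= cIm z <= d &
    [\/ cRe z = a, cRe z = b, cIm z = c | cIm z = d]].

Definition rcont f a b c d := forall z, rbnd a b c d z -> ccont f z.

Definition rect a b c d (z : R[i]) : Prop := a <= cRe z <= b /\ c <= cIm z <= d.

Lemma rcont_pcont f a b c d : a <= b -> c <= d -> rcont f a b c d ->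
  [/\ pcont (fun x => f (x +i* c)) a b, pcont (fun x => f (x +i* d)) a b,
   pcont (fun y => f (a +i* y)) c d & pcont (fun y => f (b +i* y)) c d].
Proof.
move=> ab cd H; split.
- by apply: ccont_hpath => x xab; apply: H; split => //=; rewrite ?lexx ?cd//; constructor 3.
- by apply: ccont_hpath => x xab; apply: H; split => //=; rewrite ?lexx ?cd//; constructor 4.
- by apply: ccont_vpath => x xab; apply: H; split => //=; rewrite ?lexx ?ab//; constructor 1.
- by apply: ccont_vpath => x xab; apply: H; split => //=; rewrite ?lexx ?ab//; constructor 2.
Qed.

Lemma rintE f a b c d : a <= b -> c <= d -> rcont f a b c d ->
  rint f a b c d = (cint a b (fun x => f (x +i* c)) - cint a b (fun x => f (x +i* d))) +
   'i * (cint c d (fun y => f (b +i* y)) - cint c d (fun y => f (a +i* y))).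
Proof. by move=> ab cd /(rcont_pcont ab cd)[*]; rewrite /rint !cintB. Qed.

Lemma eq_rint f g a b c d : a <= b -> c <= d ->
  (forall z, rbnd a b c d z -> f z = g z) -> rint f a b c d = rint g a b c d.
Proof.
move=> ab cd H; rewrite /rint; congr (_ + _ * _); apply: eq_cint => x xab; rewrite !H //;
 split => //=; rewrite ?lexx ?ab ?cd//; by [constructor 1|constructor 2|constructor 3|constructor 4].
Qed.

Lemma rintD f g a b c d : a <= b -> c <= d -> rcont f a b c d -> rcont g a b c d ->
  rint (fun z => f z + g z) a b c d = rint f a b c d + rint g a b c d.
Proof.
move=> ab cd Hf Hg; rewrite !rintE //; last by move=> z zr; apply: ccontD; auto.
have [? ? ? ?] := rcont_pcont ab cd Hf.
have [? ? ? ?] := rcont_pcont ab cd Hg.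
rewrite !cintD //; ring.
Qed.

Lemma rcontZ f a b c d (w : R[i]) : rcont f a b c d -> rcont (fun z => w * f z) a b c d.
Proof. by move=> H z zr; apply: ccontM; [exact: ccont_cst|auto]. Qed.

Lemma rintZ f a b c d (w : R[i]) : a <= b -> c <= d -> rcont f a b c d ->
  rint (fun z => w * f z) a b c d = w * rint f a b c d.
Proof.
move=> ab cd Hf; rewrite !rintE //; last exact: rcontZ.
have [? ? ? ?] := rcont_pcont ab cd Hf.
rewrite !cintZ //; ring.
Qed.

Lemma rintB f g a b c d : a <= b -> c <= d -> rcont f a b c d -> rcont g a b c d ->
  rint (fun z => f z - g z) a b c d = rint f a b c d - rint g a b c d.
Proof.
move=> ab cd Hf Hg; rewrite -[- rint g _ _ _ _]mulN1r -rintZ// -rintD//; last exact: rcontZ.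
by apply: eq_rint => // z _; rewrite mulN1r.
Qed.

Lemma rcont_sum (I : Type) (s : seq I) (F : I -> R[i] -> R[i]) a b c d :
  (forall i, rcont (F i) a b c d) -> rcont (fun z => \sum_(i <- s) F i z) a b c d.
Proof.
move=> H; elim: s => [|i s IH].
  move=> z zr; rewrite (_ : (fun _ => _) = fun=> 0); first exact: ccont_cst.
  by apply/funext => x; rewrite big_nil.
move=> z zr; rewrite (_ : (fun _ => _) = fun x => F i x + \sum_(j <- s) F j x).
  by apply: ccontD; [exact: H|exact: IH].
by apply/funext => x; rewrite big_cons.
Qed.

Lemma rint0 a b c d : a <= b -> c <= d -> rint (fun=> 0) a b c d = 0.
Proof. by move=> ab cd; rewrite /rint !subrr !cint_cst// !mul0r mulr0 addr0. Qed.

Lemma rint_sum (I : Type) (s : seq I) (F : I -> R[i] -> R[i]) a b c d :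
  a <= b -> c <= d -> (forall i, rcont (F i) a b c d) ->
  rint (fun z => \sum_(i <- s) F i z) a b c d = \sum_(i <- s) rint (F i) a b c d.
Proof.
move=> ab cd H; elim: s => [|i s IH].
  rewrite big_nil -[RHS](rint0 ab cd); apply: eq_rint => // z _; by rewrite big_nil.
rewrite big_cons -IH -rintD //; last exact: rcont_sum.
by apply: eq_rint => // z _; rewrite big_cons.
Qed.

Lemma rint_bound f a b c d (M : R) : a <= b -> c <= d -> rcont f a b c d ->
  (forall z, rbnd a b c d z -> normc (f z) <= M) ->
  normc (rint f a b c d) <= 4 * M * ((b - a) + (d - c)).
Proof.
move=> ab cd Hf HM; rewrite rintE //.
have [h1 h2 h3 h4] := rcont_pcont ab cd Hf.
have k1 : normc (cint a b (fun x => f (x +i* c))) <= 2 * M * (b - a).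
  by apply: cint_bound => // x xab; apply: HM; split => //=; rewrite ?lexx ?cd//; constructor 3.
have k2 : normc (cint a b (fun x => f (x +i* d))) <= 2 * M * (b - a).
  by apply: cint_bound => // x xab; apply: HM; split => //=; rewrite ?lexx ?cd//; constructor 4.
have k3 : normc (cint c d (fun x => f (a +i* x))) <= 2 * M * (d - c).
  by apply: cint_bound => // x xab; apply: HM; split => //=; rewrite ?lexx ?ab//; constructor 1.
have k4 : normc (cint c d (fun x => f (b +i* x))) <= 2 * M * (d - c).
  by apply: cint_bound => // x xab; apply: HM; split => //=; rewrite ?lexx ?ab//; constructor 2.
apply: le_trans (le_normcD _ _) _; rewrite Normc.normcM normci mul1r.
have := le_normcD (cint a b (fun x => f (x +i* c))) (- cint a b (fun x => f (x +i* d))).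
have := le_normcD (cint c d (fun y => f (b +i* y))) (- cint c d (fun y => f (a +i* y))).
rewrite !normcN; nra.
Qed.

(** The integrals over the common side cancel. *)
Lemma rint_hcut f a m b c d : a <= m <= b -> c <= d -> rcont f a b c d ->
  (forall y, c <= y <= d -> ccont f (m +i* y)) ->
  rint f a b c d = rint f a m c d + rint f m b c d.
Proof.
move=> /andP[am mb] cd H1 Hm.
have ab := le_trans am mb.
have H2 : rcont f a m c d.
  move=> z [/andP[za zb] zc h].
  have zab : a <= cRe z <= b by rewrite za (le_trans zb mb).
  case: h => h; try by apply: H1; split => //; by [constructor 1|constructor 3|constructor 4].
  by rewrite (complexC_E z) h; exact: Hm.
have H3 : rcont f m b c d.
  move=> z [/andP[za zb] zc h].
  have zab : a <= cRe z <= b by rewrite zb (le_trans am za).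
  case: h => h; try by apply: H1; split => //; by [constructor 2|constructor 3|constructor 4].
  by rewrite (complexC_E z) h; exact: Hm.
have [h1 h2 h3 h4] := rcont_pcont ab cd H1.
rewrite !rintE // (cint_cat (m := m) (a := a) (b := b)) ?am//.
rewrite (cint_cat (m := m) (a := a) (b := b) (g := (fun x => f (x +i* d)))) ?am//.
ring.
Qed.

Lemma rint_vcut f a b c m d : a <= b -> c <= m <= d -> rcont f a b c d ->
  (forall x, a <= x <= b -> ccont f (x +i* m)) ->
  rint f a b c d = rint f a b c m + rint f a b m d.
Proof.
move=> ab /andP[cm md] H1 Hm.
have cd := le_trans cm md.
have H2 : rcont f a b c m.
  move=> z [zc /andP[za zb] h].
  have zab : c <= cIm z <= d by rewrite za (le_trans zb md).
  case: h => h; try by apply: H1; split => //; by [constructor 1|constructor 2|constructor 3].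
  by rewrite (complexC_E z) h; exact: Hm.
have H3 : rcont f a b m d.
  move=> z [zc /andP[za zb] h].
  have zab : c <= cIm z <= d by rewrite zb (le_trans cm za).
  case: h => h; try by apply: H1; split => //; by [constructor 1|constructor 2|constructor 4].
  by rewrite (complexC_E z) h; exact: Hm.
have [h1 h2 h3 h4] := rcont_pcont ab cd H1.
rewrite !rintE // (cint_cat (m := m) (a := c) (b := d)) ?cm//.
rewrite (cint_cat (m := m) (a := c) (b := d) (g := (fun x => f (a +i* x)))) ?cm//.
ring.
Qed.

End Rectangle.

(** * Cauchy's theorem and Cauchy's formula on rectangles *)

Section Bisection.
Context {R : realType}.
Implicit Types (P : R -> R -> R -> R -> Prop).

Lemma le_pow2_eps (l e : R) : 0 <= l -> 0 < e -> exists n, l / 2 ^+ n <= e.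
Proof.
move=> l0 e0; have := archi_boundP (divr_ge0 l0 (ltW e0)).
set n := Num.bound _ => Hn; exists n.
rewrite ler_pdivrMr ?exprn_gt0// mulrC -ler_pdivrMr//.
apply: le_trans (ltW Hn) _; rewrite -natrX ler_nat; exact/ltnW/ltn_expl.
Qed.

(** By contradiction: repeated bisection gives nested failing rectangles that
    shrink to a point, and the last hypothesis applies at that point. *)
Lemma rect_bisection P (a0 b0 c0 d0 : R) : a0 <= b0 -> c0 <= d0 ->
  (forall a b c d, a <= b -> c <= d ->
     P a ((a + b) / 2) c ((c + d) / 2) -> P ((a + b) / 2) b c ((c + d) / 2) ->
     P a ((a + b) / 2) ((c + d) / 2) d -> P ((a + b) / 2) b ((c + d) / 2) d -> P a b c d) ->
  (forall x y, a0 <= x <= b0 -> c0 <= y <= d0 -> exists2 e : R, 0 < e &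
     forall a b c d, a0 <= a -> a <= x <= b -> b <= b0 -> c0 <= c -> c <= y <= d -> d <= d0 ->
       b - a <= e -> d - c <= e -> P a b c d) ->
  P a0 b0 c0 d0.
Proof.
move=> ab0 cd0 Hq Hl; apply: contrapT => nP.
pose T := ((R * R) * (R * R))%type.
pose good (Q : T) := [/\ Q.1.1 <= Q.1.2, Q.2.1 <= Q.2.2 & ~ P Q.1.1 Q.1.2 Q.2.1 Q.2.2].
pose half (Q Q' : T) := [/\ Q.1.1 <= Q'.1.1 /\ Q'.1.2 <= Q.1.2, Q.2.1 <= Q'.2.1 /\ Q'.2.2 <= Q.2.2,
  Q'.1.2 - Q'.1.1 = (Q.1.2 - Q.1.1) / 2 & Q'.2.2 - Q'.2.1 = (Q.2.2 - Q.2.1) / 2].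
have step Q : exists Q', good Q -> good Q' /\ half Q Q'.
  case: Q => [[a b] [c d]]; have [g|ng] := pselect (good ((a, b), (c, d))); last by exists ((a, b), (c, d)).
  case: (g) => /= ab cd nPQ.
  have [q1|n1] := pselect (P a ((a + b) / 2) c ((c + d) / 2)); last first.
    exists ((a, (a + b) / 2), (c, (c + d) / 2)) => _; split; split => //=; lra.
  have [q2|n2] := pselect (P ((a + b) / 2) b c ((c + d) / 2)); last first.
    exists (((a + b) / 2, b), (c, (c + d) / 2)) => _; split; split => //=; lra.
  have [q3|n3] := pselect (P a ((a + b) / 2) ((c + d) / 2) d); last first.
    exists ((a, (a + b) / 2), ((c + d) / 2, d)) => _; split; split => //=; lra.
  have [q4|n4] := pselect (P ((a + b) / 2) b ((c + d) / 2) d); last first.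
    exists (((a + b) / 2, b), ((c + d) / 2, d)) => _; split; split => //=; lra.
  by case: nPQ; exact: Hq.
have [next Hnext] := choice step.
pose s n := iter n next ((a0, b0), (c0, d0)).
have gs n : good (s n).
  elim: n => [|n IH]; first by split.
  by have [] := Hnext _ IH.
have hs n : half (s n) (s n.+1) by have [] := Hnext _ (gs n).
have mono n k : (s n).1.1 <= (s (n + k)%N).1.1 /\ (s (n + k)%N).1.2 <= (s n).1.2 /\
   (s n).2.1 <= (s (n + k)%N).2.1 /\ (s (n + k)%N).2.2 <= (s n).2.2.
  elim: k => [|k [h1 [h2 [h3 h4]]]]; first by rewrite addn0 !lexx.
  rewrite addnS; have [[? ?] [? ?] _ _] := hs (n + k)%N.
  by split; [|split; [|split]]; lra.
have size n : (s n).1.2 - (s n).1.1 = (b0 - a0) / 2 ^+ n /\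
    (s n).2.2 - (s n).2.1 = (d0 - c0) / 2 ^+ n.
  elim: n => [|n [h1 h2]]; first by rewrite expr0 !divr1.
  have [_ _ -> ->] := hs n; rewrite h1 h2 exprSr invfM !mulrA.
  by split.
have cross1 n m : (s n).1.1 <= (s m).1.2.
  have [h1 [h2 _]] := mono n m; have [h3 [h4 _]] := mono m n.
  rewrite [(m + n)%N]addnC in h3 h4; have [g1 _ _] := gs (n + m)%N; lra.
have cross2 n m : (s n).2.1 <= (s m).2.2.
  have [_ [_ [h1 h2]]] := mono n m; have [_ [_ [h3 h4]]] := mono m n.
  rewrite [(m + n)%N]addnC in h3 h4; have [_ g1 _] := gs (n + m)%N; lra.
pose x := sup (range (fun n => (s n).1.1)).
pose y := sup (range (fun n => (s n).2.1)).
have xs n : (s n).1.1 <= x <= (s n).1.2.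
  apply/andP; split.
    apply: sup_upper_bound; last by exists n.
    split; first by exists (s 0%N).1.1; exists 0%N.
    by exists (s 0%N).1.2 => _ [k _ <-].
  apply: ge_sup; first by exists (s 0%N).1.1; exists 0%N.
  by move=> _ [k _ <-].
have ys n : (s n).2.1 <= y <= (s n).2.2.
  apply/andP; split.
    apply: sup_upper_bound; last by exists n.
    split; first by exists (s 0%N).2.1; exists 0%N.
    by exists (s 0%N).2.2 => _ [k _ <-].
  apply: ge_sup; first by exists (s 0%N).2.1; exists 0%N.
  by move=> _ [k _ <-].
have [e e0 He] := Hl x y (xs 0%N) (ys 0%N).
have ba : 0 <= b0 - a0 by lra.
have dc : 0 <= d0 - c0 by lra.
have [n1 Hn1] := le_pow2_eps ba e0.
have [n2 Hn2] := le_pow2_eps dc e0.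
have [_ _] := gs (n1 + n2)%N; apply.
have [h1 [h2 [h3 h4]]] := mono 0%N (n1 + n2)%N; rewrite add0n in h1 h2 h3 h4.
apply: He => //.
- rewrite (size _).1; apply: le_trans Hn1; rewrite ler_wpM2l// lef_pV2 ?posrE ?exprn_gt0//.
  by rewrite ler_weXn2l ?leq_addr// ler1n.
- rewrite (size _).2; apply: le_trans Hn2; rewrite ler_wpM2l// lef_pV2 ?posrE ?exprn_gt0//.
  by rewrite ler_weXn2l ?leq_addl// ler1n.
Qed.

End Bisection.

Section Goursat.
Context {R : realType}.
Implicit Types (f g : R[i] -> R[i]) (a b c d m : R).

Definition holo f z := exists l, cdiff f z l.

Lemma holo_ccont f z : holo f z -> ccont f z.
Proof. by case=> l; exact: cdiff_ccont. Qed.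

Lemma holoD f g z : holo f z -> holo g z -> holo (fun x => f x + g x) z.
Proof. by move=> [l h] [m k]; exists (l + m); exact: cdiffD. Qed.
Lemma holoM f g z : holo f z -> holo g z -> holo (fun x => f x * g x) z.
Proof. by move=> [l h] [m k]; exists (l * g z + f z * m); exact: cdiffM. Qed.
Lemma holo_cst (w z : R[i]) : holo (fun=> w) z.
Proof. by exists 0; exact: cdiff_cst. Qed.
Lemma holo_id (z : R[i]) : holo id z.
Proof. by exists 1; exact: cdiff_id. Qed.
Lemma holo_shiftV (w z : R[i]) : z != w -> holo (fun x => (x - w)^-1) z.
Proof.
move=> zw.
have H : cdiff (fun x => x^-1) (1 * z + (- w)) (- (1 * z - w)^-2).
  by apply: cdiffV; rewrite mul1r subr_eq0.
exists (1 * - (1 * z - w)^-2); apply: cdiff_eq (cdiff_affine H) => x.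
by rewrite mul1r.
Qed.
Lemma holoX f z n : holo f z -> holo (fun x => f x ^+ n) z.
Proof.
move=> h; elim: n => [|n IH]; first exact: holo_cst.
have -> : (fun x => f x ^+ n.+1) = (fun x => f x * f x ^+ n).
  by apply/funext => x; rewrite exprS.
exact: holoM.
Qed.

Lemma rint_affine (w l : R[i]) a b c d : a <= b -> c <= d ->
  rint (fun z => w + l * z) a b c d = 0.
Proof.
move=> ab cd; rewrite /rint.
rewrite (@eq_cint _ _ (fun=> l * ((c - d)%:C * 'i)) a b); last first.
  by move=> x _; apply: eq_complexP; rewrite ?(cReD, cImD, cReN, cImN, cReM, cImM) /=; ring.
rewrite (@eq_cint _ _ (fun=> l * (b - a)%:C) c d); last first.
  by move=> x _; apply: eq_complexP; rewrite ?(cReD, cImD, cReN, cImN, cReM, cImM) /=; ring.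
rewrite !cint_cst//; apply: eq_complexP; rewrite ?(cReD, cImD, cReN, cImN, cReM, cImM) /=; ring.
Qed.

Lemma rect_normc a b c d (z w : R[i]) : rect a b c d z -> rect a b c d w ->
  normc (z - w) <= (b - a) + (d - c).
Proof.
case=> /andP[? ?] /andP[? ?] [/andP[? ?] /andP[? ?]].
apply: le_trans (normc_leD _) _; rewrite !(cReD, cImD, cReN, cImN).
by apply: lerD; rewrite ler_norml; apply/andP; split; lra.
Qed.

Lemma rbnd_rect a b c d (z : R[i]) : rbnd a b c d z -> rect a b c d z.
Proof. by case. Qed.

(** Near a point, f differs from an affine function, whose integral vanishes, by
    at most e times the distance; so small rectangles satisfy
    |integral| <= 4 e L^2 with L the half-perimeter.  As L is halved in each of
    the four quarters, the estimate is stable under bisection. *)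
Lemma goursat f a b c d : a <= b -> c <= d ->
  (forall z, rect a b c d z -> holo f z) -> rint f a b c d = 0.
Proof.
move=> ab cd Hf.
pose L (a b c d : R) := (b - a) + (d - c).
have key e : 0 < e -> normc (rint f a b c d) <= 4 * e * L a b c d ^+ 2.
  move=> e0.
  pose P a' b' c' d' := a <= a' -> b' <= b -> c <= c' -> d' <= d ->
    normc (rint f a' b' c' d') <= 4 * e * L a' b' c' d' ^+ 2.
  suff : P a b c d by apply; exact: lexx.
  apply: rect_bisection => //.
    move=> a' b' c' d' ab' cd' p1 p2 p3 p4 h1 h2 h3 h4.
    set m := (a' + b') / 2 in p1 p2 p3 p4; set n := (c' + d') / 2 in p1 p2 p3 p4.
    have am : a' <= m <= b' by rewrite /m; lra.
    have cn : c' <= n <= d' by rewrite /n; lra.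
    have inr z : rect a' b' c' d' z -> ccont f z.
      case=> /andP[? ?] /andP[? ?]; apply/holo_ccont/Hf; split; apply/andP; split; lra.
    rewrite (@rint_hcut _ f a' m)//; last 2 first.
      by move=> z /rbnd_rect/inr.
      by move=> y yc; apply: inr; split.
    have /andP[am1 am2] := am; have /andP[cn1 cn2] := cn.
    rewrite (@rint_vcut _ f a' m c' n d')//; last 2 first.
      move=> z /rbnd_rect[/andP[? ?] ?]; apply: inr; split => //; apply/andP; split; lra.
      move=> x /andP[? ?]; apply: inr; split => //=; apply/andP; split; lra.
    rewrite (@rint_vcut _ f m b' c' n d')//; last 2 first.
      move=> z /rbnd_rect[/andP[? ?] ?]; apply: inr; split => //; apply/andP; split; lra.
      move=> x /andP[? ?]; apply: inr; split => //=; apply/andP; split; lra.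
    have {}p1 := p1 ltac:(lra) ltac:(lra) ltac:(lra) ltac:(lra).
    have {}p2 := p2 ltac:(lra) ltac:(lra) ltac:(lra) ltac:(lra).
    have {}p3 := p3 ltac:(lra) ltac:(lra) ltac:(lra) ltac:(lra).
    have {}p4 := p4 ltac:(lra) ltac:(lra) ltac:(lra) ltac:(lra).
    have E1 : L a' m c' n = L a' b' c' d' / 2 by rewrite /L /m /n; field.
    have E2 : L m b' c' n = L a' b' c' d' / 2 by rewrite /L /m /n; field.
    have E3 : L a' m n d' = L a' b' c' d' / 2 by rewrite /L /m /n; field.
    have E4 : L m b' n d' = L a' b' c' d' / 2 by rewrite /L /m /n; field.
    rewrite E1 in p1; rewrite E2 in p2; rewrite E3 in p3; rewrite E4 in p4.
    apply: le_trans (le_normcD _ _) _.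
    apply: le_trans (lerD (le_normcD _ _) (le_normcD _ _)) _.
    rewrite -[L a' b' c' d'](@divfK _ 2)// in p1 p2 p3 p4 *.
    set l := L a' b' c' d' / 2 in p1 p2 p3 p4 *.
    rewrite mulfK// in p1 p2 p3 p4.
    lra.
  move=> x y xab ycd; have [l Hl] := Hf (x +i* y) (conj xab ycd).
  have [dl dl0 Hd] := Hl e e0.
  exists (dl / 4); first by rewrite divr_gt0.
  move=> a' b' c' d' aa /andP[ax xb] bb cc /andP[cy yd] dd s1 s2 _ _ _ _.
  have ab' : a' <= b' by lra.
  have cd' : c' <= d' by lra.
  pose z0 := x +i* y; pose r z := f z - ((f z0 - l * z0) + l * z).
  have cf : rcont f a' b' c' d'.
    move=> z [/andP[? ?] /andP[? ?] _]; apply/holo_ccont/Hf; split; apply/andP; split; lra.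
  have ca : rcont (fun z => (f z0 - l * z0) + l * z) a' b' c' d'.
    move=> z _; apply/holo_ccont/holoD; first exact: holo_cst.
    by apply: holoM; [exact: holo_cst|exact: holo_id].
  have cr : rcont r a' b' c' d'.
    by move=> z zr; apply: ccontB; [exact: cf|exact: ca].
  have -> : rint f a' b' c' d' = rint r a' b' c' d'.
    by rewrite /r rintB// rint_affine// subr0.
  have -> : 4 * e * L a' b' c' d' ^+ 2 = 4 * (e * L a' b' c' d') * (b' - a' + (d' - c')).
    rewrite /L; ring.
  apply: rint_bound => // z /rbnd_rect zr.
  have zL : normc (z - z0) <= L a' b' c' d'.
    by apply: rect_normc => //; split => /=; [rewrite ax xb|rewrite cy yd].
  have := Hd (z - z0); rewrite [x +i* y + _]addrC subrK -/z0.
  have -> : f z - f z0 - l * (z - z0) = r z by rewrite /r; ring.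
  move=> h; apply: (@le_trans _ _ (e * normc (z - z0))).
    apply: h; apply: le_lt_trans zL _; rewrite /L; lra.
  by rewrite ler_wpM2l// ltW.
apply/Normc.eq0_normc/eqP; rewrite eq_le normc_ge0 andbT.
have L0 : 0 <= L a b c d by rewrite /L; lra.
apply/ler_addgt0Pl => e e0; rewrite addr0.
have D0 : 0 < 4 * (L a b c d ^+ 2 + 1) by have := sqr_ge0 (L a b c d); lra.
apply: le_trans (key (e / (4 * (L a b c d ^+ 2 + 1))) _) _; first exact: divr_gt0.
set L2 := L a b c d ^+ 2 in D0 *.
have -> : 4 * (e / (4 * (L2 + 1))) * L2 = e * (4 * L2) / (4 * (L2 + 1)) by ring.
by rewrite ler_pdivrMr// ler_wpM2l//; [exact: ltW|lra].
Qed.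

End Goursat.

Ltac slra := lazymatch goal with |- is_true _ => try lra | _ => idtac end.

Section CauchyFormula.
Context {R : realType}.
Notation mu := (@lebesgue_measure R).
Implicit Types (f g : R[i] -> R[i]) (a b c d m : R).

Lemma rbnd_far a b c d (w z : R[i]) (r : R) : rbnd a b c d z ->
  a <= cRe w - r -> cRe w + r <= b -> c <= cIm w - r -> cIm w + r <= d ->
  r <= normc (z - w).
Proof.
case=> _ _ hz h1 h2 h3 h4.
case: hz => E.
- apply: le_trans (normc_Re _); rewrite cReD cReN E ler_normr; apply/orP; right; lra.
- apply: le_trans (normc_Re _); rewrite cReD cReN E ler_normr; apply/orP; left; lra.
- apply: le_trans (normc_Im _); rewrite cImD cImN E ler_normr; apply/orP; right; lra.
- apply: le_trans (normc_Im _); rewrite cImD cImN E ler_normr; apply/orP; left; lra.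
Qed.

(** The punctured rectangle is cut into the small square and four rectangles
    that avoid w, where Goursat applies. *)
Lemma rint_deform f a b c d (w : R[i]) (e : R) : 0 < e ->
  a <= cRe w - e -> cRe w + e <= b -> c <= cIm w - e -> cIm w + e <= d ->
  (forall z, rect a b c d z -> z != w -> holo f z) ->
  rint f a b c d = rint f (cRe w - e) (cRe w + e) (cIm w - e) (cIm w + e).
Proof.
case: w => w1 w2 /= e0 h1 h2 h3 h4 Hf.
have Hn (z : R[i]) : cRe z != w1 \/ cIm z != w2 -> z != w1 +i* w2.
  by case: z => z1 z2 /= H; apply/eqP => -[E1 E2]; case: H; rewrite ?E1 ?E2 eqxx.
have Hc z : rect a b c d z -> cRe z != w1 \/ cIm z != w2 -> ccont f z.
  by move=> zr /Hn zw; apply: holo_ccont; apply: Hf.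
rewrite (@rint_hcut _ f a (w1 - e) b c d); slra; last 2 first.
  move=> z [/andP[? ?] /andP[? ?] hz]; apply: Hc; first by split; lra.
  case: hz => ->; [left|left|right|right]; apply/eqP; lra.
  move=> y yc; apply: Hc => /=; first by split => /=; lra.
  left; apply/eqP; lra.
rewrite (@rint_hcut _ f (w1 - e) (w1 + e) b c d); slra; last 2 first.
  move=> z [/andP[? ?] /andP[? ?] hz]; apply: Hc; first by split; lra.
  case: hz => ->; [left|left|right|right]; apply/eqP; lra.
  move=> y yc; apply: Hc => /=; first by split => /=; lra.
  left; apply/eqP; lra.
rewrite [rint f a (w1 - e) c d]goursat ?add0r; slra; last first.
  move=> z [/andP[? ?] /andP[? ?]]; apply: Hf; first by split; lra.
  apply: Hn; left; apply/eqP; lra.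
rewrite [rint f (w1 + e) b c d]goursat ?addr0; slra; last first.
  move=> z [/andP[? ?] /andP[? ?]]; apply: Hf; first by split; lra.
  apply: Hn; left; apply/eqP; lra.
rewrite (@rint_vcut _ f (w1 - e) (w1 + e) c (w2 - e) d); slra; last 2 first.
  move=> z [/andP[? ?] /andP[? ?] hz]; apply: Hc; first by split; lra.
  case: hz => ->; [left|left|right|right]; apply/eqP; lra.
  move=> y yc; apply: Hc => /=; first by split => /=; lra.
  right; apply/eqP; lra.
rewrite (@rint_vcut _ f (w1 - e) (w1 + e) (w2 - e) (w2 + e) d); slra; last 2 first.
  move=> z [/andP[? ?] /andP[? ?] hz]; apply: Hc; first by split; lra.
  case: hz => ->; [left|left|right|right]; apply/eqP; lra.
  move=> y yc; apply: Hc => /=; first by split => /=; lra.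
  right; apply/eqP; lra.
rewrite [rint f _ _ c (w2 - e)]goursat ?add0r; slra; last first.
  move=> z [/andP[? ?] /andP[? ?]]; apply: Hf; first by split; lra.
  apply: Hn; right; apply/eqP; lra.
rewrite [rint f _ _ (w2 + e) d]goursat ?addr0; slra => //.
move=> z [/andP[? ?] /andP[? ?]]; apply: Hf; first by split; lra.
apply: Hn; right; apply/eqP; lra.
Qed.

Lemma Rintegral_poisson (w e : R) : 0 < e ->
  \int[mu]_(x in `[w - e, w + e]) (2 * e / ((x - w) ^+ 2 + e ^+ 2)) = pi.
Proof.
move=> e0; pose F (x : R) := 2 * atan ((x - w) / e).
have e2 : 0 < e ^+ 2 by rewrite exprn_gt0.
have dF (x : R) : is_derive x (1 : R) F (2 * e / ((x - w) ^+ 2 + e ^+ 2)).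
  apply: is_derive_eq; rewrite /GRing.scale /=.
  have : 0 <= (x - w) ^+ 2 by rewrite sqr_ge0.
  move=> h; field; rewrite !gt_eqF//; lra.
have cF : continuous F.
  by move=> x; apply: differentiable_continuous; apply/derivable1_diffP; have [] := dF x.
rewrite /Rintegral (@continuous_FTC2 _ _ F); first last.
- by move=> x _; rewrite derive1E; have [_ ->] := dF x.
- split; first by move=> x _; have [] := dF x.
  + by apply: cvg_at_right_filter; exact: cF.
  + by apply: cvg_at_left_filter; exact: cF.
- apply: continuous_subspaceT => x.
  apply: cvgM; first exact: cvg_cst.
  apply: cvgV; first by rewrite gt_eqF// ltr_wpDl// sqr_ge0.
  apply: cvgD; last exact: cvg_cst.
  rewrite expr2; apply: cvgM; apply: cvgB; by [exact: cvg_id|exact: cvg_cst].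
- by lra.
rewrite /F /=; have -> : (w + e - w) / e = 1 by field; rewrite gt_eqF.
have -> : (w - e - w) / e = - 1 by field; rewrite gt_eqF.
rewrite atanN atan1; lra.
Qed.

(** Opposite sides combine to a Poisson kernel, whose integral over a side is pi. *)
Lemma rint_inv_square (w : R[i]) (e : R) : 0 < e ->
  rint (fun z => (z - w)^-1) (cRe w - e) (cRe w + e) (cIm w - e) (cIm w + e) =
  (2 * pi)%:C * 'i.
Proof.
case: w => w1 w2 /= e0; rewrite /rint.
have e2 : 0 < e ^+ 2 by rewrite exprn_gt0.
have D (x : R) : x ^+ 2 + e ^+ 2 != 0.
  by rewrite gt_eqF// ltr_wpDl// sqr_ge0.
rewrite (@eq_cint _ _ (fun x => 0 +i* (2 * e / ((x - w1) ^+ 2 + e ^+ 2))) (w1 - e)); last first.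
  move=> x _; have d := D (x - w1).
  have -> : (x +i* (w2 - e) - (w1 +i* w2) : R[i]) = ((x - w1) +i* (- e)).
    by apply: eq_complexP => /=; ring.
  have -> : (x +i* (w2 + e) - (w1 +i* w2) : R[i]) = ((x - w1) +i* e).
    by apply: eq_complexP => /=; ring.
  by apply: eq_complexP; rewrite ?(cReD, cImD, cReN, cImN) /= ?sqrrN; field.
rewrite (@eq_cint _ _ (fun x => (2 * e / ((x - w2) ^+ 2 + e ^+ 2)) +i* 0) (w2 - e)); last first.
  move=> x _; have d := D (x - w2).
  have -> : ((w1 + e) +i* x - (w1 +i* w2) : R[i]) = (e +i* (x - w2)).
    by apply: eq_complexP => /=; ring.
  have -> : ((w1 - e) +i* x - (w1 +i* w2) : R[i]) = ((-e) +i* (x - w2)).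
    by apply: eq_complexP => /=; ring.
  by apply: eq_complexP; rewrite ?(cReD, cImD, cReN, cImN) /= ?sqrrN; field; rewrite ?d //; move: d; rewrite addrC.
rewrite /cint /= !Rintegral_poisson// !Rintegral_itv_cst; slra.
by apply: eq_complexP; rewrite ?(cReD, cImD, cReM, cImM) /=; ring.
Qed.

(** The contour is shrunk to a square of half-side r around w, on which
    f(z) / (z - w) is uniformly close to f(w) / (z - w). *)
Lemma cauchy_formula f a b c d (w : R[i]) :
  a < cRe w < b -> c < cIm w < d -> (forall z, rect a b c d z -> holo f z) ->
  rint (fun z => f z * (z - w)^-1) a b c d = (2 * pi)%:C * 'i * f w.
Proof.
move=> /andP[w1 w2] /andP[w3 w4] Hf.
have Hw : rect a b c d w by split; lra.
apply/eqP; rewrite -subr_eq0 -normc_eq0 eq_le normc_ge0 andbT.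
apply/ler_addgt0Pl => e e0; rewrite addr0.
(* rint_bound multiplies by 4 times the half-perimeter 4 r, that is by 16 r *)
have e16 : 0 < e / 16 by rewrite divr_gt0.
have [dl dl0 Hd] := holo_ccont (Hf w Hw) e16.
pose r := Num.min (dl / 4) (Num.min (Num.min (cRe w - a) (b - cRe w)) (Num.min (cIm w - c) (d - cIm w))).
have r0 : 0 < r by rewrite /r !lt_min; lra.
have r1 : r <= dl / 4 by rewrite /r ge_min lexx.
have r2 : r <= cRe w - a by rewrite /r !ge_min lexx ?orbT.
have r3 : r <= b - cRe w by rewrite /r !ge_min lexx ?orbT.
have r4 : r <= cIm w - c by rewrite /r !ge_min lexx ?orbT.
have r5 : r <= d - cIm w by rewrite /r !ge_min lexx ?orbT.
rewrite (@rint_deform _ a b c d w r); slra; last first.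
  by move=> z zr zw; apply: holoM; [exact: Hf|exact: holo_shiftV].
rewrite -(rint_inv_square w r0) [_ * f w]mulrC.
have sub z : rbnd (cRe w - r) (cRe w + r) (cIm w - r) (cIm w + r) z -> rect a b c d z /\ r <= normc (z - w).
  move=> zr; split; last by apply: (rbnd_far zr); lra.
  case: zr => /andP[? ?] /andP[? ?] _; by split; lra.
have subn z : rbnd (cRe w - r) (cRe w + r) (cIm w - r) (cIm w + r) z -> z != w.
  by move=> /sub[_ h]; rewrite -subr_eq0 -normc_gt0; exact: lt_le_trans h.
have ab' : cRe w - r <= cRe w + r by lra.
have cd' : cIm w - r <= cIm w + r by lra.
have cV : rcont (fun z => (z - w)^-1) (cRe w - r) (cRe w + r) (cIm w - r) (cIm w + r).
  by move=> z /subn zw; apply/holo_ccont/holo_shiftV.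
have cF : rcont (fun z => f z * (z - w)^-1) (cRe w - r) (cRe w + r) (cIm w - r) (cIm w + r).
  by move=> z zr; apply: ccontM; [apply/holo_ccont/Hf; case: (sub z zr)|exact: cV].
rewrite -rintZ// -rintB//; last exact: rcontZ.
apply: le_trans (@rint_bound _ _ _ _ _ _ (e / 16 * r^-1) ab' cd' _ _) _.
- by move=> z zr; apply: ccontB; [exact: cF|exact: (rcontZ _ cV)].
- move=> z zr; have [_ zw] := sub z zr.
  rewrite -mulrBl Normc.normcM Normc.normcV; apply: ler_pM; rewrite ?normc_ge0//.
  + by rewrite invr_ge0 normc_ge0.
  + have := Hd (z - w); rewrite [w + _]addrC subrK; apply.
    apply: le_lt_trans (_ : r + r < dl); last lra.
    apply: le_trans (normc_leD _) _; rewrite !(cReD,cImD,cReN,cImN).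
    case: zr => /andP[? ?] /andP[? ?] _.
    by apply: lerD; rewrite ler_norml; apply/andP; split; lra.
  + by rewrite lef_pV2 ?posrE//; exact: lt_le_trans zw.
rewrite le_eqVlt; apply/orP; left; apply/eqP.
have -> : (cRe w + r - (cRe w - r) + (cIm w + r - (cIm w - r))) = 4 * r by ring.
by field; rewrite gt_eqF.
Qed.

End CauchyFormula.

(** * Taylor expansion of entire functions *)

Section Taylor.
Context {R : realType}.
Implicit Types (f g : R[i] -> R[i]) (a b c d m : R).

Lemma pcont_bounded (g : R -> R[i]) a b : a <= b -> pcont g a b ->
  exists M : R, forall x, a <= x <= b -> normc (g x) <= M.
Proof.
move=> ab cg; have cn := pcont_within (p := @normc R) (@normc_lip R) cg.
have [c _ Hc] := EVT_max ab cn; exists (normc (g c)) => x xab.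
by apply: Hc; rewrite in_itv.
Qed.

Lemma rcont_bounded f a b c d : a <= b -> c <= d -> rcont f a b c d ->
  exists2 M : R, 0 <= M & forall z, rbnd a b c d z -> normc (f z) <= M.
Proof.
move=> ab cd Hf; have [h1 h2 h3 h4] := rcont_pcont ab cd Hf.
have [M1 H1] := pcont_bounded ab h1; have [M2 H2] := pcont_bounded ab h2.
have [M3 H3] := pcont_bounded cd h3; have [M4 H4] := pcont_bounded cd h4.
exists (`|M1| + `|M2| + `|M3| + `|M4|); first by rewrite !addr_ge0.
have := ler_norm M1; have := ler_norm M2; have := ler_norm M3; have := ler_norm M4.
have := normr_ge0 M1; have := normr_ge0 M2; have := normr_ge0 M3; have := normr_ge0 M4.
move=> ? ? ? ? ? ? ? ? [x y] [/= xab ycd []] E; subst.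
- have := H3 y ycd; lra.
- have := H4 y ycd; lra.
- have := H1 x xab; lra.
- have := H2 x xab; lra.
Qed.

(** First-order expansion of x^n with x = 1 / (z - w), y = 1 / (z - w - h), for
    which y - x = h x y; the constant only depends on a bound for x and y.  It
    allows differentiation under the integral sign. *)
Lemma powV_expansion (M : R) n : 0 <= M -> exists2 C : R, 0 <= C &
  forall x y h : R[i], y - x = h * x * y -> normc x <= M -> normc y <= M ->
    normc (y ^+ n - x ^+ n) <= C * normc h /\
    normc (y ^+ n - x ^+ n - n%:R * h * x ^+ n.+1) <= C * normc h ^+ 2.
Proof.
move=> M0; elim: n => [|n [C C0 IH]].
  exists 0 => // x y h _ _ _.
  by rewrite !expr0 subrr !mul0r subrr Normc.normc0 lexx.
pose C' := M * C + M ^+ n.+2 + (M ^+ 2 * C + M ^+ n.+3).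
have mM k : 0 <= M ^+ k by exact: exprn_ge0.
exists C'; first by rewrite /C' !addr_ge0// !mulr_ge0.
move=> x y h E xM yM; have [h1 h2] := IH x y h E xM yM.
have nx := normc_ge0 x; have ny := normc_ge0 y; have nh := normc_ge0 h.
have xk k : normc (x ^+ k) <= M ^+ k by rewrite normcX lerXn2r ?nnegrE.
have D0 := normc_ge0 (y ^+ n - x ^+ n).
set D := y ^+ n - x ^+ n in h1 h2 D0.
split.
  have -> : y ^+ n.+1 - x ^+ n.+1 = y * D + h * (x ^+ n.+1 * y).
    have -> : h * (x ^+ n.+1 * y) = (h * x * y) * x ^+ n by rewrite exprS; ring.
    rewrite -E /D !exprS; ring.
  apply: le_trans (le_normcD _ _) _; rewrite !Normc.normcM.
  apply: (@le_trans _ _ (M * (C * normc h) + normc h * (M ^+ n.+1 * M))).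
    apply: lerD; first by apply: ler_pM.
    by apply: ler_wpM2l => //; apply: ler_pM => //; exact: normc_ge0.
  have -> : M * (C * normc h) + normc h * (M ^+ n.+1 * M) = (M * C + M ^+ n.+2) * normc h.
    by rewrite [M ^+ n.+2]exprSr; ring.
  rewrite ler_wpM2r// /C' lerDl addr_ge0// mulr_ge0//.
set E' := D - _ in h2.
have -> : y ^+ n.+1 - x ^+ n.+1 - n.+1%:R * h * x ^+ n.+2 =
   x * E' + (h * (x * (y * D)) + h * (h * (x ^+ n.+2 * y))).
  apply/eqP; rewrite -subr_eq0; apply/eqP.
  have E0 : y - x - h * x * y = 0 by rewrite E subrr.
  rewrite -[RHS](mul0r (x ^+ n + D + h * x ^+ n.+1)) -E0 /E' /D !exprS -natr1; ring.
apply: le_trans (le_normcD _ _) _.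
move: (x ^+ n.+2) (xk n.+2) => X nX.
apply: le_trans (lerD (lexx _) (le_normcD _ _)) _; rewrite !Normc.normcM.
apply: (@le_trans _ _ (M * (C * normc h ^+ 2) + (normc h * (M * (M * (C * normc h))) + normc h * (normc h * (M ^+ n.+2 * M))))).
  apply: lerD; first by apply: ler_pM => //; exact: normc_ge0.
  apply: lerD; apply: ler_wpM2l => //.
    by apply: ler_pM => //; [exact: mulr_ge0|exact: ler_pM].
  by apply: ler_wpM2l => //; apply: ler_pM => //; exact: normc_ge0.
have -> : M * (C * normc h ^+ 2) + (normc h * (M * (M * (C * normc h))) + normc h * (normc h * (M ^+ n.+2 * M))) =
  (M * C + (M ^+ 2 * C + M ^+ n.+3)) * normc h ^+ 2.
  by rewrite [M ^+ n.+3]exprSr; ring.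
rewrite ler_wpM2r ?exprn_ge0// /C'; have := mM n.+2; lra.
Qed.

Context (f : R[i] -> R[i]) (Hf : forall z, holo f z) (rho : R) (rho0 : 0 < rho).

Let Phi n w := rint (fun z => f z * (z - w)^-1 ^+ n) (- rho) rho (- rho) rho.

Let rr : - rho <= rho. Proof. by move: rho0 => h; lra. Qed.

Lemma bnd_far z w : rbnd (- rho) rho (- rho) rho z -> rho - normc w <= normc (z - w).
Proof.
move=> zr; apply: le_trans (normc_lebB z w); rewrite lerD2r.
have := normc_Re z; have := normc_Im z.
have := ler_norm (cRe z); have := ler_norm (- cRe z).
have := ler_norm (cIm z); have := ler_norm (- cIm z); rewrite !normrN.
case: zr => _ _ [] ->; lra.
Qed.

Lemma bnd_neq z w : normc w < rho -> rbnd (- rho) rho (- rho) rho z -> z != w.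
Proof.
move=> wr zr; have h := bnd_far w zr; rewrite -subr_eq0 -normc_gt0; apply: lt_le_trans h; lra.
Qed.

Lemma rcont_Phi n w : normc w < rho ->
  rcont (fun z => f z * (z - w)^-1 ^+ n) (- rho) rho (- rho) rho.
Proof.
move=> wr z zr; apply: holo_ccont; apply: holoM; first exact: Hf.
by apply/holoX/holo_shiftV; exact: bnd_neq zr.
Qed.

Lemma rcont_f : rcont f (- rho) rho (- rho) rho.
Proof. by move=> z _; apply: holo_ccont. Qed.

Lemma cdiff_Phi n w : normc w < rho -> cdiff (Phi n) w (n%:R * Phi n.+1 w).
Proof.
move=> wr e e0.
have [F F0 HF] := rcont_bounded rr rr rcont_f.
pose eta := rho - normc w; have eta0 : 0 < eta by rewrite /eta; lra.
have M0 : 0 <= 2 / eta by rewrite divr_ge0// ltW.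
have [C C0 HC] := powV_expansion n M0.
pose K := 16 * F * C * rho + 1.
have K0 : 0 < K by rewrite /K ltr_wpDl// !mulr_ge0// ltW.
exists (Num.min (eta / 2) (e / K)); first by rewrite lt_min !divr_gt0.
move=> h; rewrite lt_min => /andP[h1 h2].
have nh := normc_ge0 h.
have whr : normc (w + h) < rho by apply: le_lt_trans (le_normcD _ _) _; rewrite /eta in h1; lra.
have -> : Phi n (w + h) - Phi n w - n%:R * Phi n.+1 w * h =
  rint (fun z => f z * (z - (w + h))^-1 ^+ n - f z * (z - w)^-1 ^+ n - (n%:R * h) * (f z * (z - w)^-1 ^+ n.+1)) (- rho) rho (- rho) rho.
  have c1 := @rcont_Phi n _ whr; have c2 := @rcont_Phi n _ wr; have c3 := @rcont_Phi n.+1 _ wr.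
  rewrite rintB //; last exact: rcontZ.
    by rewrite (rintB rr rr c1 c2) (rintZ _ rr rr c3) /Phi [in LHS]mulrAC.
  by move=> z zr; apply: ccontB; [exact: c1|exact: c2].
apply: le_trans (@rint_bound _ _ _ _ _ _ (F * (C * normc h ^+ 2)) rr rr _ _) _.
- move=> z zr; apply: holo_ccont.
  have zw := bnd_neq wr zr; have zwh := bnd_neq whr zr.
  have k1 := holoX n (holo_shiftV zwh); have k2 k := holoX k (holo_shiftV zw).
  have -> : (fun z => f z * (z - (w + h))^-1 ^+ n - f z * (z - w)^-1 ^+ n - (n%:R * h) * (f z * (z - w)^-1 ^+ n.+1))
    = (fun z => f z * (z - (w + h))^-1 ^+ n + (-1) * (f z * (z - w)^-1 ^+ n) + (- (n%:R * h)) * (f z * (z - w)^-1 ^+ n.+1)).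
    by apply/funext => x; rewrite mulN1r mulNr.
  apply: holoD; last by apply: holoM; [exact: holo_cst|apply: holoM].
  apply: holoD; last by apply: holoM; [exact: holo_cst|apply: holoM].
  exact: holoM.
- move=> z zr.
  have zw := bnd_neq wr zr; have zwh := bnd_neq whr zr.
  have -> : f z * (z - (w + h))^-1 ^+ n - f z * (z - w)^-1 ^+ n - (n%:R * h) * (f z * (z - w)^-1 ^+ n.+1) =
    f z * ((z - (w + h))^-1 ^+ n - (z - w)^-1 ^+ n - n%:R * h * (z - w)^-1 ^+ n.+1) by ring.
  rewrite Normc.normcM; apply: ler_pM; rewrite ?normc_ge0//; first exact: HF.
  apply: (HC _ _ _ _ _ _).2.
  + by field; rewrite !subr_eq0 zw zwh.
  + rewrite Normc.normcV -[2 / eta]invrK lef_pV2 ?posrE ?invr_gt0 ?divr_gt0//; last first.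
      by rewrite normc_gt0 subr_eq0.
    rewrite invf_div; have := bnd_far w zr; rewrite /eta in eta0 *; lra.
  + rewrite Normc.normcV -[2 / eta]invrK lef_pV2 ?posrE ?invr_gt0 ?divr_gt0//; last first.
      by rewrite normc_gt0 subr_eq0.
    rewrite invf_div; have := bnd_far (w + h) zr; have := le_normcD w h; rewrite /eta in eta0 h1 *; lra.
have -> : 4 * (F * (C * normc h ^+ 2)) * (rho - - rho + (rho - - rho)) = (normc h * (16 * F * C * rho)) * normc h by ring.
apply: ler_wpM2r => //; apply: (@le_trans _ _ (normc h * K)).
  by apply: ler_wpM2l => //; rewrite /K; lra.
by rewrite -ler_pdivlMr// ltW.
Qed.

Lemma cdiff_local (g h : R[i] -> R[i]) (w l : R[i]) (d : R) : 0 < d ->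
  (forall k, normc k < d -> g (w + k) = h (w + k)) -> cdiff g w l -> cdiff h w l.
Proof.
move=> d0 E H e e0; have [d' d0' Hd] := H e e0.
exists (Num.min d d'); first by rewrite lt_min d0.
move=> k; rewrite lt_min => /andP[k1 k2]; rewrite -E// -[h w](congr1 h (addr0 w)) -E.
  by rewrite addr0; exact: Hd.
by rewrite Normc.normc0.
Qed.

Let tpi : R[i] := (2 * pi)%:C * 'i.

Lemma tpi_neq0 : tpi != 0.
Proof.
rewrite mulf_neq0//.
  by rewrite eq_complex /= eqxx andbT mulf_neq0// gt_eqF// pi_gt0.
by rewrite eq_complex /= oner_eq0 andbF.
Qed.

(** The iterated derivatives are those of the Cauchy integral.  In particular
    a merely differentiable entire function is infinitely differentiable. *)
Lemma cderivn_cauchy k w : normc w < rho ->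
  cderivn k f w = tpi^-1 * k`!%:R * Phi k.+1 w.
Proof.
elim: k w => [|k IH] w wr.
  have E : Phi 1 w = tpi * f w.
    rewrite -(@cauchy_formula _ f (- rho) rho (- rho) rho w); first by rewrite /Phi; under eq_fun do rewrite expr1.
    - by have := normc_Re w; rewrite ler_norml => /andP[? ?]; lra.
    - by have := normc_Im w; rewrite ler_norml => /andP[? ?]; lra.
    - by move=> z _; exact: Hf.
  by rewrite E /cderivn /= fact0 mulr1 mulKf// tpi_neq0.
have : cdiff (cderivn k f) w (tpi^-1 * k`!%:R * (k.+1%:R * Phi k.+2 w)).
  apply: (@cdiff_local (fun w => tpi^-1 * k`!%:R * Phi k.+1 w) _ _ _ (rho - normc w)); first by rewrite subr_gt0.
    by move=> h hr; rewrite -IH//; apply: le_lt_trans (le_normcD _ _) _; lra.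
  exact: cdiffZ (cdiff_Phi _ wr).
move/cdiff_derive1; rewrite /cderivn /derive1n /= => ->.
rewrite factS natrM; ring.
Qed.

Lemma geometric_remainder n (z w : R[i]) : z != 0 -> z != w ->
  (z - w)^-1 = \sum_(k < n) w ^+ k * (z - 0)^-1 ^+ k.+1 + w ^+ n * (z^-1 ^+ n * (z - w)^-1).
Proof.
move=> z0 zw; have zw' : z - w != 0 by rewrite subr_eq0.
elim: n => [|n IH]; first by rewrite big_ord0 add0r !expr0 !mul1r.
rewrite big_ord_recr /= {1}IH -addrA subr0; congr (_ + _).
rewrite !exprS; set X := w ^+ n; set Y := z^-1 ^+ n; field; by rewrite zw' z0.
Qed.

(** The geometric series of 1 / (z - w) is integrated term by term; its
    remainder carries the factor (w / z)^n, and |z| >= rho on the contour. *)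
Lemma taylor_remainder w : normc w < rho -> exists2 C : R, 0 <= C &
  forall n, normc (f w - \sum_(k < n) (cderivn k f 0 / k`!%:R) * w ^+ k) <= C * (normc w / rho) ^+ n.
Proof.
move=> wr.
have [F F0 HF] := rcont_bounded rr rr rcont_f.
pose eta := rho - normc w; have eta0 : 0 < eta by rewrite /eta; lra.
exists (normc tpi^-1 * (4 * (F / eta) * (4 * rho))).
  by rewrite !mulr_ge0 ?normc_ge0// ?invr_ge0 ltW.
move=> n.
have n0 : normc 0 < rho by rewrite Normc.normc0.
have E : tpi * f w = Phi 1 w.
  rewrite /Phi -(@cauchy_formula _ f (- rho) rho (- rho) rho w).
  - by under eq_fun do rewrite -[X in _ * X]expr1.
  - by have := normc_Re w; rewrite ler_norml => /andP[? ?]; lra.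
  - by have := normc_Im w; rewrite ler_norml => /andP[? ?]; lra.
  - by move=> z _; exact: Hf.
pose Rm z := w ^+ n * (f z * (z^-1 ^+ n * (z - w)^-1)).
have cR : rcont Rm (- rho) rho (- rho) rho.
  move=> z zr; apply: holo_ccont; apply: holoM; first exact: holo_cst.
  apply: holoM => //; apply: holoM; last by apply: holo_shiftV; exact: bnd_neq zr.
  have := holo_shiftV (bnd_neq n0 zr) => /(holoX n).
  by under eq_fun do rewrite subr0.
have cS (k : 'I_n) : rcont (fun z => w ^+ k * (f z * (z - 0)^-1 ^+ k.+1)) (- rho) rho (- rho) rho.
  by apply: rcontZ; exact: rcont_Phi.
have E2 : Phi 1 w = \sum_(k < n) w ^+ k * Phi k.+1 0 + rint Rm (- rho) rho (- rho) rho.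
  have -> : \sum_(k < n) w ^+ k * Phi k.+1 0 = rint (fun z => \sum_(k < n) w ^+ k * (f z * (z - 0)^-1 ^+ k.+1)) (- rho) rho (- rho) rho.
    by rewrite rint_sum//; apply: eq_bigr => k _; rewrite rintZ//; exact: rcont_Phi.
  rewrite -rintD//; last exact: rcont_sum.
  apply: eq_rint => // z zr.
  rewrite expr1 (@geometric_remainder n) ?(bnd_neq _ zr)//.
  rewrite mulrDr big_distrr /=; congr (_ + _); last by rewrite /Rm; ring.
  by apply: eq_bigr => k _; ring.
have -> : f w - \sum_(k < n) (cderivn k f 0 / k`!%:R) * w ^+ k = tpi^-1 * rint Rm (- rho) rho (- rho) rho.
  apply: (mulfI tpi_neq0); rewrite mulrBr E E2 mulrA divff ?tpi_neq0// mul1r.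
  have -> : tpi * (\sum_(k < n) (cderivn k f 0 / k`!%:R) * w ^+ k) = \sum_(k < n) w ^+ k * Phi k.+1 0.
    rewrite big_distrr /=; apply: eq_bigr => k _; rewrite (cderivn_cauchy k n0).
    have k0 : (k`!%:R : R[i]) != 0 by rewrite pnatr_eq0 -lt0n fact_gt0.
    move: (Phi k.+1 0) tpi tpi_neq0 (w ^+ k) => P T T0 X; field; by rewrite T0 k0.
  by rewrite addrC addKr.
rewrite Normc.normcM -!mulrA ler_wpM2l ?normc_ge0//.
apply: le_trans (@rint_bound _ _ _ _ _ _ ((normc w / rho) ^+ n * (F / eta)) rr rr cR _) _; last first.
  rewrite le_eqVlt; apply/orP; left; apply/eqP; ring.
move=> z zr.
have zrho : rho <= normc z by have := bnd_far 0 zr; rewrite subr0 Normc.normc0 subr0.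
have zeta := bnd_far w zr.
rewrite /Rm !Normc.normcM !normcX !Normc.normcV exprMn -!mulrA ler_wpM2l ?exprn_ge0 ?normc_ge0//.
have -> : normc (f z) * ((normc z)^-1 ^+ n * (normc (z - w))^-1) = (normc z)^-1 ^+ n * (normc (f z) * (normc (z - w))^-1) by ring.
apply: ler_pM.
- by rewrite exprn_ge0// invr_ge0 normc_ge0.
- by rewrite mulr_ge0 ?normc_ge0// invr_ge0 normc_ge0.
- rewrite lerXn2r ?nnegrE ?invr_ge0 ?normc_ge0 ?(ltW rho0)//.
  by rewrite lef_pV2 ?posrE// (lt_le_trans rho0).
- apply: ler_pM; rewrite ?normc_ge0// ?invr_ge0 ?normc_ge0//; first exact: HF.
  by rewrite lef_pV2 ?posrE// (lt_le_trans eta0).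
Qed.

End Taylor.

Section TaylorConvergence.
Context {R : realType}.
Implicit Types (f g : R[i] -> R[i]).

Lemma taylor_cvg f w : entire f -> forall e : R, 0 < e -> exists N, forall n, (N <= n)%N ->
  normc (f w - \sum_(k < n) (cderivn k f 0 / k`!%:R) * w ^+ k) <= e.
Proof.
move=> /entire_cdiff Hf e e0.
have nw := normc_ge0 w.
(* any rho > 2 |w| makes the ratio |w| / rho at most 1 / 2 *)
pose rho := 2 * normc w + 1.
have rho0 : 0 < rho by rewrite /rho; lra.
have wr : normc w < rho by rewrite /rho; lra.
have [C C0 HC] := taylor_remainder Hf rho0 wr.
have [N HN] := le_pow2_eps C0 e0.
exists N => n Nn; apply: le_trans (HC n) _; apply: le_trans HN.
apply: ler_wpM2l => //.
have h : normc w / rho <= 2^-1 by rewrite ler_pdivrMr// /rho; lra.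
apply: (@le_trans _ _ (2^-1 ^+ n)).
  by rewrite lerXn2r ?nnegrE// ?invr_ge0// divr_ge0// ltW.
rewrite -exprVn ler_wiXn2l// ?invr_ge0//; lra.
Qed.

End TaylorConvergence.

(** * The complex exponential *)

Section CExp.
Context {R : realType}.
Implicit Types (z w : R[i]).

Lemma cexpD z w : cexp (z + w) = cexp z * cexp w.
Proof.
case: z w => [a b] [c d]; apply: eq_complexP; rewrite ?cReM ?cImM /= expRD.
  by rewrite cosD; ring.
by rewrite sinD; ring.
Qed.

Lemma cexp0 : cexp (0 : R[i]) = 1.
Proof. by apply: eq_complexP; rewrite /= expR0 ?cos0 ?sin0 ?mul1r. Qed.

Lemma normc_cexp z : normc (cexp z) = expR (cRe z).
Proof.
rewrite /cexp /= !exprMn -mulrDr cos2Dsin2 mulr1 sqrtr_sqr ger0_norm//; exact: expR_ge0.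
Qed.

Lemma cexpN z : cexp (- z) * cexp z = 1.
Proof. by rewrite -cexpD addNr cexp0. Qed.

Lemma cexp_nat z n : cexp (n%:R * z) = cexp z ^+ n.
Proof.
elim: n => [|n IH]; first by rewrite mul0r cexp0.
by rewrite exprS -IH -cexpD -natr1; congr cexp; ring.
Qed.

Lemma cexp_real (x : R) : cexp x%:C = (expR x)%:C.
Proof. by apply: eq_complexP; rewrite /= ?cos0 ?sin0 ?mulr1 ?mulr0. Qed.

Lemma is_derive_estimate (g : R -> R) (x l : R) : is_derive x (1 : R) g l ->
  forall e : R, 0 < e -> exists2 d : R, 0 < d &
  forall h, `|h| < d -> `|g (x + h) - g x - l * h| <= e * `|h|.
Proof.
move=> [dg Dg] e e0.
have H : (fun h : R => h^-1 *: (g (h *: 1 + x) - g x)) @ 0^' --> l by rewrite -Dg; exact: dg.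
move/cvgrPdist_lt : H => /(_ _ e0); rewrite /dnbhs /within /= => /nbhs_ballP[d d0 Hd].
exists d => // h hd.
have [->|h0] := eqVneq h 0; first by rewrite addr0 subrr mulr0 subrr normr0 mulr0.
have := Hd h; rewrite /ball /= sub0r normrN => /(_ hd h0)/ltW.
rewrite /GRing.scale /= mulr1 [h + x]addrC.
have -> : l - h^-1 * (g (x + h) - g x) = - (h^-1 * (g (x + h) - g x - l * h)) by field.
have nh : 0 < `|h| by rewrite normr_gt0.
by rewrite normrN normrM normfV mulrC ler_pdivrMr.
Qed.

Lemma cdiff_cexp0 : cdiff cexp (0 : R[i]) 1.
Proof.
move=> e e0.
(* the two components will be bounded by 4 e1 |h| and 5 e1 |h| *)
pose e1 := Num.min 1 (e / 16).
have e10 : 0 < e1 by rewrite lt_min ltr01 divr_gt0.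
have e1le : e1 <= 1 by rewrite ge_min lexx.
have e1e : e1 <= e / 16 by rewrite ge_min lexx orbT.
clearbody e1.
have [d1 d10 H1] := is_derive_estimate (is_derive_expR (0 : R)) e10.
have [d2 d20 H2] := is_derive_estimate (is_derive_cos (0 : R)) e10.
have [d3 d30 H3] := is_derive_estimate (is_derive_sin (0 : R)) e10.
exists (Num.min e1 (Num.min d1 (Num.min d2 d3))); first by rewrite !lt_min e10 d10 d20.
move=> h; rewrite !lt_min => /and4P[h0 h1 h2 h3].
have nRe := normc_Re h; have nIm := normc_Im h.
rewrite add0r cexp0 mul1r; apply: le_trans (normc_leD _) _.
rewrite !(cReD, cImD, cReN, cImN).
move: (normc h) h0 h1 h2 h3 nRe nIm => N h0 h1 h2 h3.
case: h => a b /= nRe nIm.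
have := H1 a (le_lt_trans nRe h1); rewrite add0r expR0 mul1r.
have := H2 b (le_lt_trans nIm h2); rewrite add0r sin0 oppr0 mul0r subr0 cos0.
have := H3 b (le_lt_trans nIm h3); rewrite add0r cos0 sin0 subr0 mul1r.
move=> k3 k2 k1.
rewrite addr0.
have na := normr_ge0 a; have nb := normr_ge0 b.
set A := expR a - 1 - a in k1; set C := cos b - 1 in k2; set S := sin b - b in k3.
have -> : expR a * cos b - 1 - a = A + ((A + a) * C + C) by rewrite /A /C; ring.
have -> : expR a * sin b - b = (A + a) * (S + b) + S by rewrite /A /S; ring.
have nA : `|A + a| <= 2 * N.
  apply: le_trans (ler_normD _ _) _; nra.
have nS : `|S + b| <= 2 * e1.
  apply: le_trans (ler_normD _ _) _; nra.
have t1 : `|A + ((A + a) * C + C)| <= 4 * e1 * N.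
  apply: le_trans (ler_normD _ _) _; apply: le_trans (lerD (lexx _) (ler_normD _ _)) _.
  rewrite normrM.
  have : `|A + a| * `|C| <= 2 * N * e1.
    apply: ler_pM => //; apply: le_trans k2 _; rewrite -[leRHS]mulr1; apply: ler_wpM2l; lra.
  have : e1 * `|a| <= e1 * N by apply: ler_wpM2l => //; lra.
  have : e1 * `|b| <= e1 * N by apply: ler_wpM2l => //; lra.
  lra.
have t2 : `|(A + a) * (S + b) + S| <= 5 * e1 * N.
  apply: le_trans (ler_normD _ _) _; rewrite normrM.
  have : `|A + a| * `|S + b| <= 2 * N * (2 * e1) by apply: ler_pM.
  have : e1 * `|b| <= e1 * N by apply: ler_wpM2l => //; lra.
  lra.
have N0 : 0 <= N by lra.
have := ler_wpM2r N0 e1e; rewrite mulrAC => h; have := mulr_ge0 (ltW e0) N0; lra.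
Qed.

Lemma cdiff_cexp z : cdiff cexp z (cexp z).
Proof.
have H : cdiff cexp (1 * z + (- z)) (1 : R[i]) by rewrite mul1r subrr; exact: cdiff_cexp0.
have := cdiffZ (cexp z) (cdiff_affine H); rewrite !mulr1.
by apply: cdiff_eq => x; rewrite mul1r -cexpD addrC subrK.
Qed.

Lemma cdiff_cexp_affine (a b z : R[i]) :
  cdiff (fun x => cexp (a * x + b)) z (a * cexp (a * z + b)).
Proof. exact: cdiff_affine (cdiff_cexp _). Qed.

Lemma cderivn_sum_cexp (I : Type) (s : seq I) (c a : I -> R[i]) n z :
  cderivn n (fun x => \sum_(i <- s) c i * cexp (a i * x)) z =
  \sum_(i <- s) c i * a i ^+ n * cexp (a i * z).
Proof.
elim: n z => [|n IH] z; first by rewrite /cderivn /=; apply: eq_bigr => i _; rewrite expr0 mulr1.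
rewrite /cderivn /derive1n /=.
apply: cdiff_derive1.
apply: (@cdiff_eq _ (fun z => \sum_(i <- s) c i * a i ^+ n * cexp (a i * z))).
  by move=> x; rewrite -IH.
rewrite (eq_bigr (fun i => c i * a i ^+ n * (a i * cexp (a i * z)))); last first.
  by move=> i _; rewrite exprSr !mulrA.
apply: cdiff_sum => i; apply: cdiffZ.
have := cdiff_cexp_affine (a i) 0 z; rewrite addr0.
by apply: cdiff_eq => x; rewrite addr0.
Qed.

Lemma cexp_taylor z (e : R) : 0 < e -> exists N, forall n, (N <= n)%N ->
  normc (cexp z - \sum_(k < n) z ^+ k / k`!%:R) <= e.
Proof.
move=> e0.
have ent : entire (cexp : R[i] -> R[i]).
  by apply: cdiff_entire => w; exists (cexp w); exact: cdiff_cexp.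
have [N HN] := taylor_cvg z ent e0; exists N => n /HN.
suff -> : \sum_(k < n) cderivn k cexp 0 / k`!%:R * z ^+ k = \sum_(k < n) z ^+ k / k`!%:R by [].
apply: eq_bigr => k _.
have -> : cexp = (fun x => \sum_(i <- [:: tt]) (fun=> 1) i * cexp ((fun=> 1) i * x)) :> (R[i] -> R[i]).
  by apply/funext => x; rewrite big_cons big_nil addr0 !mul1r.
by rewrite cderivn_sum_cexp big_cons big_nil addr0 mulr0 cexp0 expr1n !mul1r mulrC.
Qed.

Lemma entire_translate beta (f : R[i] -> R[i]) : entire f -> entire (fock_translate beta f).
Proof.
move=> /entire_cdiff Hf; apply: cdiff_entire => z.
have [l Hl] := Hf (1 * z + (- beta)).
have := cdiffM (cdiff_cexp_affine beta^* (- (2^-1 * `|beta| ^+ 2)) z) (cdiff_affine Hl).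
set L := (X in cdiff _ _ X) => HL; exists L.
by apply: cdiff_eq HL => x; rewrite /fock_translate mul1r [- _ + _]addrC.
Qed.

End CExp.

(** * Local lower bounds for the Fock norm *)

Section Measurability.
Context {R : realType}.
Notation mu := (@lebesgue_measure R).

Definition cmeas (g : R * R -> R[i]) :=
  measurable_fun [set: R * R] (fun p => cRe (g p)) /\
  measurable_fun [set: R * R] (fun p => cIm (g p)).

Lemma cmeas_cst (a : R[i]) : cmeas (fun=> a).
Proof. by split; exact: measurable_cst. Qed.

Lemma cmeas_id : cmeas (fun p => p.1 +i* p.2).
Proof. by split => /=; [exact: measurable_fst|exact: measurable_snd]. Qed.

Lemma cmeasD g h : cmeas g -> cmeas h -> cmeas (fun p => g p + h p).
Proof.
move=> [g1 g2] [h1 h2]; split.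
  rewrite (_ : (fun _ => _) = (fun p => cRe (g p)) \+ (fun p => cRe (h p))).
    exact: measurable_funD.
  by apply/funext => p; rewrite cReD.
rewrite (_ : (fun _ => _) = (fun p => cIm (g p)) \+ (fun p => cIm (h p))).
  exact: measurable_funD.
by apply/funext => p; rewrite cImD.
Qed.

Lemma cmeasM g h : cmeas g -> cmeas h -> cmeas (fun p => g p * h p).
Proof.
move=> [g1 g2] [h1 h2]; split.
  rewrite (_ : (fun _ => _) = ((fun p => cRe (g p)) \* (fun p => cRe (h p))) \- ((fun p => cIm (g p)) \* (fun p => cIm (h p)))).
    by apply: measurable_funB; exact: measurable_funM.
  by apply/funext => p; rewrite cReM.
rewrite (_ : (fun _ => _) = ((fun p => cRe (g p)) \* (fun p => cIm (h p))) \+ ((fun p => cIm (g p)) \* (fun p => cRe (h p)))).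
  by apply: measurable_funD; exact: measurable_funM.
by apply/funext => p; rewrite cImM.
Qed.

Lemma cmeasX g n : cmeas g -> cmeas (fun p => g p ^+ n).
Proof.
move=> mg; elim: n => [|n IH]; first exact: cmeas_cst.
rewrite (_ : (fun _ => _) = (fun p => g p * g p ^+ n)); first exact: cmeasM.
by apply/funext => p; rewrite exprS.
Qed.

Lemma cmeas_sum (I : Type) (s : seq I) (F : I -> R * R -> R[i]) :
  (forall i, cmeas (F i)) -> cmeas (fun p => \sum_(i <- s) F i p).
Proof.
move=> mF; elim: s => [|a s IH].
  rewrite (_ : (fun _ => _) = fun=> 0); first exact: cmeas_cst.
  by apply/funext => p; rewrite big_nil.
rewrite (_ : (fun _ => _) = (fun p => F a p + \sum_(i <- s) F i p)); first exact: cmeasD.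
by apply/funext => p; rewrite big_cons.
Qed.

(** An entire function is the pointwise limit of its Taylor polynomials, which
    are measurable on the product space. *)
Lemma cmeas_entire f : entire f -> cmeas (fun p => f (p.1 +i* p.2)).
Proof.
move=> ef.
pose g n (p : R * R) : R[i] := \sum_(k < n) (cderivn k f 0 / k`!%:R) * (p.1 +i* p.2) ^+ k.
have mg n : cmeas (g n).
  by apply: cmeas_sum => k; apply: cmeasM; [exact: cmeas_cst|exact/cmeasX/cmeas_id].
have cg p (e : R) : 0 < e -> \forall n \near \oo, normc (f (p.1 +i* p.2) - g n p) <= e.
  by move=> e0; have [N HN] := taylor_cvg (p.1 +i* p.2) ef e0; exists N => // n /= /HN.
split.
- apply: (@measurable_fun_cvg _ _ _ _ (fun n p => cRe (g n p))); first by move=> n; exact: (mg n).1.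
  move=> p _; apply/cvgrPdist_le => e e0; near=> n.
  apply: le_trans (Re_lip _ _) _; near: n; exact: cg.
- apply: (@measurable_fun_cvg _ _ _ _ (fun n p => cIm (g n p))); first by move=> n; exact: (mg n).2.
  move=> p _; apply/cvgrPdist_le => e e0; near=> n.
  apply: le_trans (Im_lip _ _) _; near: n; exact: cg.
Unshelve. all: by end_near. Qed.

Lemma measurable_sqmod f : entire f ->
  measurable_fun [set: R * R] (fun p => sqmod (f (p.1 +i* p.2))).
Proof.
move=> /cmeas_entire[m1 m2].
rewrite (_ : (fun _ => _) = ((fun p => cRe (f (p.1 +i* p.2))) \* (fun p => cRe (f (p.1 +i* p.2)))) \+
  ((fun p => cIm (f (p.1 +i* p.2))) \* (fun p => cIm (f (p.1 +i* p.2))))).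
  by apply: measurable_funD; exact: measurable_funM.
by apply/funext => p; rewrite sqmodE !expr2.
Qed.

Definition fock_density f z : R := sqmod (f z) * expR (- sqmod z).

Lemma fock_density_ge0 f z : 0 <= fock_density f z.
Proof. by rewrite mulr_ge0 ?sqr_ge0 ?expR_ge0. Qed.

Lemma measurable_fock_density f : entire f ->
  measurable_fun [set: R * R] (fun p => fock_density f (p.1 +i* p.2)).
Proof.
move=> ef; apply: measurable_funM; first exact: measurable_sqmod.
apply: measurableT_comp; first exact: measurable_expR.
apply: measurable_funN.
have ei : entire (id : R[i] -> R[i]) by apply: cdiff_entire => z; exists 1; exact: cdiff_id.
exact: (measurable_sqmod ei).
Qed.

Lemma fubini_restrict (F : R * R -> R) (A B : set R) :
  measurable A -> measurable B ->
  measurable_fun [set: R * R] F -> (forall p, 0 <= F p) ->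
  [/\ measurable_fun [set: R * R] ((fun p => (F p)%:E) \_ (A `*` B)),
   (forall p, (0 <= ((fun p => (F p)%:E) \_ (A `*` B)) p)%E),
   (forall x, A x -> (\int[mu]_y ((fun p => (F p)%:E) \_ (A `*` B)) (x, y) = \int[mu]_(y in B) (F (x, y))%:E)%E) &
   (forall y, B y -> (\int[mu]_x ((fun p => (F p)%:E) \_ (A `*` B)) (x, y) = \int[mu]_(x in A) (F (x, y))%:E)%E)].
Proof.
move=> mA mB mF F0; split.
- apply/(measurable_restrictT _ _).1.
    exact: measurableX.
  by apply: measurable_funTS; exact/measurable_EFinP.
- by move=> p; apply: erestrict_ge0 => q _; rewrite lee_fin.
- move=> x Ax; rewrite [RHS]integral_mkcond; apply: eq_integral => y _.
  rewrite !patchE; congr (if _ then _ else _).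
  by apply/idP/idP; rewrite !inE /= => // -[].
- move=> y By; rewrite [RHS]integral_mkcond; apply: eq_integral => x _.
  rewrite !patchE; congr (if _ then _ else _).
  by apply/idP/idP; rewrite !inE /= => // -[].
Qed.

Lemma slice_avg (S : R -> \bar R) (p r J J' : R) : 0 < r -> J < r * J' ->
  measurable_fun [set: R] S -> (forall x, (0 <= S x)%E) ->
  (\int[mu]_(x in `[p, (p + r)%R]) S x <= J%:E)%E ->
  exists2 x, p <= x <= p + r & (S x <= J'%:E)%E.
Proof.
move=> r0 JJ mS S0 SJ; apply: contrapT => nex.
have J'0 : 0 <= J'.
  have : (0 <= J%:E)%E by apply: le_trans SJ; exact: integral_ge0.
  rewrite lee_fin => J0; rewrite leNgt; apply/negP => J'0.
  have : r * J' < 0 by rewrite pmulr_rlt0.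
  lra.
have : (\int[mu]_(x in `[p, (p + r)%R]) (J'%:E) <= \int[mu]_(x in `[p, (p + r)%R]) S x)%E.
  apply: ge0_le_integral => //.
  - exact: measurable_funTS.
  - move=> x; rewrite /= in_itv /= => xp.
    by rewrite leNgt; apply/negP => /ltW h; apply: nex; exists x.
rewrite integral_cst//= lebesgue_measure_itv /= lte_fin ltrDl r0 => /le_trans/(_ SJ).
rewrite -EFinD -EFinM lee_fin addrAC subrr add0r; lra.
Qed.

(** Tonelli's theorem turns the plane integral into the integral of its slices. *)
Lemma vslice_avg (F : R * R -> R) (A B : set R) (p r J J' : R) : 0 < r -> J < r * J' ->
  measurable A -> measurable B -> measurable_fun [set: R * R] F -> (forall p, 0 <= F p) ->
  `[p, p + r] `<=` A ->
  (\int[mu \x mu]_(q in A `*` B) (F q)%:E <= J%:E)%E ->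
  exists2 x, p <= x <= p + r & (\int[mu]_(y in B) (F (x, y))%:E <= J'%:E)%E.
Proof.
move=> r0 JJ mA mB mF F0 pA FJ.
have [mG G0 HG _] := fubini_restrict mA mB mF F0.
set G := (X in measurable_fun _ X) in mG G0 HG.
have mS := measurable_fun_fubini_tonelli_F G mG G0 (m2 := mu).
have S0 x : (0 <= fubini_F mu G x)%E by apply: integral_ge0.
have [|x xp Sx] := slice_avg r0 JJ mS S0 (p := p).
  apply: le_trans FJ; rewrite [leRHS]integral_mkcond -/G fubini_tonelli1//.
  exact: ge0_subset_integral.
exists x => //; rewrite -HG //; apply: pA; by rewrite /= in_itv.
Qed.

Lemma hslice_avg (F : R * R -> R) (A B : set R) (p r J J' : R) : 0 < r -> J < r * J' ->
  measurable A -> measurable B -> measurable_fun [set: R * R] F -> (forall p, 0 <= F p) ->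
  `[p, p + r] `<=` B ->
  (\int[mu \x mu]_(q in A `*` B) (F q)%:E <= J%:E)%E ->
  exists2 y, p <= y <= p + r & (\int[mu]_(x in A) (F (x, y))%:E <= J'%:E)%E.
Proof.
move=> r0 JJ mA mB mF F0 pB FJ.
have [mG G0 _ HG] := fubini_restrict mA mB mF F0.
set G := (X in measurable_fun _ X) in mG G0 HG.
have mS := measurable_fun_fubini_tonelli_G G mG G0 (m1 := mu).
have S0 x : (0 <= fubini_G mu G x)%E by apply: integral_ge0.
have [|x xp Sx] := slice_avg r0 JJ mS S0 (p := p).
  apply: le_trans FJ; rewrite [leRHS]integral_mkcond -/G fubini_tonelli2//.
  exact: ge0_subset_integral.
exists x => //; rewrite -HG //; apply: pB; by rewrite /= in_itv.
Qed.

End Measurability.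

Section MeanValue.
Context {R : realType}.
Notation mu := (@lebesgue_measure R).
Implicit Types (f g : R[i] -> R[i]) (w z : R[i]).

Definition square w (r : R) : set (R * R) :=
  `[cRe w - r, cRe w + r] `*` `[cIm w - r, cIm w + r].

Lemma side_bound (g k : R -> R[i]) (a b a' b' r J : R) : 0 < r -> a' <= a -> b <= b' ->
  pcont g a b -> pcont k a' b' ->
  (forall x, a <= x <= b -> normc (g x) <= r^-1 * sqmod (k x)) ->
  (\int[mu]_(x in `[a', b']) (sqmod (k x))%:E <= J%:E)%E ->
  normc (cint a b g) <= 2 * (r^-1 * J).
Proof.
move=> r0 aa bb cg ck gk kJ.
have sE : (fun x => sqmod (k x)) = (fun x => normc (k x)) \* (fun x => normc (k x)).
  by apply/funext => x; rewrite /sqmod expr2.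
have ik' : mu.-integrable `[a', b'] (EFin \o (fun x => sqmod (k x))).
  apply: itv_continuous_integrable; rewrite sE.
  have ck' := pcont_within (p := @normc R) (@normc_lip R) ck.
  by move=> x; apply: cvgM; exact: ck'.
have sub : `[a, b] `<=` `[a', b'] by apply: subset_itvScc.
have ik : mu.-integrable `[a, b] (EFin \o (fun x => sqmod (k x))).
  exact: integrableS ik'.
have := cint_le cg (integrable_scale r^-1 ik) gk => /le_trans; apply.
rewrite RintegralZl// ler_wpM2l// ler_wpM2l ?invr_ge0 ?(ltW r0)//.
rewrite -lee_fin /Rintegral fineK; last exact: integrable_fin_num.
apply: le_trans kJ; apply: ge0_subset_integral => //.
- exact: measurable_int ik'.
- by move=> x _; rewrite lee_fin sqr_ge0.
Qed.

(** Cauchy's formula for f^2 on [a, b] x [c, d], all of whose sides are at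
    distance at least r from w. *)
Lemma square_mean_core f w (r J a b c d : R) : entire f -> 0 < r ->
  cRe w - 2 * r <= a <= cRe w - 2 * r + r -> cRe w + r <= b <= cRe w + r + r ->
  cIm w - 2 * r <= c <= cIm w - 2 * r + r -> cIm w + r <= d <= cIm w + r + r ->
  (\int[mu]_(y in `[(cIm w - 2 * r)%R, (cIm w + 2 * r)%R]) (sqmod (f (a +i* y)))%:E <= J%:E)%E ->
  (\int[mu]_(y in `[(cIm w - 2 * r)%R, (cIm w + 2 * r)%R]) (sqmod (f (b +i* y)))%:E <= J%:E)%E ->
  (\int[mu]_(x in `[(cRe w - 2 * r)%R, (cRe w + 2 * r)%R]) (sqmod (f (x +i* c)))%:E <= J%:E)%E ->
  (\int[mu]_(x in `[(cRe w - 2 * r)%R, (cRe w + 2 * r)%R]) (sqmod (f (x +i* d)))%:E <= J%:E)%E ->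
  pi * r * sqmod (f w) <= 4 * J.
Proof.
move=> ef r0 a1 b1 c1 d1.
have la : cRe w - 2 * r <= a by lra.
have lb : b <= cRe w + 2 * r by lra.
have lc : cIm w - 2 * r <= c by lra.
have ld : d <= cIm w + 2 * r by lra.
have hf z : holo f z by exact: entire_cdiff.
have hF z : holo (fun z => f z * f z) z by exact: holoM.
have cf z : ccont f z by exact: holo_ccont.
have ab : a <= b by lra.
have cd : c <= d by lra.
have C := @cauchy_formula _ (fun z => f z * f z) a b c d w ltac:(lra) ltac:(lra) (fun z _ => hF z).
have far z : rbnd a b c d z -> r <= normc (z - w).
  by move=> zr; apply: (rbnd_far zr); lra.
have cg : rcont (fun z => f z * f z * (z - w)^-1) a b c d.
  move=> z /far zw; apply/holo_ccont/holoM => //; apply: holo_shiftV.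
  by rewrite -subr_eq0 -normc_gt0; exact: lt_le_trans zw.
have gk z : rbnd a b c d z -> normc (f z * f z * (z - w)^-1) <= r^-1 * sqmod (f z).
  move=> /far zw; rewrite !Normc.normcM Normc.normcV -expr2 mulrC ler_wpM2r ?sqr_ge0//.
  by rewrite lef_pV2 ?posrE//; exact: lt_le_trans zw.
move=> a2 b2 c2 d2.
have [g1 g2 g3 g4] := rcont_pcont ab cd cg.
have n1 : normc (cint a b (fun x => f (x +i* c) * f (x +i* c) * (x +i* c - w)^-1)) <= 2 * (r^-1 * J).
  apply: side_bound c2; first exact: r0.
  - by [].
  - by [].
  - exact: g1.
  - by apply: ccont_hpath => x _; exact: cf.
  - by move=> x xab; apply: gk; split => //=; rewrite ?lexx ?cd//; constructor 3.
have n2 : normc (cint a b (fun x => f (x +i* d) * f (x +i* d) * (x +i* d - w)^-1)) <= 2 * (r^-1 * J).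
  apply: side_bound d2; first exact: r0.
  - by [].
  - by [].
  - exact: g2.
  - by apply: ccont_hpath => x _; exact: cf.
  - by move=> x xab; apply: gk; split => //=; rewrite ?lexx ?cd//; constructor 4.
have n3 : normc (cint c d (fun x => f (a +i* x) * f (a +i* x) * (a +i* x - w)^-1)) <= 2 * (r^-1 * J).
  apply: side_bound a2; first exact: r0.
  - by [].
  - by [].
  - exact: g3.
  - by apply: ccont_vpath => x _; exact: cf.
  - by move=> x xab; apply: gk; split => //=; rewrite ?lexx ?ab//; constructor 1.
have n4 : normc (cint c d (fun x => f (b +i* x) * f (b +i* x) * (b +i* x - w)^-1)) <= 2 * (r^-1 * J).
  apply: side_bound b2; first exact: r0.
  - by [].
  - by [].
  - exact: g4.
  - by apply: ccont_vpath => x _; exact: cf.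
  - by move=> x xab; apply: gk; split => //=; rewrite ?lexx ?ab//; constructor 2.
have N : normc (rint (fun z => f z * f z * (z - w)^-1) a b c d) <= 8 * (r^-1 * J).
  rewrite rintE//; apply: le_trans (le_normcD _ _) _; rewrite [X in _ + X]Normc.normcM normci mul1r.
  apply: le_trans (lerD (le_normcD _ _) (le_normcD _ _)) _; rewrite !normcN.
  apply: le_trans (lerD (lerD n1 n2) (lerD n4 n3)) _; lra.
rewrite C !Normc.normcM normci mulr1 normcR (ger0_norm (mulr_ge0 _ (pi_ge0 R))) // in N.
clear a2 b2 c2 d2 n1 n2 n3 n4 g1 g2 g3 g4.
rewrite /sqmod expr2.
have -> : pi * r * (normc (f w) * normc (f w)) = r / 2 * (2 * pi * (normc (f w) * normc (f w))) by field.
have -> : 4 * J = r / 2 * (8 * (r^-1 * J)) by field; rewrite gt_eqF.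
apply: ler_wpM2l => //; lra.
Qed.

(** Each side of the contour can be moved over an interval of length r, and is
    placed where its integral is at most the average.  This replaces polar
    coordinates in the usual proof of the mean value inequality. *)
Lemma square_mean_value f w (r : R) : entire f -> 0 < r ->
  ((pi * r ^+ 2 / 4 * sqmod (f w))%:E <=
   \int[mu \x mu]_(p in square w (2 * r)%R) (sqmod (f (p.1 +i* p.2)))%:E)%E.
Proof.
move=> ef r0; have pi0 := pi_gt0 R.
have s1 : `[cRe w - 2 * r, cRe w - 2 * r + r] `<=` `[cRe w - 2 * r, cRe w + 2 * r].
  by apply: subset_itvScc; rewrite bnd_simp; lra.
have s2 : `[cRe w + r, cRe w + r + r] `<=` `[cRe w - 2 * r, cRe w + 2 * r].
  by apply: subset_itvScc; rewrite bnd_simp; lra.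
have s3 : `[cIm w - 2 * r, cIm w - 2 * r + r] `<=` `[cIm w - 2 * r, cIm w + 2 * r].
  by apply: subset_itvScc; rewrite bnd_simp; lra.
have s4 : `[cIm w + r, cIm w + r + r] `<=` `[cIm w - 2 * r, cIm w + 2 * r].
  by apply: subset_itvScc; rewrite bnd_simp; lra.
set I := (\int[_]_(_ in _) _)%E.
have I0 : (0 <= I)%E by apply: integral_ge0 => p _; rewrite lee_fin sqr_ge0.
case E: I I0 => [J| |] // J0; last by rewrite leey.
rewrite lee_fin; rewrite lee_fin in J0.
suff key (J' : R) : J < r * J' -> pi * r * sqmod (f w) <= 4 * J'.
  apply/ler_addgt0Pl => e e0.
  have h : J < r * ((J + e) / r) by rewrite mulrCA divff ?gt_eqF// mulr1; lra.
  have -> : pi * r ^+ 2 / 4 * sqmod (f w) = r / 4 * (pi * r * sqmod (f w)) by ring.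
  apply: le_trans (_ : r / 4 * (4 * ((J + e) / r)) <= _).
    by apply: ler_wpM2l; [lra|exact: key].
  have -> : r / 4 * (4 * ((J + e) / r)) = J + e by field; rewrite gt_eqF.
  by rewrite addrC.
move=> JJ'.
have mF := measurable_sqmod ef.
have F0 (p : R * R) : 0 <= sqmod (f (p.1 +i* p.2)) by exact: sqr_ge0.
have IJ : (I <= J%:E)%E by rewrite E.
clear E.
pose A : set R := `[cRe w - 2 * r, cRe w + 2 * r]%classic.
pose B : set R := `[cIm w - 2 * r, cIm w + 2 * r]%classic.
have mA : measurable A by exact: measurable_itv.
have mB : measurable B by exact: measurable_itv.
have [a a1 a2] := vslice_avg r0 JJ' mA mB mF F0 s1 IJ.
have [b b1 b2] := vslice_avg r0 JJ' mA mB mF F0 s2 IJ.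
have [c c1 c2] := hslice_avg r0 JJ' mA mB mF F0 s3 IJ.
have [d d1 d2] := hslice_avg r0 JJ' mA mB mF F0 s4 IJ.
exact: (@square_mean_core f w r J' a b c d).
Qed.

Definition local_cst (r : R) : R := pi * r ^+ 2 / 4 * expR (- (8 * r ^+ 2)).

Lemma local_cst_gt0 (r : R) : 0 < r -> 0 < local_cst r.
Proof. by move=> r0; rewrite mulr_gt0 ?expR_gt0// divr_gt0// mulr_gt0 ?pi_gt0// exprn_gt0. Qed.

(** Multiplying f by e^(- conj(w) z) centres the Gaussian weight at w: it amounts
    to translating w to the origin in Fock space. *)
Lemma fock_local_bound f w (r : R) : entire f -> 0 < r ->
  ((local_cst r * fock_density f w)%:E <=
   \int[mu \x mu]_(p in square w (2 * r)%R) (fock_density f (p.1 +i* p.2))%:E)%E.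
Proof.
move=> ef r0.
pose k z := f z * cexp (- w^* * z + 0).
have ek : entire k.
  apply: cdiff_entire => z; have [l Hl] := entire_cdiff ef z.
  by have := cdiffM Hl (cdiff_cexp_affine (- w^*) 0 z); set L := (X in cdiff _ _ X); exists L.
have kE z : sqmod (k z) = fock_density f z * expR (sqmod (z - w) - sqmod w).
  rewrite /sqmod /k Normc.normcM normc_cexp /fock_density exprMn -mulrA -expRD -!/(sqmod _); congr (_ * _).
  rewrite expr2 -expRD; congr expR; rewrite addr0 !sqmodE !(cReM,cImM,cReD,cReN,cImD,cImN).
  by case: z w {k ek} => [a b] [c d] /=; ring.
have m : measurable (square w (2 * r)).
  by apply: measurableX; exact: measurable_itv.
have := square_mean_value w ek r0.
set I := (\int[_]_(_ in _) _)%E.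
set I' := (\int[_]_(_ in _) _)%E => H.
have L : (I <= (expR (8 * r ^+ 2 - sqmod w))%:E * I')%E.
  rewrite /I' -ge0_integralZl_EFin ?expR_ge0//; first last.
  - by apply: measurable_funTS; apply/measurable_EFinP; exact: measurable_fock_density.
  - by move=> p _; rewrite lee_fin fock_density_ge0.
  apply: ge0_le_integral => //.
  - by move=> p _; rewrite lee_fin sqr_ge0.
  - by apply: measurable_funTS; apply/measurable_EFinP; exact: measurable_sqmod.
  - apply: measurable_funTS; apply/measurable_EFinP; apply: measurable_funM; first exact: measurable_cst.
    exact: measurable_fock_density.
  - move=> [x y] [] /=; rewrite !in_itv /= => /andP[x1 x2] /andP[y1 y2].
    rewrite -EFinM lee_fin kE mulrC ler_wpM2r ?fock_density_ge0// ler_expR lerD2r.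
    rewrite sqmodE !(cReD,cReN,cImD,cImN) /=; nra.
have {}H := le_trans H L.
have E0 : 0 < expR (- (8 * r ^+ 2 - sqmod w)) by exact: expR_gt0.
have := lee_wpmul2l (ltW E0 : (0 <= (expR (- (8 * r ^+ 2 - sqmod w)))%:E)%E) H.
rewrite muleA -!EFinM -expRD addNr expR0 mul1e; apply: le_trans; rewrite lee_fin.
rewrite kE subrr /local_cst le_eqVlt; apply/orP; left; apply/eqP.
rewrite [sqmod 0]/sqmod Normc.normc0 expr0n /= sub0r opprB.
have -> : expR (sqmod w - 8 * r ^+ 2) * (pi * r ^+ 2 / 4 * (fock_density f w * expR (- sqmod w)))
  = pi * r ^+ 2 / 4 * (expR (sqmod w - 8 * r ^+ 2) * expR (- sqmod w)) * fock_density f w by ring.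
by rewrite -expRD; congr (_ * expR _ * _); ring.
Qed.

End MeanValue.

(** * Point evaluations and exponential sums in Fock space *)

Section FockBounds.
Context {R : realType}.
Notation mu := (@lebesgue_measure R).
Implicit Types (f g : R[i] -> R[i]) (w z : R[i]).

Lemma fock_sqnormE f : fock_sqnorm f =
  ((pi^-1)%:E * \int[mu \x mu]_(p in [set: R * R]) (fock_density f (p.1 +i* p.2))%:E)%E.
Proof. by []. Qed.

(** The squares of half-side 2 r around the points are disjoint. *)
Lemma separated_lower_bound f (n : nat) (w : 'I_n -> R[i]) (r : R) : entire f -> 0 < r ->
  (forall i j, i != j -> 8 * r < normc (w i - w j)) ->
  ((pi^-1 * local_cst r * \sum_(i < n) fock_density f (w i))%:E <= fock_sqnorm f)%E.
Proof.
move=> ef r0 sep; rewrite fock_sqnormE -mulrA EFinM.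
apply: lee_wpmul2l; first by rewrite lee_fin invr_ge0 pi_ge0.
have mS i : measurable (square (w i) (2 * r)).
  by apply: measurableX; exact: measurable_itv.
have mF : measurable_fun [set: R * R] (fun p => (fock_density f (p.1 +i* p.2))%:E).
  by apply/measurable_EFinP; exact: measurable_fock_density.
have F0 p : (0 <= (fock_density f (p.1 +i* p.2))%:E)%E by rewrite lee_fin fock_density_ge0.
pose D := \big[setU/set0]_(i <- enum 'I_n) square (w i) (2 * r).
have mD : measurable D by apply: bigsetU_measurable.
apply: (@le_trans _ _ (\int[mu \x mu]_(p in D) (fock_density f (p.1 +i* p.2))%:E)%E); last first.
  by apply: ge0_subset_integral.
rewrite ge0_integral_bigsetU//; first last.
- exact: measurable_funTS.
- move=> i j _ _ [[x y] [[/= +  +] [/= + +]]]; rewrite !in_itv /=.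
  move=> /andP[? ?] /andP[? ?] /andP[? ?] /andP[? ?].
  apply/eqP; case: (eqVneq i j) => // /sep.
  have := normc_leD (w i - w j); rewrite !(cReD, cImD, cReN, cImN) => h1 h2.
  have : `|cRe (w i) - cRe (w j)| <= 4 * r by rewrite ler_norml; apply/andP; split; lra.
  have : `|cIm (w i) - cIm (w j)| <= 4 * r by rewrite ler_norml; apply/andP; split; lra.
  lra.
- exact: enum_uniq.
rewrite mulr_sumr -sumEFin big_enum /=; apply: lee_sum => i _.
exact: fock_local_bound.
Qed.

Lemma fock_density_bound f : fock f -> exists C : R, forall z, fock_density f z <= C.
Proof.
case=> ef; have N0 : (0 <= fock_sqnorm f)%E.
  rewrite fock_sqnormE; apply: mule_ge0; first by rewrite lee_fin invr_ge0 pi_ge0.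
  by apply: integral_ge0 => p _; rewrite lee_fin fock_density_ge0.
case: (fock_sqnorm f) (@separated_lower_bound f 1) N0 => // N H _ _.
have K0 : 0 < pi^-1 * local_cst 1 :> R.
  by apply: mulr_gt0; [rewrite invr_gt0 pi_gt0|exact: local_cst_gt0].
exists (N / (pi^-1 * local_cst 1)) => z.
rewrite ler_pdivlMr// [leLHS]mulrC.
have := H (fun=> z) 1 ef ltr01; rewrite big_ord1 lee_fin; apply.
by move=> i j; rewrite !ord1 eqxx.
Qed.

Lemma esum_nat_le (D : set nat) (a : nat -> R) (C : R) : (forall j, 0 <= a j) ->
  (forall N, \sum_(j < N) a j <= C) -> (\esum_(j in D) (a j)%:E <= C%:E)%E.
Proof.
move=> a0 H.
apply: (@le_trans _ _ (\esum_(j in [set: nat]) (a j)%:E)%E).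
  rewrite esum_mkcond; apply: le_esum => j _; case: ifP => _ //; by rewrite lee_fin.
rewrite -nneseries_esumT; last by move=> j; rewrite lee_fin.
apply: lime_le; first by apply: is_cvg_nneseries => n _ _; rewrite lee_fin.
by apply: nearW => n; rewrite /= sumEFin lee_fin big_mkord.
Qed.

Lemma exp_partial_sum (x : R) n : 0 <= x -> \sum_(k < n) x ^+ k / k`!%:R <= expR x.
Proof.
move=> x0; apply/ler_addgt0Pl => e e0.
have [N HN] := cexp_taylor x%:C e0.
have := HN (N + n)%N (leq_addr _ _); rewrite cexp_real.
have -> : \sum_(k < N + n) x%:C ^+ k / k`!%:R = (\sum_(k < N + n) x ^+ k / k`!%:R)%:C.
  rewrite raddf_sum; apply: eq_bigr => k _ /=.
  by rewrite [RHS]rmorphM /= rmorphXn /= fmorphV /= rmorph_nat.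
rewrite -rmorphB /= expr0n addr0 sqrtr_sqr => h.
have : \sum_(k < n) x ^+ k / k`!%:R <= \sum_(k < N + n) x ^+ k / k`!%:R.
  rewrite addnC big_split_ord /= lerDl sumr_ge0// => i _.
  by rewrite divr_ge0// exprn_ge0.
move: h; rewrite ler_norml; lra.
Qed.

Lemma exp_sum_entire (I : Type) (s : seq I) (c a : I -> R[i]) :
  entire (fun z => \sum_(i <- s) c i * cexp (a i * z)).
Proof.
apply: cdiff_entire => z; exists (\sum_(i <- s) c i * (a i * cexp (a i * z))).
apply: cdiff_sum => i; apply: cdiffZ.
have := cdiff_cexp_affine (a i) 0 z; rewrite addr0.
by apply: cdiff_eq => x; rewrite addr0.
Qed.

(** An exponential grows like e^(A |z|), and 2 A |z| <= |z|^2 / 2 + 2 A^2, so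
    the density is dominated by a product of two one-dimensional Gaussians. *)
Lemma exp_sum_fock (I : Type) (s : seq I) (c a : I -> R[i]) :
  fock (fun z => \sum_(i <- s) c i * cexp (a i * z)).
Proof.
have ef := @exp_sum_entire I s c a.
split => //; set f := fun z => _ in ef *.
pose A := \sum_(i <- s) normc (a i).
pose C := \sum_(i <- s) normc (c i).
have A0 : 0 <= A by apply: sumr_ge0 => i _; exact: normc_ge0.
have C0 : 0 <= C by apply: sumr_ge0 => i _; exact: normc_ge0.
have fle z : normc (f z) <= C * expR (A * normc z).
  rewrite /f /A /C; elim: s {f ef A C A0 C0} => [|i s IH].
    by rewrite !big_nil Normc.normc0 mul0r.
  rewrite !big_cons; apply: le_trans (le_normcD _ _) _; rewrite mulrDl.
  set A := \sum_(j <- s) normc (a j).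
  have A0 : 0 <= A by apply: sumr_ge0 => j _; exact: normc_ge0.
  have na := normc_ge0 (a i); have nz := normc_ge0 z.
  apply: lerD.
    rewrite Normc.normcM ler_wpM2l ?normc_ge0// normc_cexp ler_expR.
    apply: le_trans (ler_norm _) _; apply: le_trans (normc_Re _) _; rewrite Normc.normcM.
    by apply: ler_wpM2r => //; lra.
  apply: le_trans IH _; apply: ler_wpM2l; first by apply: sumr_ge0 => j _; exact: normc_ge0.
  by rewrite ler_expR ler_wpM2r// lerDr.
pose K := C ^+ 2 * expR (2 * A ^+ 2).
have K0 : 0 <= K by rewrite mulr_ge0 ?sqr_ge0 ?expR_ge0.
pose g (x : R) := expR (- (x ^+ 2 / 2)).
have dle (p : R * R) : fock_density f (p.1 +i* p.2) <= K * g p.1 * g p.2.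
  have -> : K * g p.1 * g p.2 = C ^+ 2 * expR (2 * A ^+ 2 - p.1 ^+ 2 / 2 - p.2 ^+ 2 / 2).
    by rewrite /K /g !expRD; ring.
  rewrite /fock_density.
  have h : sqmod (f (p.1 +i* p.2)) <= C ^+ 2 * expR (2 * A * normc (p.1 +i* p.2)).
    apply: (@le_trans _ _ ((C * expR (A * normc (p.1 +i* p.2))) ^+ 2)).
      by rewrite lerXn2r ?nnegrE ?normc_ge0 ?mulr_ge0 ?expR_ge0.
    rewrite exprMn ler_wpM2l ?sqr_ge0// expr2 -expRD ler_expR le_eqVlt.
    by apply/orP; left; apply/eqP; ring.
  apply: le_trans (ler_wpM2r (expR_ge0 _) h) _; rewrite -[leLHS]mulrA ler_wpM2l ?sqr_ge0//.
  rewrite -expRD ler_expR.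
  have E : sqmod (p.1 +i* p.2) = p.1 ^+ 2 + p.2 ^+ 2 by rewrite sqmodE.
  have : 0 <= (2 * A - normc (p.1 +i* p.2)) ^+ 2 by exact: sqr_ge0.
  have E2 : normc (p.1 +i* p.2) ^+ 2 = p.1 ^+ 2 + p.2 ^+ 2 by rewrite -E.
  rewrite sqrrB E2 E; lra.
have mg : measurable_fun [set: R] g.
  apply: measurableT_comp; first exact: measurable_expR.
  apply: measurable_funN; apply: measurable_funM; last exact: measurable_cst.
  exact: exprn_measurable.
have g0 x : 0 <= g x by exact: expR_ge0.
have ig : (\int[mu]_x (g x)%:E < +oo)%E.
  have s1 : (1 : R) != 0 by exact: oner_neq0.
  have E x : (normal_pdf 0 1 x)%:E = ((normal_peak 1)%:E * (g x)%:E)%E :> \bar R.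
    rewrite /normal_pdf (negbTE s1) /normal_fun subr0 expr1n -EFinM; congr (_ * expR _)%:E.
    by rewrite mulNr.
  have := integral_normal_pdf (0 : R) 1.
  under eq_integral do rewrite E.
  rewrite ge0_integralZl_EFin//; last 3 first.
  - by move=> x _; rewrite lee_fin.
  - by apply/measurable_EFinP.
  - exact: normal_peak_ge0.
  have p0 : (0 < normal_peak 1 :> R) by exact: normal_peak_gt0.
  case: (\int[mu]_x (g x)%:E)%E => //=; first by move=> r _; exact: ltry.
  by rewrite gt0_muley// lte_fin.
have mh : measurable_fun [set: R * R] (fun p => (K * g p.1 * g p.2)%:E).
  apply/measurable_EFinP; apply: measurable_funM.
    apply: measurable_funM; first exact: measurable_cst.
    by apply: measurableT_comp => //; exact: measurable_fst.
  by apply: measurableT_comp => //; exact: measurable_snd.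
have h0 (p : R * R) : (0 <= (K * g p.1 * g p.2)%:E)%E by rewrite lee_fin !mulr_ge0.
rewrite fock_sqnormE; apply: lte_mul_pinfty => //.
  by rewrite lee_fin invr_ge0 pi_ge0.
apply: (@le_lt_trans _ _ (\int[mu \x mu]_(p in [set: R * R]) (K * g p.1 * g p.2)%:E)%E).
  apply: ge0_le_integral => //.
  - by move=> p _; rewrite lee_fin fock_density_ge0.
  - by apply/measurable_EFinP; exact: measurable_fock_density.
  - by move=> p _; rewrite lee_fin.
rewrite fubini_tonelli1// /fubini_F /=.
have [G EG] : exists G, (\int[mu]_x (g x)%:E = G%:E)%E.
  exists (fine (\int[mu]_x (g x)%:E)%E); rewrite fineK// ge0_fin_numE//.
  by apply: integral_ge0 => x _; rewrite lee_fin.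
have E x : (\int[mu]_y (K * g x * g y)%:E = (K * G)%:E * (g x)%:E)%E.
  under eq_integral do rewrite EFinM.
  rewrite ge0_integralZl_EFin ?EG ?mulr_ge0//.
  - by rewrite -!EFinM; congr EFin; ring.
  - by move=> y _; rewrite lee_fin.
  - by apply/measurable_EFinP.
under eq_integral do rewrite E.
have G0 : 0 <= G by rewrite -lee_fin -EG; apply: integral_ge0 => x _; rewrite lee_fin.
rewrite ge0_integralZl_EFin ?mulr_ge0//.
- by rewrite EG -EFinM ltry.
- by move=> y _; rewrite lee_fin.
- by apply/measurable_EFinP.
Qed.

End FockBounds.

(** * Failure of deep sampling *)

Section Sampling.
Context {R : realType} (beta : R[i]).
Implicit Types (t x : R) (z : R[i]).

Let B : R := sqmod beta.

Definition kcoef t : R := expR (- (t ^+ 2 * sqmod beta / 2)).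

(** The image of the constant 1 under the Fock translate by t * beta. *)
Definition kern t z : R[i] := (kcoef t)%:C * cexp (t%:C * beta^* * z).

Lemma mulJ_sqmod z : z^* * z = (sqmod z)%:C.
Proof. by apply: eq_complexP; rewrite sqmodE ?cReM ?cImM; case: z => a b /=; ring. Qed.

Lemma kcoefN t : kcoef (- t) = kcoef t.
Proof. by rewrite /kcoef sqrrN. Qed.

Lemma kcoef_ge0 t : 0 <= kcoef t. Proof. exact: expR_ge0. Qed.

(** Translates along a real line through the origin compose without a phase. *)
Lemma translate_kern t z : fock_translate beta (kern t) z = kern (t + 1) z.
Proof.
rewrite /fock_translate /kern mulrCA -cexpD.
have -> : - (2^-1 * `|beta| ^+ 2) + beta^* * z + t%:C * beta^* * (z - beta) =
   (- (B / 2) - t * B)%:C + (t + 1)%:C * beta^* * z.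
  have -> : `|beta| ^+ 2 = B%:C by rewrite normcE -rmorphXn.
  have -> : t%:C * beta^* * (z - beta) = t%:C * beta^* * z - t%:C * (beta^* * beta) by ring.
  have -> : (2^-1 : R[i]) = (2^-1 : R)%:C by rewrite fmorphV rmorph_nat.
  rewrite mulJ_sqmod -/B -mulrA -[(t + 1)%:C * _ * _]mulrA; move: (beta^* * z) => w.
  by apply: eq_complexP; rewrite !(cReD, cImD, cReN, cImN, cReM, cImM) /=; ring.
rewrite cexpD cexp_real mulrA -rmorphM /kcoef -expRD; congr ((expR _)%:C * _).
by rewrite -/B; field.
Qed.

Lemma translate_sum (I : Type) (s : seq I) (c : I -> R[i]) (t : I -> R) z :
  fock_translate beta (fun z => \sum_(i <- s) c i * kern (t i) z) z =
  \sum_(i <- s) c i * kern (t i + 1) z.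
Proof.
rewrite /fock_translate mulr_sumr; apply: eq_bigr => i _.
by rewrite -translate_kern /fock_translate mulrCA.
Qed.

Lemma cderivn_kern_sum (I : Type) (s : seq I) (c : I -> R[i]) (t : I -> R) j :
  cderivn j (fun z => \sum_(i <- s) c i * kern (t i) z) 0 =
  \sum_(i <- s) c i * ((kcoef (t i))%:C * ((t i)%:C * beta^*) ^+ j).
Proof.
have -> : (fun z => \sum_(i <- s) c i * kern (t i) z) =
  (fun z => \sum_(i <- s) (c i * (kcoef (t i))%:C) * cexp ((t i)%:C * beta^* * z)).
  by apply/funext => z; apply: eq_bigr => i _; rewrite /kern mulrA.
rewrite cderivn_sum_cexp; apply: eq_bigr => i _.
by rewrite mulr0 cexp0 mulr1 mulrA.
Qed.

(** The nodes -m, -m + 2, ..., m, symmetric about the origin. *)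
Definition node (m i : nat) : R := 2 * i%:R - m%:R.

Lemma node_rev m (i : 'I_m.+1) : node m (rev_ord i) = - node m i.
Proof.
rewrite /node /= subSS natrB; last by rewrite -ltnS.
ring.
Qed.

(** The reflection i |-> m - i changes the sign of the sum. *)
Lemma alternating_cancel m j (w : R[i]) : odd (m + j) ->
  \sum_(i < m.+1) (-1) ^+ i * ((kcoef (node m i))%:C * ((node m i)%:C * w) ^+ j) = 0.
Proof.
move=> mj; set S := \sum_(i < _) _.
have SN : S = - S.
  rewrite {1}/S (reindex_inj rev_ord_inj) /= -sumrN; apply: eq_bigr => i _.
  rewrite -[(m.+1 - i.+1)%N]/(rev_ord i : nat) node_rev /=.
  rewrite subSS kcoefN rmorphN mulNr [(- (_ * w)) ^+ j]exprNn.
  rewrite -signr_odd oddB; last by rewrite -ltnS.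
  rewrite -[(-1) ^+ i]signr_odd -[(-1) ^+ j]signr_odd.
  move: mj; rewrite oddD.
  by case: (odd m); case: (odd i); case: (odd j) => //= _; ring.
apply/eqP; have : S *+ 2 == 0 by rewrite mulr2n {2}SN subrr.
by rewrite mulrn_eq0.
Qed.

(** It has the parity of n, and is nearly an eigenvector of the translation by
    2 * beta for the eigenvalue -1. *)
Definition test_fun (n : nat) z : R[i] :=
  \sum_(i < n.+1) (-1) ^+ i * kern (node n i) z.

Lemma test_fun_fock n : fock (test_fun n).
Proof.
have -> : test_fun n = (fun z => \sum_(i < n.+1) ((-1) ^+ i * (kcoef (node n i))%:C) * cexp ((node n i)%:C * beta^* * z)).
  by apply/funext => z; apply: eq_bigr => i _; rewrite /kern mulrA.
exact: exp_sum_fock.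
Qed.

Lemma test_fun_deriv n j : odd (n + j) -> cderivn j (test_fun n) 0 = 0.
Proof. by move=> nj; rewrite /test_fun cderivn_kern_sum alternating_cancel. Qed.

(** After translation the nodes are -n + 1, ..., n + 1.  All but the last are
    again symmetric about the origin and cancel, so that only one translate of
    the constant 1 is left, whatever n is. *)
Lemma test_fun_translate_deriv n j : ~~ odd (n + j) ->
  cderivn j (fock_translate beta (test_fun n)) 0 =
  (-1) ^+ n * ((kcoef n.+1%:R)%:C * (n.+1%:R%:C * beta^*) ^+ j).
Proof.
move=> nj.
have -> : fock_translate beta (test_fun n) = (fun z => \sum_(i < n.+1) (-1) ^+ i * kern (node n i + 1) z).
  by apply/funext => z; rewrite translate_sum.
rewrite cderivn_kern_sum big_ord_recr /=.
have -> : node n n + 1 = n.+1%:R by rewrite /node -natr1; ring.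
case: n nj => [|m] nj; first by rewrite big_ord0 add0r.
rewrite (eq_bigr (fun i : 'I_m.+1 => (-1) ^+ i * ((kcoef (node m i))%:C * ((node m i)%:C * beta^*) ^+ j))).
  by rewrite alternating_cancel ?add0r// -[odd _]negbK -oddS.
move=> i _; have -> : node m.+1 i + 1 = node m i by rewrite /node -natr1; ring.
by [].
Qed.

Lemma cexp_ipi : cexp (0 +i* pi) = -1 :> R[i].
Proof. by apply: eq_complexP; rewrite /= expR0 ?cospi ?sinpi ?mul1r ?oppr0. Qed.

Lemma normc_cexp_im x : normc (cexp (0 +i* x)) = 1.
Proof. by rewrite normc_cexp expR0. Qed.

(** As sigma |beta|^2 = pi / 2, consecutive nodes t and t + 2 give opposite phases
    to the translates of the constant 1 at height sigma. *)
Let sigma : R := pi / (2 * B).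

(** The alternating phases compensate the alternating signs, so the value is, up
    to a phase, a sum of positive terms, and the term i = m is large enough. *)
Lemma test_fun_peak (n : nat) (m : 'I_n.+1) : beta != 0 ->
  expR (- (sigma ^+ 2 * B)) <= fock_density (test_fun n) ((node n m +i* sigma) * beta).
Proof.
move=> b0; have B0 : 0 < B by rewrite exprn_gt0// normc_gt0.
set z := _ * beta.
have bz : beta^* * z = (B * node n m) +i* (pi / 2).
  rewrite /z mulrCA mulJ_sqmod -/B; apply: eq_complexP; rewrite ?cReM ?cImM /= !(mulr0, subr0, add0r).
    exact: mulrC.
  by rewrite /sigma; field; rewrite gt_eqF.
pose u : R[i] := cexp (0 +i* (- (n%:R * (pi / 2)))).
pose S := \sum_(i < n.+1) kcoef (node n i) * expR (node n i * (B * node n m)).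
have fE : test_fun n z = u * S%:C.
  rewrite /test_fun /S rmorph_sum mulr_sumr; apply: eq_bigr => i _.
  rewrite /kern -mulrA bz.
  have -> : (node n i)%:C * ((B * node n m) +i* (pi / 2)) =
    (node n i * (B * node n m))%:C + (i%:R * (0 +i* pi) + (0 +i* (- (n%:R * (pi / 2))))) :> R[i].
    rewrite -(rmorph_nat (real_complex R)).
    by apply: eq_complexP; rewrite ?cReD ?cImD ?cReM ?cImM /= /node; field.
  rewrite !cexpD cexp_real cexp_nat cexp_ipi rmorphM -/u /=.
  have -> : (-1) ^+ i * ((kcoef (node n i))%:C * ((expR (node n i * (B * node n m)))%:C * ((-1) ^+ i * u))) =
    ((-1) ^+ i * (-1) ^+ i) * (u * ((kcoef (node n i))%:C * (expR (node n i * (B * node n m)))%:C)) :> R[i] by ring.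
  by rewrite -expr2 sqrr_sign mul1r.
have SB : expR (node n m ^+ 2 * B / 2) <= S.
  rewrite /S (bigD1 m) //= /kcoef -expRD.
  have -> : - (node n m ^+ 2 * sqmod beta / 2) + node n m * (B * node n m) = node n m ^+ 2 * B / 2.
    by rewrite -/B; field.
  by rewrite lerDl sumr_ge0// => i _; rewrite mulr_ge0 ?kcoef_ge0 ?expR_ge0.
have S0 : 0 <= S by apply: le_trans SB; exact: expR_ge0.
have sz : sqmod z = (node n m ^+ 2 + sigma ^+ 2) * B.
  by rewrite /z /sqmod Normc.normcM exprMn -!/(sqmod _) -/B [sqmod (_ +i* _)]sqmodE.
rewrite /fock_density sz fE {1}/sqmod Normc.normcM normc_cexp_im mul1r normcR ger0_norm//.
apply: (@le_trans _ _ (expR (node n m ^+ 2 * B / 2) ^+ 2 * expR (- ((node n m ^+ 2 + sigma ^+ 2) * B)))).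
  rewrite [X in _ <= X * _]expr2 -!expRD ler_expR le_eqVlt.
  by apply/orP; left; apply/eqP; field.
by apply: ler_wpM2r; rewrite ?expR_ge0// lerXn2r ?nnegrE ?expR_ge0.
Qed.

(** The n + 1 peaks lie on a line at mutual distances at least 2 |beta|. *)
Lemma test_fun_norm_large (C : R) : beta != 0 -> exists N, forall n, (N <= n)%N ->
  (C%:E < fock_sqnorm (test_fun n))%E.
Proof.
move=> b0; have nb : 0 < normc beta by rewrite normc_gt0.
(* neighbouring peaks are at distance 2 |beta| > 8 r *)
pose r := normc beta / 8; have r0 : 0 < r by rewrite divr_gt0.
pose K := pi^-1 * local_cst r * expR (- (sigma ^+ 2 * B)).
have K0 : 0 < K.
  apply: mulr_gt0; last exact: expR_gt0.
  by apply: mulr_gt0; [rewrite invr_gt0 pi_gt0|exact: local_cst_gt0].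
exists (Num.bound (`|C| / K)) => n nN.
have [ef _] := test_fun_fock n.
have sep (i j : 'I_n.+1) : i != j -> 8 * r < normc ((node n i +i* sigma) * beta - (node n j +i* sigma) * beta).
  move=> ij; rewrite -mulrBl Normc.normcM.
  have -> : (node n i +i* sigma) - (node n j +i* sigma) = (2 * (i%:R - j%:R))%:C :> R[i].
    by apply: eq_complexP; rewrite ?cReD ?cImD ?cReN ?cImN /= /node; ring.
  rewrite normcR normrM ger0_norm//.
  have : 1 <= `|i%:R - j%:R : R|.
    wlog ltij : i j ij / (i < j)%N.
      move=> W; case: (ltngtP i j) => h; [exact: W|rewrite distrC; apply: W => //; by rewrite eq_sym|].
      by move: ij; rewrite -val_eqE /= h eqxx.
    by rewrite distrC -natrB ?(ltnW ltij)// normr_nat ler1n subn_gt0.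
  rewrite /r; nra.
apply: lt_le_trans (separated_lower_bound ef r0 sep).
rewrite lte_fin; apply: (@lt_le_trans _ _ (K * n.+1%:R)).
  apply: le_lt_trans (ler_norm C) _; rewrite mulrC -ltr_pdivrMr//.
  apply: lt_le_trans (archi_boundP _) _; first by rewrite divr_ge0// ltW.
  by rewrite ler_nat leqW.
rewrite /K -mulrA; apply: ler_wpM2l.
  by rewrite mulr_ge0 ?invr_ge0 ?pi_ge0// ltW// local_cst_gt0.
have -> : expR (- (sigma ^+ 2 * B)) * n.+1%:R = \sum_(i < n.+1) expR (- (sigma ^+ 2 * B)).
  by rewrite sumr_const card_ord mulr_natr.
by apply: ler_sum => i _; exact: test_fun_peak.
Qed.

(** For n of the parity opposite to E the first sum vanishes and the second is
    bounded by 1, while the norm of the test function is unbounded. *)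
Lemma parity_not_sampling (e : bool) (E : set nat) : beta != 0 ->
  (forall j, E j <-> odd j = e) -> ~ deep_sampling E beta.
Proof.
move=> b0 HE [eps [eps0 H]].
have [N HN] := test_fun_norm_large eps^-1 b0.
pose n := (N.*2 + ~~ e)%N.
have on : odd n = ~~ e by rewrite /n oddD odd_double; case: e {HE n}.
have Nn : (N <= n)%N by rewrite /n -addnn -addnA leq_addr.
clearbody n; have {HN} := HN n Nn.
have := H _ (test_fun_fock n).
have -> : weighted_sum E (fun j => cderivn j (test_fun n) 0) = 0%E.
  apply: esum1 => j /HE Ej; rewrite test_fun_deriv ?oddD ?on ?Ej ?addNb ?addbb //.
  by rewrite /sqmod Normc.normc0 expr0n mul0r.
rewrite add0e.
have W : (weighted_sum (~` E) (fun j => cderivn j (fock_translate beta (test_fun n)) 0%R) <= 1%:E)%E.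
  pose x := n.+1%:R ^+ 2 * B.
  have x0 : 0 <= x by rewrite mulr_ge0 ?sqr_ge0.
  apply: (@le_trans _ _ (\esum_(j in ~` E) (expR (- x) * (x ^+ j / j`!%:R))%:E)%E); last first.
    apply: esum_nat_le => [j|M].
      by rewrite mulr_ge0 ?expR_ge0// divr_ge0// exprn_ge0.
    have E1 : expR (- x) * expR x = 1 :> R by rewrite -expRD addNr expR0.
    rewrite -mulr_sumr -[leRHS]E1.
    by apply: ler_wpM2l; [exact: expR_ge0|exact: exp_partial_sum].
  apply: le_esum => j nEj.
  have oj : odd j = ~~ e.
    have nj : odd j <> e by move=> /HE.
    by move: nj; clear; case: (odd j); case: e.
  rewrite lee_fin test_fun_translate_deriv; last by rewrite oddD on oj addbb.
  rewrite le_eqVlt; apply/orP; left; apply/eqP.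
  rewrite mulrA; congr (_ / _).
  rewrite /sqmod Normc.normcM normcX normcN Normc.normc1 expr1n mul1r Normc.normcM normcR.
  rewrite normcX Normc.normcM normcR normcJ ger0_norm ?kcoef_ge0// ger0_norm// exprMn.
  congr (_ * _).
    by rewrite /kcoef expr2 -expRD; congr expR; rewrite /x -/B; field.
  by rewrite /x /B /sqmod -exprMn -!exprM mulnC.
move=> /le_trans/(_ W) h1 h2.
case: (fock_sqnorm (test_fun n)) h1 h2 => [s| |] //=.
  rewrite -EFinM !lee_fin lte_fin => h1 h2.
  have : eps * eps^-1 < eps * s by rewrite ltr_pM2l.
  by rewrite divff ?gt_eqF//; lra.
by rewrite gt0_muley ?lte_fin.
Qed.

End Sampling.

(** * Failure of deep interpolation *)

Section Geometric.
Context {R : realType}.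
Implicit Types (q : R).

Lemma geometric_sum_le q m n : 0 <= q < 1 ->
  \sum_(m <= i < n) q ^+ i <= q ^+ m / (1 - q).
Proof.
move=> /andP[q0 q1]; have d : 0 < 1 - q by lra.
rewrite ler_pdivlMr//.
have [mn|/ltnW nm] := leqP m n; last by rewrite big_geq// mul0r exprn_ge0.
suff -> : (\sum_(m <= i < n) q ^+ i) * (1 - q) = q ^+ m - q ^+ n.
  by rewrite gerBl exprn_ge0.
rewrite -(subnKC mn); elim: (n - m)%N => [|k IH]; first by rewrite addn0 big_geq// mul0r subrr.
by rewrite addnS big_nat_recr ?leq_addr//= mulrDl IH exprS; ring.
Qed.

Lemma geometric_row q (i M : nat) : 0 <= q < 1 ->
  \sum_(k < M) q ^+ ((i - k) + (k - i)) <= 2 / (1 - q).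
Proof.
move=> q01; have /andP[q0 q1] := q01.
have d : 0 < 1 - q by lra.
have H n : \sum_(k < n) q ^+ k <= 1 / (1 - q).
  by have := geometric_sum_le 0 n q01; rewrite big_mkord expr0.
apply: (@le_trans _ _ (\sum_(k < i + M) q ^+ ((i - k) + (k - i)))).
  by rewrite addnC big_split_ord /= lerDl sumr_ge0// => k _; exact: exprn_ge0.
rewrite big_split_ord /= -[2]/(1 + 1) mulrDl; apply: lerD.
  rewrite (reindex_inj rev_ord_inj) /=; apply: le_trans (H i); apply: ler_sum => k _.
  have -> : (i - (i - k.+1) + (i - k.+1 - i))%N = k.+1 by have := ltn_ord k; lia.
  by rewrite exprS ler_piMl ?exprn_ge0// ltW.
apply: le_trans (H M); apply: ler_sum => k _.
by have -> : (i - (i + k) + (i + k - i))%N = k by lia.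
Qed.

(** Schur's test, from c_i c_k <= (c_i^2 + c_k^2) / 2. *)
Lemma schur_geometric q (c : nat -> R) M : 0 <= q < 1 ->
  \sum_(i < M) \sum_(k < M) c i * c k * q ^+ ((i - k) + (k - i)) <=
  2 / (1 - q) * \sum_(i < M) c i ^+ 2.
Proof.
move=> q01; have /andP[q0 q1] := q01.
pose w (i k : nat) := q ^+ ((i - k) + (k - i)).
have w0 i k : 0 <= w i k by exact: exprn_ge0.
have wC i k : w i k = w k i by rewrite /w addnC.
apply: (@le_trans _ _ (\sum_(i < M) \sum_(k < M) (c i ^+ 2 * w i k / 2 + c k ^+ 2 * w k i / 2))).
  apply: ler_sum => i _; apply: ler_sum => k _; rewrite -/(w i k) (wC k i).
  have := mulr_ge0 (sqr_ge0 (c i - c k)) (w0 i k); rewrite sqrrB => h.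
  have -> : c i ^+ 2 * w i k / 2 + c k ^+ 2 * w i k / 2 = c i * c k * w i k +
    (c i ^+ 2 - c i * c k *+ 2 + c k ^+ 2) * w i k / 2 by field.
  by rewrite lerDl divr_ge0.
under eq_bigr do rewrite big_split /=.
rewrite big_split /= [X in _ + X]exchange_big /= -big_split /= mulr_sumr.
apply: ler_sum => i _; rewrite -big_split /=.
have -> : \sum_(k < M) (c i ^+ 2 * w i k / 2 + c i ^+ 2 * w i k / 2) = c i ^+ 2 * \sum_(k < M) w i k.
  by rewrite mulr_sumr; apply: eq_bigr => k _; field.
rewrite mulrC; apply: ler_wpM2r; first exact: sqr_ge0.
exact: geometric_row.
Qed.

Lemma sum_inv_sqr_le M : \sum_(i < M) (i.+1%:R^-1) ^+ 2 <= 2 :> R.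
Proof.
case: M => [|M]; first by rewrite big_ord0.
(* telescoping bound, from 1 / (x + 1)^2 <= 1 / x - 1 / (x + 1) *)
suff H : \sum_(i < M.+1) (i.+1%:R^-1) ^+ 2 <= 2 - M.+1%:R^-1 :> R.
  by apply: le_trans H _; rewrite gerBl invr_ge0.
elim: M => [|M IH]; first by rewrite big_ord_recr big_ord0 /= invr1 expr1n; lra.
rewrite big_ord_recr /=; apply: le_trans (lerD IH (lexx _)) _.
have a : (0 : R) < M.+1%:R by [].
rewrite -(natr1 M.+1); set x := M.+1%:R in a *.
have b : 0 < x + 1 by lra.
have -> : 2 - x^-1 + (x + 1)^-1 ^+ 2 = 2 - (x + 1)^-1 - x^-1 * (x + 1)^-1 ^+ 2.
  by field; rewrite !gt_eqF.
by rewrite gerBl mulr_ge0 ?sqr_ge0// invr_ge0 ltW.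
Qed.

End Geometric.

Section Data.
Context {R : realType} (beta : R[i]) (b0 : beta != 0) (e : bool).
Implicit Types (x : R) (z : R[i]).

Let B : R := sqmod beta.
Let q : R := expR (- B).

Let B0 : 0 < B. Proof. by rewrite exprn_gt0// normc_gt0. Qed.
Let q01 : 0 <= q < 1. Proof. by rewrite expR_ge0 -expR0 ltr_expR oppr_lt0 B0. Qed.

(** The data are the derivatives at 0 of the sum over i of
    (-1)^(i+1) / (i+1) times the translate of the constant 1 by ypt i * beta.
    The coefficients 1 / (i+1) are square summable but not summable. *)
Definition ypt (i : nat) : R := 2 * i.+1%:R.
Definition weight (i : nat) : R := i.+1%:R^-1 * kcoef beta (ypt i).
Definition signed_weight (i : nat) : R := (-1) ^+ i.+1 * weight i.

Lemma ypt_ge0 i : 0 <= ypt i. Proof. by rewrite mulr_ge0. Qed.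
Lemma weight_ge0 i : 0 <= weight i.
Proof. by rewrite mulr_ge0 ?kcoef_ge0// invr_ge0. Qed.
Lemma norm_signed_weight i : `|signed_weight i| = weight i.
Proof. by rewrite normrM normrX normrN1 expr1n mul1r ger0_norm// weight_ge0. Qed.

(** Completing the square: yx <= y^2 B / 4 + x^2 / B with y = ypt i, and
    y^2 / 4 = (i+1)^2 >= i. *)
Lemma weight_exp x i : weight i * expR (ypt i * x) <= expR (x ^+ 2 / B) * q ^+ i.
Proof.
apply: (@le_trans _ _ (kcoef beta (ypt i) * expR (ypt i * x))).
  rewrite ler_wpM2r ?expR_ge0// /weight ler_piMl ?kcoef_ge0//.
  by rewrite invf_le1// ler1n.
have -> : q ^+ i = expR (- (i%:R * B)) by rewrite /q -expRM_natl mulrN.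
rewrite /kcoef -/B -!expRD ler_expR.
have : 0 <= (ypt i * B / 2 - x) ^+ 2 / B by rewrite divr_ge0 ?sqr_ge0// ltW.
have -> : (ypt i * B / 2 - x) ^+ 2 / B = ypt i ^+ 2 * B / 4 - ypt i * x + x ^+ 2 / B.
  by field; rewrite gt_eqF.
have : i%:R * B <= ypt i ^+ 2 * B / 4.
  have -> : ypt i ^+ 2 * B / 4 = (i.+1 ^ 2)%:R * B by rewrite /ypt natrX; field.
  apply: ler_wpM2r; first exact: ltW.
  by rewrite ler_nat; nia.
lra.
Qed.

(** The moments of the weights, truncated and complete. *)
Definition psum (M j : nat) : R := series (fun i => signed_weight i * ypt i ^+ j) M.
Definition msum (j : nat) : R := limn (fun M => psum M j).

Lemma weight_pow i j : weight i * ypt i ^+ j <= j`!%:R * expR B^-1 * q ^+ i.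
Proof.
have fj : (0 : R) < j`!%:R by rewrite ltr0n fact_gt0.
rewrite -mulrA -ler_pdivrMl// mulrCA [_ * ypt i ^+ j]mulrC.
have := weight_exp 1 i; rewrite expr1n mul1r mulr1; apply: le_trans.
apply: ler_wpM2l; first exact: weight_ge0.
apply: le_trans (exp_partial_sum j.+1 (ypt_ge0 i)).
by rewrite big_ord_recr /= lerDr sumr_ge0// => k _; rewrite divr_ge0// exprn_ge0// ypt_ge0.
Qed.

Lemma msum_cvg j : (fun M => psum M j) @ \oo --> msum j.
Proof.
suff : cvgn (fun M => psum M j) by [].
apply: (@normed_cvg R R^o (fun i => signed_weight i * ypt i ^+ j)).
apply: (@series_le_cvg _ _ (geometric (j`!%:R * expR B^-1) q)).
- by move=> i /=; rewrite normr_ge0.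
- by move=> i /=; rewrite !mulr_ge0 ?expR_ge0// exprn_ge0// ?expR_ge0.
- move=> i /=; rewrite normrM norm_signed_weight normrX (ger0_norm (ypt_ge0 i)).
  exact: weight_pow.
- by apply: is_cvg_geometric_series; have /andP[? ?] := q01; rewrite ger0_norm.
Qed.

(** Uniformity in n is what allows the exchange of the Taylor series in j with
    the sum over the sources. *)
Lemma tail_bound (x : R) (n M : nat) : 0 <= x ->
  \sum_(j < n) `|msum j - psum M j| * x ^+ j / j`!%:R <= expR (x ^+ 2 / B) * (q ^+ M / (1 - q)).
Proof.
move=> x0.
have C : (fun M' => \sum_(j < n) `|psum M' j - psum M j| * x ^+ j / j`!%:R) @ \oo -->
    \sum_(j < n) `|msum j - psum M j| * x ^+ j / j`!%:R.
  apply: cvg_big; first exact: add_continuous.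
  move=> j _; apply: cvgMr_tmp; apply: cvgMr_tmp; apply: cvg_norm.
  by apply: cvgB; [exact: msum_cvg|exact: cvg_cst].
apply: (cvgr_to_le C); near=> M'.
have MM' : (M <= M')%N by near: M'; exact: nbhs_infty_ge.
apply: (@le_trans _ _ (\sum_(j < n) \sum_(M <= i < M') weight i * ((ypt i * x) ^+ j / j`!%:R))).
  apply: ler_sum => j _; rewrite sub_series_geq//.
  have -> : \sum_(M <= i < M') weight i * ((ypt i * x) ^+ j / j`!%:R) =
     (\sum_(M <= i < M') weight i * ypt i ^+ j) * x ^+ j / j`!%:R.
    by rewrite !mulr_suml; apply: eq_bigr => i _; rewrite exprMn !mulrA.
  rewrite -!mulrA; apply: ler_wpM2r; first by rewrite divr_ge0// exprn_ge0.
  apply: le_trans (ler_norm_sum _ _ _) _; apply: ler_sum => i _.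
  by rewrite normrM norm_signed_weight normrX (ger0_norm (ypt_ge0 i)).
rewrite exchange_big /=.
apply: (@le_trans _ _ (\sum_(M <= i < M') expR (x ^+ 2 / B) * q ^+ i)).
  apply: ler_sum => i _; rewrite -mulr_sumr; apply: le_trans (weight_exp x i).
  apply: ler_wpM2l; first exact: weight_ge0.
  by apply: exp_partial_sum; rewrite mulr_ge0// ypt_ge0.
by rewrite -mulr_sumr ler_wpM2l ?expR_ge0//; exact: geometric_sum_le.
Unshelve. all: by end_near. Qed.

(** Expanding the square and summing over j first gives the Gram matrix of the
    translates, whose entries decay like q^(2 |i - k|^2) and hence at least
    geometrically; Schur's test applies. *)
Lemma psum_sqr_sum (M J : nat) :
  \sum_(j < J) psum M j ^+ 2 * B ^+ j / j`!%:R <= 4 / (1 - q).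
Proof.
apply: (@le_trans _ _ (\sum_(j < J) \sum_(i < M) \sum_(k < M) weight i * weight k * ((B * (ypt i * ypt k)) ^+ j / j`!%:R))).
  apply: ler_sum => j _.
  have -> : \sum_(i < M) \sum_(k < M) weight i * weight k * ((B * (ypt i * ypt k)) ^+ j / j`!%:R) =
    (\sum_(i < M) weight i * ypt i ^+ j) ^+ 2 * B ^+ j / j`!%:R.
    rewrite expr2 !mulr_suml; apply: eq_bigr => i _; rewrite mulr_sumr !mulr_suml.
    by apply: eq_bigr => k _; rewrite !exprMn; ring.
  apply: ler_wpM2r; first by rewrite invr_ge0.
  apply: ler_wpM2r; first by rewrite exprn_ge0// ltW.
  rewrite -[leLHS]real_normK ?num_real// lerXn2r ?nnegrE//.
    by apply: sumr_ge0 => i _; rewrite mulr_ge0 ?weight_ge0// exprn_ge0// ypt_ge0.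
  rewrite /psum seriesEord; apply: le_trans (ler_norm_sum _ _ _) _; apply: ler_sum => i _.
  by rewrite normrM norm_signed_weight normrX (ger0_norm (ypt_ge0 i)).
have -> : 4 / (1 - q) = 2 / (1 - q) * 2 by field; have /andP[_ h] := q01; rewrite gt_eqF// subr_gt0.
have q1 : 0 < 1 - q by have /andP[_ h] := q01; rewrite subr_gt0.
apply: (@le_trans _ _ (2 / (1 - q) * \sum_(i < M) (i.+1%:R^-1) ^+ 2)); last first.
  apply: ler_wpM2l; last exact: sum_inv_sqr_le.
  by rewrite divr_ge0// ltW.
apply: le_trans (schur_geometric (fun i => i.+1%:R^-1) M q01).
rewrite exchange_big /=; apply: ler_sum => i _.
rewrite exchange_big /=; apply: ler_sum => k _.
rewrite -mulr_sumr.
apply: (@le_trans _ _ (weight i * weight k * expR (B * (ypt i * ypt k)))).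
  apply: ler_wpM2l; first by rewrite mulr_ge0 ?weight_ge0.
  apply: exp_partial_sum; apply: mulr_ge0; first exact: ltW.
  by rewrite mulr_ge0 ?ypt_ge0.
have -> : weight i * weight k * expR (B * (ypt i * ypt k)) =
  i.+1%:R^-1 * k.+1%:R^-1 * (kcoef beta (ypt i) * kcoef beta (ypt k) * expR (B * (ypt i * ypt k))).
  by rewrite /weight; ring.
apply: ler_wpM2l; first by rewrite mulr_ge0// invr_ge0.
rewrite /kcoef -/B -!expRD.
have -> : q ^+ (i - k + (k - i)) = expR (- ((i - k + (k - i))%:R * B)) by rewrite /q -expRM_natl mulrN.
rewrite ler_expR.
have -> : - (ypt i ^+ 2 * B / 2) + - (ypt k ^+ 2 * B / 2) + B * (ypt i * ypt k) = - ((ypt i - ypt k) ^+ 2 / 2 * B).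
  by field.
rewrite lerN2; apply: ler_wpM2r; first exact: ltW.
have -> : (ypt i - ypt k) ^+ 2 / 2 = (2 * (i - k + (k - i)) ^ 2)%:R.
  rewrite natrM natrX /ypt -[i.+1%:R]natr1 -[k.+1%:R]natr1.
  have [ik|/ltnW ki] := leqP i k.
    have -> : (i - k + (k - i))%N = (k - i)%N by lia.
    by rewrite natrB//; field.
  have -> : (i - k + (k - i))%N = (i - k)%N by lia.
  by rewrite natrB//; field.
rewrite ler_nat; nia.
Qed.

Lemma msum_sqr_sum (J : nat) :
  \sum_(j < J) msum j ^+ 2 * B ^+ j / j`!%:R <= 4 / (1 - q).
Proof.
have C : (fun M => \sum_(j < J) psum M j ^+ 2 * B ^+ j / j`!%:R) @ \oo -->
    \sum_(j < J) msum j ^+ 2 * B ^+ j / j`!%:R.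
  apply: cvg_big; first exact: add_continuous.
  move=> j _; apply: cvgMr_tmp; apply: cvgMr_tmp; rewrite expr2.
  under eq_fun do rewrite expr2.
  by apply: cvgM; exact: msum_cvg.
by apply: (cvgr_to_le C); apply: nearW => M; exact: psum_sqr_sum.
Qed.

Definition data (j : nat) : R[i] := (msum j)%:C * beta^* ^+ j.

Lemma data_finite (E : set nat) : (weighted_sum E data <= (4 / (1 - q))%:E)%E.
Proof.
have -> : weighted_sum E data = (\esum_(j in E) (msum j ^+ 2 * B ^+ j / j`!%:R)%:E)%E.
  apply: eq_esum => j _; congr (_ / _)%:E.
  rewrite /sqmod Normc.normcM normcR normcX normcJ exprMn real_normK ?num_real//.
  by rewrite /B /sqmod -!exprM mulnC.
apply: esum_nat_le; last exact: msum_sqr_sum.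
by move=> j; rewrite divr_ge0// mulr_ge0 ?sqr_ge0// exprn_ge0// ltW.
Qed.

(** Stated in the real-valued modulus, in which all the error bounds are given. *)
Definition cconv (F : nat -> R[i]) (l : R[i]) := forall d : R, 0 < d ->
  exists N, forall n, (N <= n)%N -> normc (l - F n) <= d.

Lemma cconvD F G l m : cconv F l -> cconv G m -> cconv (fun n => F n + G n) (l + m).
Proof.
move=> HF HG d d0; have d2 : 0 < d / 2 by rewrite divr_gt0.
have [N HN] := HF _ d2; have [N' HN'] := HG _ d2.
exists (maxn N N') => n; rewrite geq_max => /andP[/HN h1 /HN' h2].
have -> : l + m - (F n + G n) = (l - F n) + (m - G n) by ring.
by apply: le_trans (le_normcD _ _) _; lra.
Qed.

Lemma cconvZ F l (w : R[i]) : cconv F l -> cconv (fun n => w * F n) (w * l).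
Proof.
move=> HF d d0; have w0 := normc_ge0 w.
have d1 : 0 < d / (normc w + 1) by rewrite divr_gt0// ltr_wpDl.
have [N HN] := HF _ d1; exists N => n /HN h.
rewrite -mulrBr Normc.normcM; apply: (@le_trans _ _ ((normc w + 1) * (d / (normc w + 1)))).
  by apply: ler_pM => //; [exact: normc_ge0|rewrite lerDl].
by rewrite mulrCA divff ?mulr1// gt_eqF// ltr_wpDl.
Qed.

Lemma cconv_sum M (F : nat -> nat -> R[i]) (l : nat -> R[i]) :
  (forall i, cconv (F i) (l i)) -> cconv (fun n => \sum_(i < M) F i n) (\sum_(i < M) l i).
Proof.
move=> H; elim: M => [|M IH].
  move=> d d0; exists 0%N => n _; rewrite !big_ord0 subrr Normc.normc0; exact: ltW.
rewrite big_ord_recr /=; under eq_fun do rewrite big_ord_recr /=.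
exact: cconvD.
Qed.

Let eta : R[i] := (-1) ^+ e.

Lemma eta_parity j : odd j = ~~ e -> 1 + eta * (-1) ^+ j = 0.
Proof.
move=> oj; rewrite /eta -[(-1) ^+ j]signr_odd oj; case: (e) => /=; ring.
Qed.

Lemma normc_eta : normc eta = 1.
Proof. by rewrite normcX normcN Normc.normc1 expr1n. Qed.

Let zeta (k : nat) : R[i] := (2 * k%:R * B) +i* (pi / 2).
Definition lattice (k : nat) : R[i] := (2 * k%:R +i* (pi / (2 * B))) * beta.

Lemma lattice_zeta k : beta^* * lattice k = zeta k.
Proof.
rewrite /lattice mulrCA mulJ_sqmod -/B; apply: eq_complexP; rewrite ?cReM ?cImM /= !(mulr0, subr0, add0r) //.
by field; rewrite gt_eqF// B0.
Qed.

Lemma cexp_zeta i k :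
  cexp ((ypt i)%:C * zeta k) = (-1) ^+ i.+1 * (expR (ypt i * (2 * k%:R * B)))%:C /\
  cexp (- ((ypt i)%:C * zeta k)) = (-1) ^+ i.+1 * (expR (- (ypt i * (2 * k%:R * B))))%:C.
Proof.
have E : (ypt i)%:C * zeta k = i.+1%:R * (0 +i* pi) + (ypt i * (2 * k%:R * B))%:C :> R[i].
  rewrite -(rmorph_nat (real_complex R)).
  by apply: eq_complexP; rewrite ?cReD ?cImD ?cReM ?cImM /= /ypt; field.
have s2 : (-1) ^+ i.+1 * (-1) ^+ i.+1 = 1 :> R[i] by rewrite -expr2 sqrr_sign.
split; first by rewrite E cexpD cexp_nat cexp_ipi cexp_real.
rewrite E opprD cexpD -rmorphN cexp_real; congr (_ * _).
have E2 : cexp (i.+1%:R * (0 +i* pi)) = (-1) ^+ i.+1 :> R[i] by rewrite cexp_nat cexp_ipi.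
have := cexpN (i.+1%:R * (0 +i* pi) : R[i]); rewrite E2.
move: (cexp (- _)) ((-1) ^+ i.+1) s2 => X s ss Xs.
by rewrite -[X]mulr1 -ss mulrA Xs mul1r.
Qed.

(** Twice the component of parity e of the first M sources, at lattice k. *)
Definition psum_part M k : R[i] := \sum_(i < M) (signed_weight i)%:C *
  (cexp ((ypt i)%:C * zeta k) + eta * cexp (- ((ypt i)%:C * zeta k))).

Lemma psum_part_conv M k : cconv (fun n => \sum_(j < n) (1 + eta * (-1) ^+ j) * ((psum M j)%:C * zeta k ^+ j / j`!%:R)) (psum_part M k).
Proof.
have -> : (fun n => \sum_(j < n) (1 + eta * (-1) ^+ j) * ((psum M j)%:C * zeta k ^+ j / j`!%:R)) =
  (fun n => \sum_(i < M) (signed_weight i)%:C *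
    (\sum_(j < n) ((ypt i)%:C * zeta k) ^+ j / j`!%:R + eta * \sum_(j < n) (- ((ypt i)%:C * zeta k)) ^+ j / j`!%:R)).
  apply/funext => n.
  have -> : \sum_(i < M) (signed_weight i)%:C *
    (\sum_(j < n) ((ypt i)%:C * zeta k) ^+ j / j`!%:R + eta * \sum_(j < n) (- ((ypt i)%:C * zeta k)) ^+ j / j`!%:R) =
    \sum_(i < M) \sum_(j < n) (1 + eta * (-1) ^+ j) * ((signed_weight i * ypt i ^+ j)%:C * zeta k ^+ j / j`!%:R).
    apply: eq_bigr => i _; rewrite [eta * _]mulr_sumr -big_split /= mulr_sumr; apply: eq_bigr => j _.
    have -> : (signed_weight i * ypt i ^+ j)%:C = (signed_weight i)%:C * (ypt i)%:C ^+ j.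
      by rewrite rmorphM rmorphXn.
    rewrite [(- (_ * _)) ^+ j]exprNn exprMn.
    move: (zeta k ^+ j) ((ypt i)%:C ^+ j) (j`!%:R^-1) ((-1) ^+ j) => *; ring.
  rewrite exchange_big /=; apply: eq_bigr => j _.
  by rewrite /psum seriesEord rmorph_sum -mulr_sumr !mulr_suml.
apply: (cconv_sum M (F := fun i n => (signed_weight i)%:C *
    (\sum_(j < n) ((ypt i)%:C * zeta k) ^+ j / j`!%:R + eta * \sum_(j < n) (- ((ypt i)%:C * zeta k)) ^+ j / j`!%:R))
  (l := fun i => (signed_weight i)%:C * (cexp ((ypt i)%:C * zeta k) + eta * cexp (- ((ypt i)%:C * zeta k))))) => i.
apply: cconvZ; apply: cconvD; last apply: cconvZ.
  by move=> d d0; exact: cexp_taylor.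
by move=> d d0; exact: cexp_taylor.
Qed.

(** All terms are nonnegative: the phases at the lattice points cancel the signs
    of the weights.  The diagonal term alone gives the bound. *)
Lemma psum_part_lower M k : (k < M)%N ->
  k.+1%:R^-1 * (1 - expR (- (8 * B))) <= kcoef beta (ypt k) * cRe (psum_part M k.+1).
Proof.
move=> kM.
pose s : R := (-1) ^+ e.
pose X i := expR (ypt i * (ypt k * B)) + s * expR (- (ypt i * (ypt k * B))).
have E : psum_part M k.+1 = (\sum_(i < M) weight i * X i)%:C.
  rewrite /psum_part rmorph_sum; apply: eq_bigr => i _.
  have [-> ->] := cexp_zeta i k.+1; rewrite -/(ypt k).
  have -> : eta = s%:C by rewrite /eta /s rmorphXn rmorphN1.
  have s2 : (-1) ^+ i.+1 * (-1) ^+ i.+1 = 1 :> R[i] by rewrite -expr2 sqrr_sign.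
  have -> : (signed_weight i)%:C = (-1) ^+ i.+1 * (weight i)%:C.
    by rewrite rmorphM rmorphXn rmorphN1.
  rewrite [RHS](_ : _ = (weight i)%:C * ((expR (ypt i * (ypt k * B)))%:C + s%:C * (expR (- (ypt i * (ypt k * B))))%:C)).
    2: by rewrite /X; apply: eq_complexP; rewrite !(cReM, cImM, cReD, cImD) /=; ring.
  rewrite -[RHS]mul1r -[in RHS]s2; move: ((-1) ^+ i.+1) => sg; ring.
have X0 i : expR (ypt i * (ypt k * B)) - expR (- (ypt i * (ypt k * B))) <= X i.
  by rewrite /X /s; have := expR_ge0 (- (ypt i * (ypt k * B))); case: (e) => /=; rewrite ?expr0 ?expr1 ?mulN1r ?mul1r; lra.
have Xge0 i : 0 <= X i.
  apply: le_trans (X0 i); rewrite subr_ge0 ler_expR.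
  have : 0 <= ypt i * (ypt k * B) by rewrite mulr_ge0 ?ypt_ge0// mulr_ge0 ?ypt_ge0 ?(ltW B0).
  lra.
rewrite E /=.
apply: (@le_trans _ _ (kcoef beta (ypt k) * (weight k * X k))); last first.
  apply: ler_wpM2l; first exact: kcoef_ge0.
  rewrite (bigD1 (Ordinal kM)) //= lerDl sumr_ge0// => i _; by rewrite mulr_ge0// weight_ge0.
have -> : kcoef beta (ypt k) * (weight k * X k) = k.+1%:R^-1 * (kcoef beta (ypt k) * kcoef beta (ypt k) * X k).
  by rewrite /weight; ring.
apply: ler_wpM2l; first by rewrite invr_ge0.
apply: le_trans (ler_wpM2l _ (X0 k)); last by rewrite mulr_ge0 ?kcoef_ge0.
rewrite mulrBr /kcoef -/B -!expRD.
have -> : - (ypt k ^+ 2 * B / 2) + - (ypt k ^+ 2 * B / 2) + ypt k * (ypt k * B) = 0 by field.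
rewrite expR0 lerD2l lerN2 ler_expR.
have : B <= k.+1%:R ^+ 2 * B.
  by rewrite -[leLHS]mul1r ler_wpM2r ?(ltW B0)// exprn_ege1// ler1n.
rewrite /ypt exprMn; lra.
Qed.

(** The prescribed derivatives determine the component of parity e of f through
    its Taylor series, so that the bound of the finite sums persists. *)
Lemma part_lower f k : entire f -> (forall j, odd j = e -> cderivn j f 0 = data j) ->
  k.+1%:R^-1 * (1 - expR (- (8 * B))) <=
  kcoef beta (ypt k) * cRe (f (lattice k.+1) + eta * f (- lattice k.+1)).
Proof.
move=> ef Hf; set u := lattice k.+1; set A := f u + _.
apply/ler_addgt0Pr => d d0.
have d4 : 0 < d / 4 by rewrite divr_gt0.
have cA : cconv (fun n => \sum_(j < n) (1 + eta * (-1) ^+ j) * ((msum j)%:C * zeta k.+1 ^+ j / j`!%:R)) A.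
  have -> : (fun n => \sum_(j < n) (1 + eta * (-1) ^+ j) * ((msum j)%:C * zeta k.+1 ^+ j / j`!%:R)) =
    (fun n => \sum_(j < n) (cderivn j f 0 / j`!%:R) * u ^+ j + eta * \sum_(j < n) (cderivn j f 0 / j`!%:R) * (- u) ^+ j).
    apply/funext => n; rewrite mulr_sumr -big_split /=; apply: eq_bigr => j _.
    have -> : cderivn j f 0 / j`!%:R * u ^+ j + eta * (cderivn j f 0 / j`!%:R * (- u) ^+ j) =
      (1 + eta * (-1) ^+ j) * (cderivn j f 0 * u ^+ j / j`!%:R).
      rewrite [(- u) ^+ j]exprNn; ring.
    have [oj|oj] := eqVneq (odd j) e.
      by rewrite Hf// /data -[_ * u ^+ j]mulrA -exprMn lattice_zeta.
    have {}oj : odd j = ~~ e by move: oj; clear; case: (odd j); case: e.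
    by rewrite eta_parity// !mul0r.
  apply: cconvD; last apply: cconvZ; move=> c c0; exact: taylor_cvg.
pose Z := normc (zeta k.+1).
have Z0 : 0 <= Z by exact: normc_ge0.
have /andP[q0 q1] := q01.
have [M [kM HM]] : exists M, (k < M)%N /\ expR (Z ^+ 2 / B) * (q ^+ M / (1 - q)) <= d / 4 / 2.
  have c0 : 0 < expR (Z ^+ 2 / B) / (1 - q) by rewrite divr_gt0 ?expR_gt0// subr_gt0.
  have C : (fun M => q ^+ M) @ \oo --> (0 : R) by apply: cvg_expr; rewrite ger0_norm.
  have h : 0 < d / 4 / 2 / (expR (Z ^+ 2 / B) / (1 - q)) by apply: divr_gt0 => //; rewrite divr_gt0.
  move/cvgrPdist_le: C => /(_ _ h)[M _ HM]; exists (maxn M k.+1); split; first by rewrite leq_maxr.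
  have := HM (maxn M k.+1) (leq_maxl _ _); rewrite sub0r normrN ger0_norm ?exprn_ge0// ler_pdivlMr//.
  by apply: le_trans; rewrite le_eqVlt; apply/orP; left; apply/eqP; ring.
have [N1 H1] := cA _ d4.
have [N2 H2] := psum_part_conv M k.+1 d4.
pose n := maxn N1 N2.
have {}H1 := H1 n (leq_maxl _ _). have {}H2 := H2 n (leq_maxr _ _).
set An := \sum_(j < n) _ in H1; set Pn := \sum_(j < n) _ in H2.
have H3 : normc (An - Pn) <= d / 4.
  rewrite /An /Pn -sumrB; apply: le_trans (normc_sum _ _ _) _.
  have -> : d / 4 = 2 * (d / 4 / 2) by field.
  apply: (@le_trans _ _ (2 * \sum_(j < n) `|msum j - psum M j| * Z ^+ j / j`!%:R)); last first.
    by apply: ler_wpM2l => //; apply: le_trans HM; exact: tail_bound.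
  rewrite mulr_sumr; apply: ler_sum => j _.
  have -> : (1 + eta * (-1) ^+ j) * ((msum j)%:C * zeta k.+1 ^+ j / j`!%:R) -
      (1 + eta * (-1) ^+ j) * ((psum M j)%:C * zeta k.+1 ^+ j / j`!%:R) =
    (1 + eta * (-1) ^+ j) * ((msum j - psum M j)%:C * zeta k.+1 ^+ j / j`!%:R).
    rewrite rmorphB; ring.
  rewrite Normc.normcM; apply: ler_pM; rewrite ?normc_ge0//.
    apply: le_trans (le_normcD _ _) _; rewrite Normc.normc1 Normc.normcM normc_eta mul1r.
    by rewrite normcX normcN Normc.normc1 expr1n.
  rewrite !Normc.normcM normcR normcX Normc.normcV.
  have -> : normc (j`!%:R : R[i]) = j`!%:R by rewrite -(rmorph_nat (real_complex R)) normcR normr_nat.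
  by [].
have H4 : normc (A - psum_part M k.+1) <= 3 * (d / 4).
  have -> : A - psum_part M k.+1 = (A - An) + ((An - Pn) + (Pn - psum_part M k.+1)) by ring.
  apply: le_trans (le_normcD _ _) _; apply: le_trans (lerD (lexx _) (le_normcD _ _)) _.
  rewrite [normc (Pn - _)]normcB; lra.
have H5 := psum_part_lower kM.
have kc1 : kcoef beta (ypt k) <= 1.
  rewrite -expR0 /kcoef ler_expR oppr_le0 divr_ge0// mulr_ge0 ?sqr_ge0//; exact: sqr_ge0.
have kc0 := kcoef_ge0 beta (ypt k).
have := le_trans (Re_lip (psum_part M k.+1) A) _; rewrite normcB => /(_ _ H4).
rewrite ler_norml => /andP[_ h].
have : kcoef beta (ypt k) * (cRe (psum_part M k.+1) - cRe A) <= 1 * (3 * (d / 4)).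
  apply: (@le_trans _ _ (kcoef beta (ypt k) * (3 * (d / 4)))); first exact: ler_wpM2l.
  by apply: ler_wpM2r => //; lra.
rewrite mulrBr; move: H5 d0; clear.
move: (_ * cRe (psum_part _ _)) (_ * cRe A) (_ * (1 - _)) => P Q L; lra.
Qed.

(** The Taylor coefficients of the translate of the wrong parity vanish. *)
Lemma translate_parity f : entire f ->
  (forall j, odd j = ~~ e -> cderivn j (fock_translate beta f) 0 = 0) ->
  forall z, fock_translate beta f (- z) = eta * fock_translate beta f z.
Proof.
move=> ef Hf z; have eG := entire_translate (beta := beta) ef.
set G := fock_translate beta f in Hf eG *.
apply/eqP; rewrite -subr_eq0 -normc_eq0 eq_le normc_ge0 andbT.
apply/ler_addgt0Pl => d d0; rewrite addr0.
have d2 : 0 < d / 2 by rewrite divr_gt0.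
have [N1 H1] := taylor_cvg (- z) eG d2.
have [N2 H2] := taylor_cvg z eG d2.
pose n := maxn N1 N2.
have {}H1 := H1 n (leq_maxl _ _). have {}H2 := H2 n (leq_maxr _ _).
set S1 := \sum_(j < n) _ in H1; set S2 := \sum_(j < n) _ in H2.
have E : S1 = eta * S2.
  rewrite /S1 /S2 mulr_sumr; apply: eq_bigr => j _.
  have [oj|oj] := eqVneq (odd j) e.
    have -> : eta = (-1) ^+ j by rewrite /eta -oj signr_odd.
    by rewrite [(- z) ^+ j]exprNn mulrCA.
  have {}oj : odd j = ~~ e by move: oj; clear; case: (odd j); case: e.
  by rewrite Hf// !mul0r mulr0.
have -> : G (- z) - eta * G z = (G (- z) - S1) - eta * (G z - S2) by rewrite E; ring.
apply: le_trans (le_normcD _ _) _; rewrite normcN Normc.normcM normc_eta mul1r; lra.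
Qed.

(** The parity of the translate relates the values of f at w and - w - 2 beta,
    and lattice k.+1 = lattice k + 2 beta. *)
Lemma lattice_step f k : entire f ->
  (forall j, odd j = ~~ e -> cderivn j (fock_translate beta f) 0 = 0) ->
  eta * f (- lattice k.+1) = - (expR ((4 * k%:R + 2) * B))%:C * f (lattice k).
Proof.
move=> ef Hf; have := translate_parity ef Hf (lattice k + beta).
have uS : lattice k.+1 = lattice k + beta + beta.
  by rewrite /lattice; apply: eq_complexP; rewrite ?cReD ?cImD ?cReM ?cImM /= -natr1; ring.
rewrite /fock_translate addrK.
have -> : - (lattice k + beta) - beta = - lattice k.+1 by rewrite uS; ring.
set c := - (2^-1 * _); rewrite !cexpD => H.
have c0 : cexp c != 0 by rewrite -normc_gt0 normc_cexp expR_gt0.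
have {}H : cexp (beta^* * - (lattice k + beta)) * f (- lattice k.+1) = eta * (cexp (beta^* * (lattice k + beta)) * f (lattice k)).
  by apply: (mulfI c0); rewrite !mulrA in H *; rewrite H; ring.
have e2 : eta * eta = 1 by rewrite /eta -expr2 sqrr_sign.
set v := beta^* * (lattice k + beta) in H.
rewrite mulrN -/v in H.
have F : f (- lattice k.+1) = cexp v * (eta * (cexp v * f (lattice k))).
  by rewrite -H mulrA [cexp v * _]mulrC cexpN mul1r.
have V : cexp v * cexp v = - (expR ((4 * k%:R + 2) * B))%:C.
  rewrite -cexpD.
  have -> : v + v = (0 +i* pi) + ((4 * k%:R + 2) * B)%:C.
    rewrite /v mulrDr lattice_zeta mulJ_sqmod -/B.
    by apply: eq_complexP; rewrite ?cReD ?cImD /=; field.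
  by rewrite cexpD cexp_ipi cexp_real mulN1r.
rewrite F -V; have -> : eta * (cexp v * (eta * (cexp v * f (lattice k)))) = (eta * eta) * (cexp v * cexp v * f (lattice k)) by ring.
by rewrite e2 mul1r.
Qed.

(** With phi the normalized values of f at the lattice points, the two previous
    lemmas give phi (k+1) - phi k >= c / (k+1).  So phi is unbounded, which is
    impossible as point evaluations are bounded on Fock space. *)
Lemma parity_not_interpolation (E : set nat) :
  (forall j, E j <-> odd j = e) -> ~ deep_interpolation E beta.
Proof.
move=> HE H.
have [|f [ff Hf1 Hf2]] := H data (fun=> 0).
  have -> : weighted_sum (~` E) (fun=> 0 : R[i]) = 0%E.
    by apply: esum1 => j _; rewrite /sqmod Normc.normc0 expr0n mul0r.
  by rewrite adde0; apply: le_lt_trans (data_finite E) _; exact: ltry.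
have [ef _] := ff.
have g1 j : odd j = e -> cderivn j f 0 = data j by move=> /HE; exact: Hf1.
have g2 j : odd j = ~~ e -> cderivn j (fock_translate beta f) 0 = 0.
  by move=> oj; apply: Hf2 => /HE; rewrite oj; case: (e).
pose kc (k : nat) := kcoef beta (2 * k%:R).
pose phi k := kc k * cRe (f (lattice k)).
pose c : R := 1 - expR (- (8 * B)).
have c0 : 0 < c by rewrite /c subr_gt0 -expR0 ltr_expR oppr_lt0 mulr_gt0 ?B0.
have step k : c * k.+1%:R^-1 <= phi k.+1 - phi k.
  have := part_lower k ef g1; rewrite -/c lattice_step// mulrC cReD => /le_trans; apply.
  have Es (x : R) (w : R[i]) : cRe (- x%:C * w) = - (x * cRe w) by rewrite cReM /=; ring.
  rewrite Es mulrDr /phi -/(kc k.+1) lerD2l le_eqVlt.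
  have -> : kc k = kc k.+1 * expR ((4 * k%:R + 2) * B).
    by rewrite /kc /kcoef -expRD; congr expR; rewrite -/B -natr1; field.
  by apply/orP; left; apply/eqP; ring.
have sum N : c * series harmonic N <= phi N - phi 0%N.
  elim: N => [|N IH]; first by rewrite /series /= big_geq// mulr0 subrr.
  by rewrite seriesS mulrDr; apply: le_trans (lerD (step N) IH) _; rewrite addrA subrK.
have [C HC] := fock_density_bound ff.
pose s := pi / (2 * B).
have ub N : phi N <= C * expR (s ^+ 2 * B) + 1.
  have : phi N ^+ 2 <= C * expR (s ^+ 2 * B).
    apply: (@le_trans _ _ (fock_density f (lattice N) * expR (s ^+ 2 * B))); last first.
      by apply: ler_wpM2r; [exact: expR_ge0|exact: HC].
    have -> : fock_density f (lattice N) * expR (s ^+ 2 * B) = kc N ^+ 2 * sqmod (f (lattice N)).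
      have sl : sqmod (lattice N) = ((2 * N%:R) ^+ 2 + s ^+ 2) * B.
        by rewrite /lattice {1}/sqmod Normc.normcM exprMn -!/(sqmod _) -/B [sqmod (_ +i* _)]sqmodE.
      rewrite /fock_density sl -mulrA -expRD mulrC; congr (_ * _).
      by rewrite [RHS]expr2 /kc /kcoef -expRD; congr expR; rewrite -/B; field.
    rewrite [leLHS]exprMn; apply: ler_wpM2l; first exact: sqr_ge0.
    by rewrite sqmodE lerDl sqr_ge0.
  have := sqr_ge0 (phi N - 1); rewrite sqrrB1; have := sqr_ge0 (phi N); lra.
apply: (@dvg_harmonic R); apply: nondecreasing_is_cvgn.
  by apply: nondecreasing_series => n _ _; exact: harmonic_ge0.
exists ((C * expR (s ^+ 2 * B) + 1 - phi 0%N) / c) => _ [N _ <-].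
rewrite ler_pdivlMr// mulrC; apply: le_trans (sum N) _.
by rewrite lerD2r.
Qed.

End Data.

Theorem theorem1p5 (R : realType) (E : set nat) (beta : R[i])
  (hE : E = [set n | ~~ odd n] \/ E = [set n | odd n])
  (hbeta : beta != 0) :
  ~ deep_interpolation E beta /\ ~ deep_sampling E beta.
Proof.
have [e He] : exists e, forall j, E j <-> odd j = e.
  case: hE => ->; [exists false|exists true] => j //=; by case: (odd j).
split; first exact: (@parity_not_interpolation R beta hbeta e E He).
exact: (@parity_not_sampling R beta e E hbeta He).
Qed.
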